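(* Let $\xi>0$, $\mathsf{p}>12$ and $\mathsf{K}>0$. Let $w=\{w_{ij}\}_{i,j\ge 1}$ be independent real random variables on a probability space $(\Omega_w,\mathcal{F}_w,\mathbb{P}_w)$ with $\mathbb{E}_w w_{ij}=0$, $\mathbb{E}_w w_{ij}^2=1$ and $\mathbb{E}_w|w_{ij}|^{\mathsf{p}}\le \mathsf{K}$ for all $i,j$. Fix a finite $\ell$ and real numbers $0<\xi_1<\ldots<\xi_\ell<\xi$ and $0<\zeta_1<\ldots<\zeta_\ell<1$. For each $N$ put $M=\lfloor \xi N\rfloor$ and let $\sigma=\sigma_N$ be chosen uniformly at random, with law $\mathbb{P}_\sigma$ and independently of $w$, from all up-right paths from $(1,1)$ to $(M,N)$ in $\square_{M,N}$ that pass through each of the points $(\lfloor \xi_i N\rfloor,\lfloor \zeta_i N\rfloor)$, $i=1,\ldots,\ell$. Then for $\mathbb{P}_w$-almost every environment $w$, $$\frac{1}{\sqrt{M+N-1}}\sum_{(i,j)\in \sigma}w_{ij}\ \xrightarrow{\ \mathscr{D}\ }\ \mathscr{N}(0,1),\qquad N\to\infty,$$ where, with $w$ held fixed, the convergence in distribution to the standard normal is with respect to $\mathbb{P}_\sigma$.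
   Context: $\square_{M,N}=\{(i,j)\in\mathbb{Z}^2: 1\le i\le M,\ 1\le j\le N\}$. An up-right path from $(1,1)$ to $(M,N)$ is a collection $\{(i_k,j_k): k=1,\ldots,M+N-1\}$ with $(i_1,j_1)=(1,1)$, $(i_{M+N-1},j_{M+N-1})=(M,N)$, and $(i_{k+1}-i_k,j_{k+1}-j_k)\in\{(1,0),(0,1)\}$ for each $k$. The weights $w_{ij}$ are independent but not necessarily identically distributed; the same environment $w$ on $\mathbb{Z}_{\ge1}^2$ is used for all $N$. Only $N$ large enough that $M\ge1$ and all the prescribed points lie in $\square_{M,N}$ are considered. *)

(* Defs.v *)
From mathcomp Require Import all_boot all_order all_algebra.
From mathcomp Require Import finmap.
From mathcomp Require Import all_classical all_reals all_analysis.
Export numFieldNormedType.Exports.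

Set Implicit Arguments.
Unset Strict Implicit.
Unset Printing Implicit Defensive.

Import Order.TTheory GRing.Theory Num.Theory.

Local Open Scope classical_set_scope.
Local Open Scope ring_scope.

(* Mutual independence of the subfamily (X i), i in D. *)
Definition independent_RVs (d d' : measure_display) (T : measurableType d)
    (T' : measurableType d') (R : realType) (P : probability T R)
    (I : choiceType) (D : set I) (X : I -> {RV P >-> T'}) : Prop :=
  forall (J : {fset I}) (B : I -> set T'),
    [set` J] `<=` D ->
    (forall i, i \in J -> measurable (B i)) ->
    P (\bigcap_(i in [set` J]) (X i @^-1` B i)) =
    (\prod_(i <- J) P (X i @^-1` B i))%E.

(* Convergence of distribution functions at the continuity points of the
   limiting one. The approximating laws are plain set functions, so that
   finitely many of them may be degenerate. *)
Definition cvg_in_distribution (R : realType) (mu_ : nat -> set R -> \bar R)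
    (mu : probability (measurableTypeR R) R) : Prop :=
  forall x : R, {for x, continuous (fun t : R => mu `]-oo, t]%classic)} ->
    mu_ n `]-oo, x]%classic @[n --> \oo] --> mu `]-oo, x]%classic.

(* The value is 0 for every event when A is empty. *)
Definition unif_prob (R : realType) (T : finType) (A : {set T}) (E : set T) :
    \bar R :=
  (#|[pred t in A | t \in E]|%:R / #|A|%:R)%:E.

Definition quadrant : set (nat * nat) :=
  [set z | (1 <= z.1)%N /\ (1 <= z.2)%N].

(* The box [1, M] x [1, N] is the type 'I_M * 'I_N, whose elements are shifted
   by one to get lattice points. *)
Definition lattice_point (M N : nat) (z : 'I_M * 'I_N) : nat * nat :=
  (z.1.+1, z.2.+1).

Definition up_right_step (y z : nat * nat) : bool :=
  (z == (y.1.+1, y.2)) || (z == (y.1, y.2.+1)).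

(* A path visits distinct points in increasing order, so the sequence
   (i_k, j_k) and the collection of its points determine each other. *)
Definition up_right_path (M N : nat) (s : seq (nat * nat)) : bool :=
  [&& size s == (M + N - 1)%N, head (0, 0)%N s == (1, 1)%N,
      last (0, 0)%N s == (M, N) & sorted up_right_step s].

Definition box_path (M N : nat) : finType :=
  ((M + N - 1).-tuple ('I_M * 'I_N))%type.

Definition points (M N : nat) (s : box_path M N) : seq (nat * nat) :=
  map (@lattice_point M N) s.

Definition paths_through (M N l : nat) (a : 'I_l -> nat * nat) :
    {set box_path M N} :=
  [set s : box_path M N |
    up_right_path M N (points s) & [forall i, a i \in points s]]%SET.

Definition path_sum (R : realType) (M N : nat) (v : nat * nat -> R)
    (s : box_path M N) : R :=
  (Num.sqrt (M + N - 1)%:R)^-1 * \sum_(z <- points s) v z.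

Definition path_sum_law (R : realType) (M N l : nat) (a : 'I_l -> nat * nat)
    (v : nat * nat -> R) (B : set R) : \bar R :=
  unif_prob R (paths_through M N a) (@path_sum R M N v @^-1` B).

(* Num.truncn is the floor on nonnegative reals. *)
Definition scaled (R : realType) (x : R) (N : nat) : nat :=
  Num.truncn (x * N%:R).

(* Main.v *)
(* For the normal distribution function Phi, the functions
   u_t(y) = Phi((a - y) / sqrt t) solve the heat equation.  Hence, along a fixed
   path, integrating out the weights one after the other (Lindeberg) shows that
   the expectation over w of u_{e^2}(T_sigma), T_sigma being the normalized path
   sum, tends to Phi(a / sqrt(1 + e^2)).

   The quenched average of u_{e^2}(T_sigma) over sigma is a function of the
   independent weights, truncated at N^nu and rounded to a grid of mesh 1/N, and
   w_z influences it by O(P_sigma(z in sigma) N^nu / sqrt N).  Since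
   sum_z P_sigma(z in sigma)^2 = O(sqrt N), the bounded differences inequality
   makes its fluctuations smaller than any constant, up to a probability
   exp(- c N^(1/4 - nu)).  The truncation costs a probability N^(2 - nu p), so
   Borel-Cantelli applies as soon as 3/p < nu < 1/4, which is possible for
   p > 12.  Letting e tend to 0 turns u_{e^2} into an indicator.

   For the overlap bound, the position of sigma at a time at distance k from the
   nearest two prescribed points is hypergeometric, and its largest atom is
   O(k^(-1/2)): exchanging a horizontal step before that time with a vertical
   step after it gives the recurrence between consecutive atoms, and by this
   recurrence order sqrt k atoms next to the mode are at least half as large. *)

Require Import Defs.
From HB Require Import structures.
From mathcomp Require Import all_boot all_order all_algebra perm finmap.
From mathcomp Require Import all_classical all_reals all_analysis.
From mathcomp Require Import measurable_realfun ring lra zify.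

Set Implicit Arguments.
Unset Strict Implicit.
Unset Printing Implicit Defensive.

Import Order.TTheory GRing.Theory Num.Theory.

(** * The largest atom of the hypergeometric distribution *)

(** The indicator of T_sigma <= x can jump when a single weight moves, so bounded differences are of
    no use for it directly; smoothing makes it Lipschitz in each weight. Smoothing by the normal
    distribution function is chosen because Lindeberg then needs no auxiliary Gaussian weights:
    exchanging a weight for a Gaussian one is the same as advancing the time t by 1/n. Rounding to a
    grid gives every weight a finite law, so expectations are iterated finite sums and independence
    enters only through finite cylinder events. The squared visit probabilities sum to O(sqrt N)
    because, at each time, one of the two factors is at most the largest atom while the other
    factors add up to 1. The Chernoff parameter is not optimized: N^(1/4 - nu) keeps the variance
    term in the exponent bounded, and the remaining stretched exponential is summable. Finally, one
    null set has to serve all x at once, so almost sure convergence is established for countably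
    many parameters and carried to every x by a sandwich. *)

Section hypergeometric_max.
Local Open Scope ring_scope.
Context {R : realType}.
Variables (H : nat -> R) (k L m : nat) (b T : R).
Hypothesis H_ge0 : forall i, 0 <= H i.
Hypothesis H_sum : forall n, \sum_(i < n) H i <= T.
Hypothesis H_rec : forall i,
  H i.+1 * ((i%:R + 1) * (L%:R - k%:R - m%:R + i%:R + 1)) =
  H i * ((k%:R - i%:R) * (m%:R - i%:R)).
Hypotheses (b_gt0 : 0 < b) (k_gt0 : (0 < k)%N) (kL : (2 * k <= L)%N).
Hypotheses (bm : b * L%:R <= m%:R) (bLm : b * L%:R <= L%:R - m%:R).

(* By the recurrence, H increases up to i0 and decreases from i0 on. *)
Let i0 := ((k.+1 * m.+1) %/ L.+2)%N.

Let natr2 : L%:R + 2 = L.+2%:R :> R.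
Proof. by rewrite -(addn2 L) natrD. Qed.

Let i0_le : (i0%:R : R) * (L%:R + 2) <= (k%:R + 1) * (m%:R + 1).
Proof.
rewrite !natr1 natr2 -!natrM ler_nat.
exact: leq_trunc_div.
Qed.

Let i0_gt : (k%:R + 1) * (m%:R + 1) <= ((i0%:R : R) + 1) * (L%:R + 2).
Proof.
by rewrite !natr1 natr2 -!natrM ler_nat ltnW// ltn_ceil.
Qed.

Let mL : (m <= L)%N.
Proof.
rewrite -(ler_nat R) -subr_ge0; apply: le_trans bLm.
by rewrite mulr_ge0// ltW.
Qed.

Let den (i : nat) : R := (i%:R + 1) * (L%:R - k%:R - m%:R + i%:R + 1).
Let num (i : nat) : R := (k%:R - i%:R) * (m%:R - i%:R).

(** The quadratic terms cancel. The difference is therefore increasing and affine in [i], it changes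
    sign once, and [i0] is the mode. *)
Let den_num i : den i - num i = (i%:R + 1) * (L%:R + 2) - (k%:R + 1) * (m%:R + 1).
Proof. rewrite /den /num; ring. Qed.

Let kLR : 2 * k%:R <= L%:R :> R.
Proof. by rewrite -natrM ler_nat. Qed.

Let k1 : 1 <= k%:R :> R.
Proof. by rewrite ler1n. Qed.

Let b2 : 2 * b <= 1.
Proof.
have L0 : 0 < L%:R :> R by have := kLR; have := k1; lra.
rewrite -(ler_pM2r L0); have := bm; have := bLm; lra.
Qed.

Let fac1 i : (i0 <= i)%N -> b * (k%:R + 1) <= i%:R + 1.
Proof.
rewrite -(ler_nat R) => ii; have L0 : 0 < L%:R + 2 :> R by rewrite ltr_wpDl.
rewrite -(ler_pM2r L0).
apply: (@le_trans _ _ ((k%:R + 1) * (m%:R + 1))).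
  rewrite mulrAC mulrC ler_wpM2l ?addr_ge0//.
  have := bm; have := b2; lra.
by apply: le_trans i0_gt _; rewrite (ler_wpM2r (ltW L0))// lerD2r.
Qed.

(** Past the mode, [L - k - m + i + 1] is at least [(L + 1 - k) * (L + 1 - m) / (L + 2)]: once the
    denominator is cleared, the two sides differ by exactly [den i - num i]. *)
Let fac2 i : (i0 <= i)%N -> b * (L%:R + 2) / 2 <= L%:R - k%:R - m%:R + i%:R + 1.
Proof.
rewrite -(ler_nat R) => ii; have L0 : 0 < L%:R + 2 :> R by rewrite ltr_wpDl.
rewrite -(ler_pM2r L0).
apply: (@le_trans _ _ ((L%:R + 1 - k%:R) * (L%:R + 1 - m%:R))).
  rewrite (_ : b * _ / 2 * _ = (L%:R + 2) / 2 * (b * (L%:R + 2))); last by ring.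
  have a1 : 0 <= (L%:R + 2) / 2 :> R by rewrite divr_ge0// ltW.
  have a2 : 0 <= b * (L%:R + 2) by exact: mulr_ge0 (ltW b_gt0) (ltW L0).
  have a3 : (L%:R + 2) / 2 <= L%:R + 1 - k%:R :> R by have := kLR; lra.
  have a4 : b * (L%:R + 2) <= L%:R + 1 - m%:R by have := bLm; have := b2; lra.
  exact: ler_pM a1 a2 a3 a4.
have : (i0%:R + 1) * (L%:R + 2) <= (i%:R + 1) * (L%:R + 2) :> R.
  by rewrite (ler_wpM2r (ltW L0))// lerD2r.
move=> /(le_trans i0_gt) h; rewrite -subr_ge0.
rewrite (_ : _ - _ = (i%:R + 1) * (L%:R + 2) - (k%:R + 1) * (m%:R + 1)); last by ring.
by rewrite subr_ge0.
Qed.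

Let den_ge i : (i0 <= i)%N -> b ^+ 2 * (k%:R + 1) * (L%:R + 2) / 2 <= den i.
Proof.
move=> ii.
rewrite (_ : _ / 2 = b * (k%:R + 1) * (b * (L%:R + 2) / 2)); last by ring.
rewrite ler_pM ?fac1 ?fac2//.
  by rewrite mulr_ge0 ?addr_ge0// ltW.
by rewrite divr_ge0// mulr_ge0 ?addr_ge0// ltW.
Qed.

Let den_gt0 i : (i0 <= i)%N -> 0 < den i.
Proof.
move=> ii; apply: lt_le_trans (den_ge ii).
by rewrite !mulr_gt0 ?exprn_gt0// ltr_wpDl.
Qed.

Let den_ge_num i : (i0 <= i)%N -> num i <= den i.
Proof.
move=> ii; rewrite -subr_ge0 den_num subr_ge0; apply: le_trans i0_gt _.
by rewrite ler_wpM2r ?addr_ge0// lerD2r ler_nat.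
Qed.

Let H_decr i : (i0 <= i)%N -> H i.+1 <= H i.
Proof.
move=> ii; rewrite -(ler_pM2r (den_gt0 ii)) H_rec -/(num i).
by rewrite ler_wpM2l ?den_ge_num.
Qed.

Let H_incr i : (i < i0)%N -> H i <= H i.+1.
Proof.
move=> ii.
have num_den : den i <= num i.
  rewrite -subr_le0 den_num subr_le0; apply: le_trans i0_le.
  by rewrite ler_wpM2r ?addr_ge0// natr1 ler_nat.
have ik : (i < k)%N.
  rewrite (leq_trans ii)// -ltnS /i0 ltn_divLR//.
  by rewrite ltn_pmul2l// ltnS leqW.
have im : (i < m)%N.
  rewrite (leq_trans ii)// -ltnS /i0 ltn_divLR// mulnC ltn_pmul2l//.
  by rewrite !ltnS (leq_trans _ kL)// leq_pmull.
have num0 : 0 < num i by rewrite mulr_gt0// subr_gt0 ltr_nat.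
(* Below the mode the factor [L - k - m + i + 1] may be nonpositive; the recurrence then forces
   [H i <= 0]. *)
have [d0|d0] := ltP 0 (den i).
  by rewrite -(ler_pM2r d0) H_rec ler_wpM2l.
have : H i * num i <= 0 by rewrite -H_rec mulr_ge0_le0.
by rewrite pmulr_lle0// => /le_trans; apply.
Qed.

Let H_mode i : H i <= H i0.
Proof.
have [ii|/ltnW ii] := leqP i0 i.
  rewrite -(subnKC ii); elim: (i - i0)%N => [|q IH]; first by rewrite addn0.
  by rewrite addnS (le_trans (H_decr _))// leq_addr.
rewrite -[X in H X <= _](subKn ii).
have : (i0 - i <= i0)%N by rewrite leq_subr.
elim: (i0 - i)%N => [_|q IH qi]; first by rewrite subn0.
apply: le_trans (IH (ltnW qi)).
by rewrite -(subnSK qi); apply: H_incr; rewrite subnSK// leq_subr.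
Qed.

(** At distance [q] beyond the mode, [den - num] is at most [(q + 1) * (L + 2)] while [den] is at
    least [b ^+ 2 * (k + 1) * (L + 2) / 2]. One step thus loses a relative amount of at most
    [2 * (q + 1) / (b ^+ 2 * (k + 1))], and the losses add up to the stated one. *)
Let H_near q :
  H i0 * (1 - (q * q.+1)%:R / (b ^+ 2 * (k%:R + 1))) <= H (i0 + q)%N.
Proof.
set B := b ^+ 2 * (k%:R + 1).
have B0 : 0 < B by rewrite mulr_gt0 ?exprn_gt0// ltr_wpDl.
elim: q => [|q IH]; first by rewrite mul0n mul0r subr0 mulr1 addn0.
set S := (q * q.+1)%:R / B in IH.
set x := 2 * (q%:R + 1) / B.
have -> : (q.+1 * q.+2)%:R / B = S + x.
  rewrite /S /x !natrM -(addn2 q) -(natr1 q) natrD.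
  by field; rewrite gt_eqF.
have iq : (i0 <= i0 + q)%N by rewrite leq_addr.
have d0 := den_gt0 iq.
have step : H (i0 + q)%N * (1 - x) <= H (i0 + q).+1.
  rewrite -(ler_pM2r d0) H_rec -/(num _) -mulrA ler_wpM2l//.
  rewrite mulrBl mul1r lerBlDr -lerBlDl den_num.
  apply: (@le_trans _ _ ((q%:R + 1) * (L%:R + 2))).
    rewrite natrD; have := i0_le; lra.
  apply: (@le_trans _ _ (x * (B * (L%:R + 2) / 2))).
    by rewrite /x le_eqVlt; apply/orP; left; apply/eqP; field; rewrite gt_eqF.
  by rewrite ler_wpM2l ?den_ge// /x divr_ge0 ?mulr_ge0 ?addr_ge0// ltW.
rewrite addnS; have [x1|x1] := leP x 1; last first.
  apply: le_trans (H_ge0 _); rewrite mulr_ge0_le0//.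
  have : 0 <= S by rewrite divr_ge0// ltW.
  lra.
apply: le_trans step; apply: (@le_trans _ _ (H i0 * (1 - S) * (1 - x))).
  rewrite -mulrA ler_wpM2l//.
  have : 0 <= S * x.
    by rewrite mulr_ge0// ?divr_ge0 ?mulr_ge0 ?addr_ge0// ltW.
  lra.
by rewrite ler_wpM2r// subr_ge0.
Qed.

Lemma hypergeometric_max i : H i <= 4 / b * T / Num.sqrt k%:R.
Proof.
apply: (le_trans (H_mode i)).
have sk : 0 < Num.sqrt k%:R :> R by rewrite sqrtr_gt0 ltr0n.
(* For [q <= Q] this gives q(q+1) <= 2 q^2 <= b^2 k / 2, so each of the [Q.+1] atoms from [i0] on is
   at least half of the largest one. *)
pose Q := Num.truncn (b * Num.sqrt k%:R / 2).
have Q0 : 0 <= b * Num.sqrt k%:R / 2 by rewrite divr_ge0// mulr_ge0 ?ltW.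
have Hq q : (q < Q.+1)%N -> H i0 / 2 <= H (i0 + q)%N.
  rewrite ltnS => qQ; apply: le_trans (H_near q); rewrite ler_wpM2l//.
  have B0 : 0 < b ^+ 2 * (k%:R + 1) by rewrite mulr_gt0 ?exprn_gt0// ltr_wpDl.
  suff : (q * q.+1)%:R / (b ^+ 2 * (k%:R + 1)) <= 2^-1 by lra.
  rewrite ler_pdivrMr//.
  have qle : q%:R <= b * Num.sqrt k%:R / 2.
    rewrite (@le_trans _ _ Q%:R) ?ler_nat//; by rewrite truncn_le.
  have q2 : (q%:R : R) ^+ 2 <= b ^+ 2 * k%:R / 4.
    rewrite (_ : b ^+ 2 * k%:R / 4 = (b * Num.sqrt k%:R / 2) ^+ 2).
      by rewrite lerXn2r// nnegrE.
    by rewrite !exprMn sqr_sqrtr//; field.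
  apply: (@le_trans _ _ (2 * (q%:R : R) ^+ 2)).
    rewrite -natrX -natrM ler_nat mulnS mul2n -addnn -mulnn leq_add2r.
    by case: (q) => // q'; rewrite leq_pmulr.
  have : 0 <= b ^+ 2 by rewrite sqr_ge0.
  lra.
have : Q.+1%:R * (H i0 / 2) <= T.
  apply: le_trans (H_sum (i0 + Q.+1)); rewrite big_split_ord /=.
  rewrite -[leLHS]add0r lerD ?sumr_ge0//.
  rewrite mulr_natl -[X in _ *+ X](card_ord Q.+1) -sumr_const.
  by apply: ler_sum => q _; rewrite Hq.
have Qb : b * Num.sqrt k%:R / 2 <= Q.+1%:R by rewrite ltW// truncnS_gt.
have H20 : 0 <= H i0 / 2 by rewrite divr_ge0.
move=> /(le_trans (ler_wpM2r H20 Qb)) h.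
rewrite ler_pdivlMr// mulrAC ler_pdivlMr//.
lra.
Qed.

End hypergeometric_max.

(** * Double counting by exchanges of two elements *)

Section swap.
Variables (T : finType) (A : {set {set T}}) (U W : {set T}) (m : nat).

(** A preimage under the transposition, rather than a removal followed by an insertion: it is an
    involution on all sets, whichever of the two points they contain. *)
Definition swap (u w : T) (D : {set T}) : {set T} :=
  [set x | tperm u w x \in D]%SET.

Lemma swapK u w : involutive (swap u w).
Proof. by move=> D; apply/finset.setP => x; rewrite !inE tpermK. Qed.

Lemma swapC u w : swap u w = swap w u.
Proof. by apply/funext => D; rewrite /swap tpermC. Qed.

Lemma swap_out u w (D : {set T}) : u \in D -> w \notin D ->
  swap u w D = (w |: (D :\ u))%SET.
Proof.
move=> uD wD; apply/finset.setP => x; rewrite !inE.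
case: tpermP => [->|->|/eqP xu /eqP xw].
- by rewrite (negbTE wD) eqxx /= orbF; apply/esym/negbTE/eqP => uw;
    rewrite -uw uD in wD.
- by rewrite uD eqxx.
- by rewrite (negbTE xw) xu.
Qed.

Hypothesis UW : [disjoint U & W].
Hypothesis A_swap : forall (D : {set T}) u w, D \in A -> u \in U -> w \in W ->
  swap u w D \in A.
Hypothesis A_card : forall D : {set T}, D \in A -> #|D :&: (U :|: W)|%SET = m.

Let cardUW (D : {set T}) : D \in A -> (#|D :&: U| + #|D :&: W| = m)%N.
Proof.
move=> DA; rewrite -(A_card DA) finset.setIUr cardsU.
rewrite (_ : D :&: U :&: (D :&: W) = finset.set0)%SET ?cards0 ?subn0//.
apply/finset.setP => x; rewrite !inE; apply/negbTE/negP => /andP[/andP[_ xU] /andP[_ xW]].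
by have := disjointFr UW xU; rewrite xW.
Qed.

Definition profile (i : nat) : {set {set T}} := [set D in A | #|D :&: U| == i]%SET.

Let pairs_out (D : {set T}) := finset.setX (D :&: U) (W :\: D).
Let pairs_in (D : {set T}) := finset.setX (U :\: D) (D :&: W).

Let card_pairs (E : {set {set T}}) (Q : {set T} -> {set T * T}) :
  (\sum_(D in E) #|Q D| =
   \sum_(p : {set T} * (T * T) | (p.1 \in E) && (p.2 \in Q p.1)) 1)%N.
Proof.
rewrite -(pair_big_dep (fun D => D \in E) (fun D q => q \in Q D) (fun _ _ => 1%N)).
by apply: eq_bigr => D _; rewrite sum1_card.
Qed.

Let U_notin_W x : x \in U -> x \in W = false.
Proof. by move=> xU; rewrite (disjointFr UW xU). Qed.

Let swap_out_profile (D : {set T}) u w i : D \in A -> #|D :&: U| = i.+1 ->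
  u \in (D :&: U)%SET -> w \in (W :\: D)%SET ->
  [/\ swap u w D \in A, #|swap u w D :&: U| = i,
      u \in (U :\: swap u w D)%SET & w \in (swap u w D :&: W)%SET].
Proof.
move=> DA Di /finset.setIP[uD uU] /finset.setDP[wW wD].
have uw : u != w by apply: contraNneq wD => <-.
have wU : w \in U = false by apply: contraTF wW => /U_notin_W ->.
rewrite A_swap// swap_out//; split => //.
- have -> : ((w |: (D :\ u)) :&: U = (D :&: U) :\ u)%SET.
    apply/finset.setP => x; rewrite !inE; case: eqVneq => [->|_]; last by rewrite andbA.
    by rewrite wU !andbF.
  by apply/eqP; rewrite -eqSS -Di (cardsD1 u (D :&: U)%SET) inE uD uU.
- by rewrite !inE uU (negbTE uw) eqxx.
- by rewrite !inE eqxx wW.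
Qed.

Let swap_in_profile (D : {set T}) u w i : D \in A -> #|D :&: U| = i ->
  u \in (U :\: D)%SET -> w \in (D :&: W)%SET ->
  [/\ swap u w D \in A, #|swap u w D :&: U| = i.+1,
      u \in (swap u w D :&: U)%SET & w \in (W :\: swap u w D)%SET].
Proof.
move=> DA Di /finset.setDP[uU uD] /finset.setIP[wD wW].
have uw : u != w by apply: contraNneq uD => ->.
have wU : w \in U = false by apply: contraTF wW => /U_notin_W ->.
rewrite A_swap// swapC swap_out//; split => //.
- have -> : ((u |: (D :\ w)) :&: U = u |: (D :&: U))%SET.
    apply/finset.setP => x; rewrite !inE; case: eqVneq => [->|_]; first by rewrite uU.
    by case: eqVneq => [->|//]; rewrite wU !andbF.
  by rewrite cardsU1 inE (negbTE uD) Di.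
- by rewrite !inE eqxx uU.
- by rewrite !inE wW eq_sym (negbTE uw) eqxx.
Qed.

(* Both sides count the pairs of an element D of A and an exchange of a point of
   U with a point of W, each of which is undone by the same exchange. *)
Lemma swap_count i :
  (#|profile i.+1| * (i.+1 * (#|W| - (m - i.+1))) =
   #|profile i| * ((#|U| - i) * (m - i)))%N.
Proof.
have EL : (#|profile i.+1| * (i.+1 * (#|W| - (m - i.+1))) =
    \sum_(D in profile i.+1) #|pairs_out D|)%N.
  rewrite -sum_nat_const; apply: eq_bigr => D; rewrite inE => /andP[DA /eqP Di].
  rewrite cardsX Di; congr (_ * _)%N; rewrite cardsD finset.setIC.
  by rewrite -(cardUW DA) Di addKn.
have ER : (#|profile i| * ((#|U| - i) * (m - i)) =
    \sum_(D in profile i) #|pairs_in D|)%N.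
  rewrite -sum_nat_const; apply: eq_bigr => D; rewrite inE => /andP[DA /eqP Di].
  rewrite cardsX; congr (_ * _)%N; first by rewrite cardsD finset.setIC Di.
  by rewrite -(cardUW DA) Di addKn.
rewrite EL ER !card_pairs.
pose f (p : {set T} * (T * T)) := (swap p.2.1 p.2.2 p.1, p.2).
have fK : involutive f by move=> [D [u w]]; rewrite /f /= swapK.
rewrite (reindex_inj (inv_inj fK)); apply: eq_bigl => -[D [u w]] /=.
rewrite !inE /=; apply/idP/idP.
- move=> /andP[/andP[DA /eqP Di] /andP[uX wX]].
  have := @swap_out_profile _ u w i DA Di; rewrite swapK !inE /=.
  move=> /(_ uX wX)[-> -> -> ->].
  by rewrite eqxx /=.
- move=> /andP[/andP[DA /eqP Di] /andP[uX wX]].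
  have := @swap_in_profile _ u w i DA Di; rewrite !inE /=.
  move=> /(_ uX wX)[-> -> -> ->].
  by rewrite eqxx /=.
Qed.

Lemma sum_profile n : (\sum_(i < n) #|profile i| <= #|A|)%N.
Proof.
rewrite (eq_bigr (fun i : 'I_n => \sum_(D in A | #|D :&: U| == i) 1)%N); last first.
  by move=> i _; rewrite -sum1_card; apply: eq_bigl => D; rewrite inE.
rewrite (exchange_big_dep (fun D => D \in A)) /=; last by move=> i D _ /andP[].
rewrite -sum1_card; apply: leq_sum => D DA.
rewrite sum1_card; case: (ltnP #|D :&: U| n) => [h|h].
  rewrite (eq_card (B := pred1 (Ordinal h))) ?card1// => j.
  by rewrite !inE DA /= -val_eqE eq_sym.
rewrite eq_card0// => j; rewrite !inE DA /=; apply/negbTE/eqP => E.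
by have := ltn_ord j; rewrite -E ltnNge h.
Qed.

Local Open Scope ring_scope.

Lemma profile_le (R : realType) (b : R) i : 0 < b -> (0 < #|U|)%N ->
  (#|U| <= #|W|)%N ->
  b * (#|U| + #|W|)%:R <= m%:R -> b * (#|U| + #|W|)%:R <= (#|U| + #|W|)%:R - m%:R ->
  #|profile i|%:R <= 4 / b * #|A|%:R / Num.sqrt #|U|%:R :> R.
Proof.
move=> b0 U0 UleW bm bLm.
apply: (@hypergeometric_max R (fun i => #|profile i|%:R) #|U| (#|U| + #|W|)%N m) => //.
- by move=> n; rewrite -natr_sum ler_nat sum_profile.
- move=> {}i.
  have := congr1 (fun n => n%:R : R) (swap_count i); rewrite !natrM natrD.
  (* The truncated subtractions of [swap_count] have to become real ones. An empty profile makes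
     both sides vanish; otherwise a member of it shows that nothing is truncated. *)
  have E1 : #|profile i.+1|%:R * (i.+1%:R * (#|W| - (m - i.+1))%:R) =
     #|profile i.+1|%:R * ((i%:R + 1) *
       (#|U|%:R + #|W|%:R - #|U|%:R - m%:R + i%:R + 1)) :> R.
    have [->|] := posnP #|profile i.+1|; first by rewrite !mul0r.
    move=> /card_gt0P[D]; rewrite inE => /andP[DA /eqP Di].
    have DU := cardUW DA; have DW : (#|D :&: W| <= #|W|)%N.
      by rewrite subset_leq_card// finset.subsetIr.
    rewrite natr1 -!addrA; congr (_ * (_ * _)).
    rewrite natrB; last by rewrite -DU Di addKn.
    rewrite natrB; last by rewrite -DU Di leq_addr.
    rewrite -natr1; ring.
  have E2 : #|profile i|%:R * ((#|U| - i)%:R * (m - i)%:R) =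
     #|profile i|%:R * ((#|U|%:R - i%:R) * (m%:R - i%:R)) :> R.
    have [->|] := posnP #|profile i|; first by rewrite !mul0r.
    move=> /card_gt0P[D]; rewrite inE => /andP[DA /eqP Di].
    have DU := cardUW DA; have DW : (#|D :&: U| <= #|U|)%N.
      by rewrite subset_leq_card// finset.subsetIr.
    rewrite natrB; last by rewrite -Di.
    by rewrite natrB// -DU Di leq_addr.
  by rewrite E1 E2.
- by rewrite mul2n -addnn leq_add2l.
Qed.

End swap.

Lemma profile_swap (T : finType) (A : {set {set T}}) (U W : {set T}) m i :
  (forall D : {set T}, D \in A -> (#|D :&: U| + #|D :&: W| = m)%N) ->
  profile A U i \subset profile A W (m - i).
Proof.
move=> AUW; apply/fintype.subsetP => D; rewrite !inE => /andP[DA /eqP Di].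
by rewrite DA /= -(AUW _ DA) Di addKn.
Qed.

(** The bound on the largest atom requires the counted block to be the smaller of the two. If [U] is
    the larger one, counting [i] points in [U] amounts to counting [m - i] points in [W]. *)
Lemma profile_le_min (R : realType) (T : finType) (A : {set {set T}})
    (U W : {set T}) m (b : R) (i : nat) :
  [disjoint U & W] ->
  (forall (D : {set T}) u w, D \in A -> u \in U -> w \in W -> swap u w D \in A) ->
  (forall D : {set T}, D \in A -> #|D :&: (U :|: W)|%SET = m) ->
  (0 < b)%R -> (0 < #|U|)%N -> (0 < #|W|)%N ->
  (b * (#|U| + #|W|)%:R <= m%:R)%R ->
  (b * (#|U| + #|W|)%:R <= (#|U| + #|W|)%:R - m%:R)%R ->
  (#|profile A U i|%:R <=
    4 / b * #|A|%:R / Num.sqrt (minn #|U| #|W|)%:R :> R)%R.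
Proof.
move=> UW Asw Am b0 U0 W0 bm bLm.
have [UleW|WltU] := leqP #|U| #|W|.
  exact: (profile_le UW Asw Am).
have le1 : (#|profile A U i|%:R <= #|profile A W (m - i)%N|%:R :> R)%R.
  rewrite ler_nat subset_leq_card// profile_swap// => D DA.
  rewrite -(Am _ DA) finset.setIUr cardsU.
  rewrite (_ : (D :&: U :&: (D :&: W) = finset.set0)%SET) ?cards0 ?subn0//.
  apply/finset.setP => x; rewrite !inE.
  apply/negbTE/negP => /andP[/andP[_ xU] /andP[_ xW]].
  by have := disjointFr UW xU; rewrite xW.
rewrite addnC in bm bLm; apply: (Order.POrderTheory.le_trans le1).
apply: (@profile_le _ A W U m) => //.
- by rewrite disjoint_sym.
- by move=> D u w DA uW wU; rewrite swapC Asw.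
- by move=> D DA; rewrite finset.setUC Am.
- exact: ltnW.
Qed.

(** * Lattice paths as sets of horizontal steps *)

Section prefix_counts.
Variable n : nat.
Implicit Types (D : {set 'I_n}) (t i : nat).

Definition cnt D t : nat := #|[set u in D | (u < t)%N]%SET|.

Lemma cnt0 D : cnt D 0 = 0.
Proof. by rewrite /cnt eq_card0// => u; rewrite !inE ltn0 andbF. Qed.

Lemma cntS D t (tn : t < n) : cnt D t.+1 = (cnt D t + (Ordinal tn \in D))%N.
Proof.
rewrite /cnt (cardsD1 (Ordinal tn)) !inE ltnSn andbT addnC; congr (_ + _)%N.
apply: eq_card => u; rewrite !inE ltnS -val_eqE /=.
by rewrite andbCA -ltn_neqAle.
Qed.

Lemma cnt_le D t : cnt D t <= t.
Proof.
elim: t => [|t IH]; first by rewrite cnt0.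
have [tn|nt] := ltnP t n; first by rewrite cntS -addn1 leq_add// leq_b1.
apply: leq_trans (leqnSn t); rewrite (leq_trans _ IH)// /cnt subset_leq_card//.
apply/fintype.subsetP => u; rewrite !inE => /andP[-> _] /=.
exact: leq_trans (ltn_ord u) nt.
Qed.

Lemma cnt_full D : cnt D n = #|D|.
Proof. by apply: eq_card => u; rewrite !inE ltn_ord andbT. Qed.

Lemma cnt_inj D D' : (forall t, t <= n -> cnt D t = cnt D' t) -> D = D'.
Proof.
move=> E; apply/finset.setP => u.
have := E u.+1 (ltn_ord u); rewrite !cntS (E u (ltnW (ltn_ord u))).
rewrite (_ : Ordinal _ = u); last exact: val_inj.
by move=> /addnI; case: (u \in D); case: (u \in D').
Qed.

Lemma cnt_swap D (u w : 'I_n) t : (u < t) = (w < t) ->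
  cnt (swap u w D) t = cnt D t.
Proof.
move=> uw; rewrite /cnt -[RHS](card_preimset _ (perm_inj (s := tperm u w))).
apply: eq_card => x; rewrite !inE; congr (_ && _).
by case: tpermP => [->|->|].
Qed.

Lemma card_ord_itv a b : b <= n -> #|[set u : 'I_n | (a <= u < b)%N]%SET| = b - a.
Proof.
elim: b => [_|b IH bn]; first by rewrite eq_card0// => u; rewrite !inE ltn0 andbF.
rewrite (cardsD1 (Ordinal bn)) !inE /= ltnSn andbT.
rewrite (eq_card (B := [set u : 'I_n | (a <= u < b)%N]%SET)); last first.
  by move=> u; rewrite !inE -val_eqE /= ltnS andbCA -ltn_neqAle.
rewrite (IH (ltnW bn)); have [ab|ba] := leqP a b; first by rewrite subSn.
by rewrite add0n !(eqP (_ : _ <= _))//; apply: ltnW.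
Qed.

End prefix_counts.

(** * Step sets with prescribed prefix counts *)

Section pinned.
Variables (n q : nat) (tau c : nat -> nat).

(** If the elements of [D] are the times of the horizontal steps, passing through a given lattice
    point prescribes the number of elements of [D] before the time of that point. *)
Definition pinned : {set {set 'I_n}} :=
  [set D : {set 'I_n} | [forall j : 'I_q.+1, cnt D (tau j) == c j]]%SET.

Lemma pinnedP (D : {set 'I_n}) :
  reflect (forall j, j <= q -> cnt D (tau j) = c j) (D \in pinned).
Proof.
rewrite inE; apply: (iffP forallP) => [H j jq|H j].
  by have /eqP := H (Ordinal (jq : j < q.+1)).
by rewrite H// -ltnS.
Qed.

Hypotheses (tau0 : tau 0 = 0) (c0 : c 0 = 0) (tauq : tau q = n).
Hypothesis tau_lt : forall j, j < q -> tau j < tau j.+1.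
Hypothesis c_le : forall j, j < q -> c j <= c j.+1.
Hypothesis c_tau : forall j, j < q -> c j.+1 - c j <= tau j.+1 - tau j.

Let tau_mono i j : i <= j -> j <= q -> tau i <= tau j.
Proof.
move=> /subnKC <-; elim: (j - i) => [|k IH]; first by rewrite addn0.
by rewrite addnS => kq; rewrite (leq_trans (IH (ltnW kq)))// ltnW// tau_lt.
Qed.

(* Between two pins, the horizontal steps come first. *)
Lemma pinned_neq0 : 0 < #|pinned|.
Proof.
suff H k : k <= q -> exists D : {set 'I_n},
    forall j, j <= k -> cnt D (tau j) = c j.
  by have [D /pinnedP DP] := H q (leqnn q); apply/card_gt0P; exists D.
elim: k => [_|k IH kq].
  by exists finset.set0 => j; rewrite leqn0 => /eqP ->; rewrite tau0 c0 cnt0.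
have [D DE] := IH (ltnW kq).
have tk1n : tau k.+1 <= n by rewrite -tauq tau_mono.
pose D' : {set 'I_n} := [set u : 'I_n |
  if (u < tau k)%N then u \in D else (tau k <= u < tau k + (c k.+1 - c k))%N]%SET.
have low t : t <= tau k -> cnt D' t = cnt D t.
  move=> tk; apply: eq_card => u; rewrite !inE; case: ltnP => //=.
  by move=> ku; rewrite [(u < t)%N]ltnNge (leq_trans tk ku) /= !andbF.
exists D' => j; rewrite leq_eqVlt => /predU1P[->|]; last first.
  by rewrite ltnS => jk; rewrite low ?DE// tau_mono// ltnW.
have e : c k.+1 = (cnt D' (tau k) + (c k.+1 - c k))%N.
  by rewrite low// DE// subnKC// c_le.
have bn : tau k + (c k.+1 - c k) <= n.
  by rewrite (leq_trans _ tk1n)// -leq_subRL ?c_tau// ltnW// tau_lt.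
rewrite e -[X in (_ + X)%N](addKn (tau k)) -(card_ord_itv _ bn) /cnt.
rewrite -cardsUI [X in (_ + X)%N](_ : _ = 0) ?addn0; last first.
  apply: eq_card0 => u; rewrite !inE; apply/negbTE/negP.
  by move=> /andP[/andP[_ uk] /andP[ku _]]; move: uk; rewrite ltnNge ku.
apply: eq_card => u; rewrite !inE; case: (ltnP u (tau k)) => [uk|ku] /=.
  by rewrite (leq_trans uk (ltnW (tau_lt kq))) !andbT ?orbF.
rewrite andbF /=; case: (ltnP u (tau k + _)) => //= ub.
rewrite (leq_trans ub)// -leq_subRL ?c_tau//.
by rewrite ltnW// tau_lt.
Qed.

(** With [U] the times from [tau j] up to [t] and [W] those from [t] up to [tau j.+1], no pin
    separates a point of [U] from a point of [W], so exchanging the two keeps all prescribed counts.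
    The count at [t] is [c j] plus the number of elements in [U], which is hypergeometric. *)
Lemma card_pinned_le (R : realType) (b : R) j t (i : nat) :
  j < q -> tau j < t < tau j.+1 -> (0 < b)%R ->
  (b * (tau j.+1 - tau j)%:R <= (c j.+1 - c j)%:R)%R ->
  (b * (tau j.+1 - tau j)%:R <= (tau j.+1 - tau j)%:R - (c j.+1 - c j)%:R)%R ->
  (#|[set D in pinned | cnt D t == i]%SET|%:R <=
    4 / b * #|pinned|%:R / Num.sqrt (minn (t - tau j) (tau j.+1 - t))%:R :> R)%R.
Proof.
move=> jq /andP[jt tj] b0 bm bLm.
have jn : tau j.+1 <= n by rewrite -tauq tau_mono.
pose U := [set u : 'I_n | (tau j <= u < t)%N]%SET.
pose W := [set u : 'I_n | (t <= u < tau j.+1)%N]%SET.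
have UE : #|U| = t - tau j by rewrite card_ord_itv// (leq_trans (ltnW tj)).
have WE : #|W| = tau j.+1 - t by rewrite card_ord_itv.
have UWE : #|U| + #|W| = tau j.+1 - tau j.
  by rewrite UE WE addnC addnBA ?subnK// ltnW.
have cntD (D : {set 'I_n}) a d : a <= d ->
    cnt D d = (cnt D a + #|D :&: [set u : 'I_n | (a <= u < d)%N]|%SET)%N.
  move=> ad; rewrite /cnt -cardsUI [X in (_ + X)%N](_ : _ = 0) ?addn0; last first.
    apply: eq_card0 => u; rewrite !inE; apply/negbTE/negP.
    by move=> /andP[/andP[_ ua] /andP[_ /andP[au _]]]; move: ua; rewrite ltnNge au.
  apply: eq_card => u; rewrite !inE -andb_orr; congr (_ && _).
  by case: (ltnP u a) => //= ua; rewrite (leq_trans ua ad).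
apply: (@Order.POrderTheory.le_trans _ _ (#|profile pinned U (i - c j)%N|%:R : R)%R).
  rewrite ler_nat subset_leq_card//; apply/fintype.subsetP => D.
  rewrite inE => /andP[DP /eqP Di]; rewrite inE DP /= -Di.
  have /pinnedP/(_ j (ltnW jq)) <- := DP.
  by rewrite (cntD D _ _ (ltnW jt)) addKn.
rewrite -UE -WE; apply: (@profile_le_min _ _ _ _ _ (c j.+1 - c j)) => //.
- rewrite -setI_eq0; apply/eqP/finset.setP => u; rewrite !inE.
  by apply/negbTE/negP => /andP[/andP[_ ut] /andP[tu _]]; move: ut; rewrite ltnNge tu.
- move=> D u w /pinnedP DP uU wW.
  move: uU wW; rewrite [u \in _]inE [w \in _]inE => /andP[ju ut] /andP[tw wj].
  apply/pinnedP => j' j'q; rewrite cnt_swap ?DP//.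
  have [j'j|jj'] := leqP j' j.
    have t1 : tau j' <= tau j by rewrite tau_mono// ltnW.
    have t2 : tau j <= w by rewrite (leq_trans ju)// (leq_trans (ltnW ut)).
    by rewrite !ltnNge (leq_trans t1 ju) (leq_trans t1 t2).
  have t1 : tau j.+1 <= tau j' by rewrite tau_mono.
  by rewrite (leq_trans wj t1) (leq_trans (ltn_trans ut tj) t1).
- move=> D DP; have /pinnedP DP' := DP.
  have := cntD D _ _ (ltnW (ltn_trans jt tj)); rewrite !DP' ?(ltnW jq)// => ->.
  rewrite addKn; apply: eq_card => u; rewrite !inE; congr (_ && _).
  case: (ltnP u t) => //= ut; rewrite ?andbF ?orbF.
    by rewrite (ltn_trans ut tj).
  by rewrite (leq_trans (ltnW jt) ut).
- by rewrite UE subn_gt0.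
- by rewrite WE subn_gt0.
- by rewrite UWE.
- by rewrite UWE.
Qed.

End pinned.

Section lattice_paths.
Variable n : nat.
Implicit Types (D : {set 'I_n}) (t : nat).

(* D is the set of times of the horizontal steps. *)
Definition path_pos D t : nat * nat := ((cnt D t).+1, (t - cnt D t).+1).

Definition path_pts D : seq (nat * nat) := mkseq (path_pos D) n.+1.

Lemma nth_path_pts D t : t <= n -> nth (0, 0) (path_pts D) t = path_pos D t.
Proof. by move=> tn; rewrite nth_mkseq. Qed.

Lemma path_pos_time D t : (path_pos D t).1 + (path_pos D t).2 = t.+2.
Proof. by rewrite /= addSn addnS subnKC ?cnt_le. Qed.

Lemma path_pos_step D t (tn : t < n) : path_pos D t.+1 =
  if Ordinal tn \in D then ((path_pos D t).1.+1, (path_pos D t).2)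
  else ((path_pos D t).1, (path_pos D t).2.+1).
Proof.
rewrite /path_pos (cntS D tn); case: (Ordinal tn \in D) => /=.
  by rewrite addn1 subSS.
by rewrite addn0 subSn ?cnt_le.
Qed.

(** The coordinate sum starts at 2 and grows by one at every step, so the time of a visit to [z] is
    determined by [z], and only the count at that time has to match. *)
Lemma mem_path_pts D z : 0 < z.1 -> 0 < z.2 ->
  (z \in path_pts D) =
  ((z.1 + z.2 - 2 <= n) && (cnt D (z.1 + z.2 - 2) == z.1.-1)).
Proof.
case: z => [[//|x] [//|y]] _ _ /=.
have -> : x.+1 + y.+1 - 2 = x + y by rewrite addSn addnS subSS subn1.
apply/mapP/andP => [[t]|[xyn /eqP E]].
  rewrite mem_iota add0n ltnS => /andP[_ tn] [-> ->].
  by rewrite subnKC ?cnt_le//; split.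
exists (x + y); first by rewrite mem_iota add0n ltnS.
by rewrite /path_pos E addKn.
Qed.

Lemma path_pts_inj : injective path_pts.
Proof.
move=> D D' E; apply: cnt_inj => t tn.
have := congr1 (fun s => nth (0, 0) s t) E; rewrite !nth_path_pts//.
by move=> [].
Qed.

Lemma uniq_path_pts D : uniq (path_pts D).
Proof.
apply/mkseq_uniqP => i j _ _ E; apply/eqP; rewrite -2!eqSS.
by rewrite -!(path_pos_time D) E.
Qed.

Lemma sorted_path_pts D : sorted up_right_step (path_pts D).
Proof.
apply/(sortedP (0, 0)) => t; rewrite size_mkseq ltnS => tn.
rewrite !nth_path_pts//; last exact: ltnW.
rewrite (path_pos_step D tn) /up_right_step; case: ifP => _; rewrite eqxx ?orbT//.
Qed.

End lattice_paths.

Section box.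
Variables M' N' : nat.
Let n := (M' + N')%N.
Let M := M'.+1.
Let N := N'.+1.

Lemma up_right_path_pts (D : {set 'I_n}) : #|D| = M' ->
  up_right_path M N (path_pts D).
Proof.
move=> DM; apply/and4P; split; last exact: sorted_path_pts.
- by rewrite size_mkseq /M /N addSn addnS subSS subn0.
- by rewrite /= /path_pos cnt0.
- rewrite -nth_last size_mkseq nth_path_pts//= /path_pos cnt_full DM.
  by rewrite /n addKn.
Qed.

Lemma up_right_pathE l : up_right_path M N l ->
  exists2 D : {set 'I_n}, #|D| = M' & l = path_pts D.
Proof.
move=> /and4P[/eqP lsize /eqP lhead /eqP llast /(sortedP (0, 0)) lstep].
have {}lsize : size l = n.+1 by rewrite lsize /M /N addSn addnS subSS subn0.
pose D : {set 'I_n} :=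
  [set u : 'I_n | (nth (0, 0) l u.+1).1 == (nth (0, 0) l u).1.+1]%SET.
have lE t : t <= n -> nth (0, 0) l t = path_pos D t.
  elim: t => [_|t IH tn]; first by rewrite nth0 lhead /path_pos cnt0.
  have {}IH := IH (ltnW tn).
  have := lstep t; rewrite lsize ltnS => /(_ tn).
  rewrite (path_pos_step D tn) inE -IH /= => /orP[] /eqP -> /=.
    by rewrite eqxx.
  by rewrite (ltn_eqF (ltnSn _)).
exists D; last first.
  apply: (@eq_from_nth _ (0, 0)); first by rewrite size_mkseq.
  by move=> t; rewrite lsize ltnS => tn; rewrite lE// nth_path_pts.
have := lE n (leqnn n); rewrite -[LHS](_ : last (0, 0) l = _); last first.
  by rewrite -nth_last lsize.
by rewrite llast /path_pos cnt_full => -[->].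
Qed.

Lemma path_pts_box (D : {set 'I_n}) z : #|D| = M' -> z \in path_pts D ->
  [/\ 0 < z.1, z.1 <= M, 0 < z.2 & z.2 <= N].
Proof.
move=> DM /mapP[t]; rewrite mem_iota add0n ltnS => /andP[_ tn] ->.
have cM : cnt D t <= M'.
  rewrite -DM /cnt subset_leq_card//; apply/fintype.subsetP => u.
  by rewrite inE => /andP[].
split=> //=; rewrite ltnS leq_subLR.
(* The vertical steps before [t] are counted by the complement of [D], which has [N'] elements. *)
have := cnt_le (~: D)%SET t.
have nE : n = #|D| + #|~: D|%SET by rewrite cardsC card_ord.
have : cnt D t + cnt (~: D)%SET t = t.
  elim: t tn {cM} => [|t IH] tn; first by rewrite !cnt0.
  rewrite !cntS addnACA IH ?(ltnW tn)// inE.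
  by case: (_ \in D); rewrite ?addn1.
have : cnt (~: D)%SET t <= N'.
  have -> : N' = #|~: D|%SET by apply/eqP; rewrite -(eqn_add2l #|D|) -nE DM.
  rewrite /cnt subset_leq_card//; apply/fintype.subsetP => u.
  by rewrite inE => /andP[].
lia.
Qed.

Lemma points_inj : injective (@points M N).
Proof.
move=> s s' E; apply: val_inj => /=; apply: (inj_map _ E) => -[i j] [i' j'] [].
by move=> /val_inj -> /val_inj ->.
Qed.

Lemma points_surj (D : {set 'I_n}) : #|D| = M' ->
  exists s : box_path M N, points s = path_pts D.
Proof.
move=> DM; pose f (z : nat * nat) : 'I_M * 'I_N := (inord z.1.-1, inord z.2.-1).
have sz : size (map f (path_pts D)) == (M + N - 1)%N.
  by rewrite size_map size_mkseq /M /N addSn addnS subSS subn0.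
exists (Tuple sz); rewrite /points -map_comp -[RHS](@map_id _ (path_pts D)).
apply/seq.eq_in_map => -[[|x] [|y]] /(path_pts_box DM)[//= _ xM _ yN].
by rewrite /lattice_point /f /= !inordK.
Qed.

(** Transfers sums over the paths in the box to sums over sets of horizontal times, where steps can
    be exchanged. *)
Lemma perm_paths_through l (a : 'I_l -> nat * nat) :
  perm_eq [seq points s | s in paths_through M N a]
    [seq path_pts D | D in
       [set D : {set 'I_n} | (#|D| == M') && [forall i, a i \in path_pts D]]%SET].
Proof.
apply: uniq_perm.
- by rewrite map_inj_uniq ?enum_uniq//; exact: points_inj.
- by rewrite map_inj_uniq ?enum_uniq//; exact: path_pts_inj.
move=> p; apply/fintype.imageP/fintype.imageP => -[].
  move=> s; rewrite inE => /andP[/up_right_pathE[D DM sE] sa] ->.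
  by exists D => //; rewrite inE DM eqxx /= -sE.
move=> D; rewrite inE => /andP[/eqP DM Da] ->.
have [s sE] := points_surj DM; exists s => //.
by rewrite inE sE up_right_path_pts.
Qed.

End box.

Local Open Scope classical_set_scope.
Local Open Scope ring_scope.

(** * Overlap of two paths *)

Section inverse_sqrt_sums.
Context {R : realType}.

(* As invsqrt 0 = 0 and subtraction is truncated, invsqrt (t - a) vanishes for
   t <= a. *)
Definition invsqrt (k : nat) : R := (Num.sqrt k%:R)^-1.

Lemma invsqrt_ge0 k : 0 <= invsqrt k.
Proof. by rewrite invr_ge0 sqrtr_ge0. Qed.

Lemma invsqrt0 : invsqrt 0 = 0.
Proof. by rewrite /invsqrt sqrtr0 invr0. Qed.

(** Telescoping: the increment of the square root is [(s' + s)^-1], which is at least half of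
    [s'^-1]. *)
Lemma sum_invsqrt n : \sum_(k < n.+1) invsqrt k <= 2 * Num.sqrt n%:R.
Proof.
elim: n => [|n IH]; first by rewrite big_ord1 invsqrt0 mulr_ge0 ?sqrtr_ge0.
rewrite big_ord_recr /=; apply: (le_trans (lerD IH (lexx _))).
set s := Num.sqrt n%:R; rewrite /invsqrt; set s' := Num.sqrt n.+1%:R.
have s'0 : 0 < s' by rewrite sqrtr_gt0 ltr0n.
have s2 : s ^+ 2 = n%:R by rewrite sqr_sqrtr.
have s'2 : s' ^+ 2 = n%:R + 1 by rewrite sqr_sqrtr ?natr1.
rewrite -lerBrDl -[leLHS]mul1r ler_pdivrMr// -mulrBr.
apply: (@le_trans _ _ ((s' - s) * (s' + s))).
  by rewrite -subr_sqr s2 s'2 addrAC subrr add0r.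
rewrite -subr_ge0 (_ : _ - _ = (s' - s) ^+ 2) ?sqr_ge0//; ring.
Qed.

Lemma sum_invsqrt_shift n a :
  \sum_(t < n) invsqrt (t - a) <= \sum_(k < n.+1) invsqrt k.
Proof.
have -> : \sum_(t < n) invsqrt (t - a) = \sum_(k < n - a) invsqrt k.
  elim: n => [|n IH]; first by rewrite sub0n !big_ord0.
  rewrite big_ord_recr /= IH; have [an|na] := leqP a n.
    by rewrite subSn// big_ord_recr.
  by rewrite (eqP (ltnW na : (n - a == 0)%N)) (eqP (na : (n.+1 - a == 0)%N))
    invsqrt0 addr0.
have nn : (n - a <= n.+1)%N by rewrite (leq_trans (leq_subr _ _)).
rewrite -(subnKC nn) big_split_ord /= lerDl sumr_ge0// => k _.
exact: invsqrt_ge0.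
Qed.

Lemma sum_invsqrt_rev n a :
  \sum_(t < n) invsqrt (a - t) <= \sum_(k < a.+1) invsqrt k.
Proof.
elim: n a => [|n IH] a.
  by rewrite big_ord0 sumr_ge0// => k _; exact: invsqrt_ge0.
rewrite big_ord_recl /= subn0 [leRHS]big_ord_recr /= [leRHS]addrC lerD2l.
case: a => [|a].
  rewrite big_ord0 big1// => t _; by rewrite sub0n invsqrt0.
by apply: le_trans (IH a); apply: ler_sum => t _; rewrite subSS.
Qed.

Lemma sum_invsqrt_min n a d : (d <= n)%N ->
  \sum_(t < n.+1) invsqrt (minn (t - a) (d - t)) <= 4 * Num.sqrt n.+1%:R.
Proof.
move=> dn; have H k : 0 <= invsqrt k := invsqrt_ge0 k.
apply: (@le_trans _ _ (\sum_(t < n.+1) (invsqrt (t - a) + invsqrt (d - t)))).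
  apply: ler_sum => t _; rewrite /minn; case: ifP => _.
    by rewrite lerDl H.
  by rewrite lerDr H.
rewrite big_split /=.
rewrite (_ : 4 * _ = 2 * Num.sqrt n.+1%:R + 2 * Num.sqrt n.+1%:R); last by ring.
rewrite lerD//; first exact: le_trans (sum_invsqrt_shift _ _) (sum_invsqrt _).
apply: le_trans (sum_invsqrt_rev _ _) _; apply: le_trans (sum_invsqrt _) _.
by rewrite ler_wpM2l// ler_wsqrtr// ler_nat leqW.
Qed.

End inverse_sqrt_sums.

Section overlap.
Context {R : realType}.
Variables (M' N' l : nat) (a : 'I_l -> nat * nat).
Let n := (M' + N')%N.
Let M := M'.+1.
Let N := N'.+1.

Definition visit (M N l : nat) (a : 'I_l -> nat * nat) (z : nat * nat) : R :=
  #|[pred s in paths_through M N a | z \in points s]|%:R /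
  #|paths_through M N a|%:R.

(** Adds the two corners to the prescribed points: index 0 is the start, and [insub] fails from
    index [l.+1] on, which yields the end [(M, N)]. *)
Definition pin (M N l : nat) (a : 'I_l -> nat * nat) (j : nat) : nat * nat :=
  if j is j'.+1 then (if insub j' is Some i then a i else (M, N)) else (1, 1)%N.

Lemma pin_ord j (jl : (j < l)%N) : pin M N a j.+1 = a (Ordinal jl).
Proof. by rewrite /pin insubT. Qed.

Lemma pin_last : pin M N a l.+1 = (M, N).
Proof. by rewrite /pin insubF// ltnn. Qed.

Let tau j := ((pin M N a j).1 + (pin M N a j).2 - 2)%N.
Let c j := (pin M N a j).1.-1.

Hypothesis pin1_lt : forall j, (j < l.+1)%N ->
  ((pin M N a j).1 < (pin M N a j.+1).1)%N.
Hypothesis pin2_lt : forall j, (j < l.+1)%N ->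
  ((pin M N a j).2 < (pin M N a j.+1).2)%N.

Let pin_gt0 j : (j <= l.+1)%N -> (0 < (pin M N a j).1)%N /\ (0 < (pin M N a j).2)%N.
Proof.
elim: j => [//|j IH] jl; split.
  by rewrite (leq_ltn_trans _ (pin1_lt jl)).
by rewrite (leq_ltn_trans _ (pin2_lt jl)).
Qed.

Let tau_lt j : (j < l.+1)%N -> (tau j < tau j.+1)%N.
Proof.
move=> jl; have := pin1_lt jl; have := pin2_lt jl.
have [] := pin_gt0 (ltnW jl); rewrite /tau; lia.
Qed.

Let tau0 : tau 0 = 0%N. Proof. by []. Qed.
Let c0 : c 0 = 0%N. Proof. by []. Qed.

Let tauq : tau l.+1 = n.
Proof. by rewrite /tau pin_last /M /N /n /= addSn addnS subSS subn1. Qed.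

Let tau_le j : (j <= l.+1)%N -> (tau j <= n)%N.
Proof.
rewrite -tauq => jl; rewrite -(subKn jl).
elim: (l.+1 - j)%N => [|k IH]; first by rewrite subn0.
have [kl|lk] := ltnP k l.+1.
  apply: leq_trans IH; rewrite -(subnSK kl) ltnW// tau_lt//.
  by rewrite subnSK// leq_subr.
rewrite (eqP (_ : (l.+1 - k.+1 == 0)%N)) ?tau0//.
by rewrite subn_eq0 leqW.
Qed.

Let c_le j : (j < l.+1)%N -> (c j <= c j.+1)%N.
Proof. by move=> jl; have := pin1_lt jl; rewrite /c; lia. Qed.

Let c_tau j : (j < l.+1)%N -> (c j.+1 - c j <= tau j.+1 - tau j)%N.
Proof.
move=> jl; have := pin1_lt jl; have := pin2_lt jl.
have [] := pin_gt0 (ltnW jl); rewrite /tau /c; lia.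
Qed.

Let P := pinned n l.+1 tau c.

Let pinnedE : [set D : {set 'I_n} |
   (#|D| == M') && [forall i, a i \in path_pts D]]%SET = P.
Proof.
apply/finset.setP => D; rewrite inE.
apply/andP/pinnedP => [[/eqP DM /forallP Da] [|j] jl|DP].
- by rewrite tau0 c0 cnt0.
- rewrite /tau /c; have [jl'|lj] := ltnP j l; last first.
    have -> : j = l by apply/eqP; rewrite eqn_leq lj andbT -ltnS.
    by rewrite -/(tau l.+1) tauq cnt_full DM pin_last.
  have [p1 p2] := pin_gt0 jl.
  have := Da (Ordinal jl'); rewrite -(pin_ord jl') mem_path_pts//.
  by move=> /andP[_ /eqP].
- split.
    by have := DP l.+1 (leqnn _); rewrite tauq cnt_full /c pin_last => ->.
  apply/forallP => -[j jl]; rewrite -(pin_ord jl).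
  have jl1 : (j.+1 <= l.+1)%N by exact: ltnW.
  have [p1 p2] := pin_gt0 jl1.
  by rewrite mem_path_pts// -/(tau j.+1) tau_le// DP/= /c.
Qed.

Let sum_paths (F : seq (nat * nat) -> R) :
  \sum_(s in paths_through M N a) F (points s) = \sum_(D in P) F (path_pts D).
Proof.
transitivity (\sum_(p <- [seq points s | s in paths_through M N a]) F p).
  by rewrite big_image.
by rewrite (perm_big _ (perm_paths_through M' N' a)) pinnedE big_image.
Qed.

Let card_paths : #|paths_through M N a|%:R = #|P|%:R :> R.
Proof.
rewrite -!sum1_card !natr_sum; exact: (sum_paths (fun=> 1)).
Qed.

Lemma paths_through_neq0 : (0 < #|paths_through M N a|)%N.
Proof.
by rewrite -(ltr_nat R) card_paths ltr_nat (pinned_neq0 tau0 c0 tauq).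
Qed.

Let visitE z : visit M N a z =
  (\sum_(D in P) (z \in path_pts D)%:R) / #|P|%:R.
Proof.
rewrite /visit card_paths; congr (_ / _).
rewrite -sum1_card natr_sum -(sum_paths (fun s => (z \in s)%:R)) big_mkcondr /=.
by apply: eq_bigr => s _; case: (z \in points s).
Qed.

Variable b : R.
Hypothesis b_gt0 : 0 < b.
Hypothesis pin1_ge : forall j, (j < l.+1)%N ->
  let d1 := (pin M N a j.+1).1%:R - (pin M N a j).1%:R in
  let d2 := (pin M N a j.+1).2%:R - (pin M N a j).2%:R in
  b * (d1 + d2) <= d1 /\ b * (d1 + d2) <= d2.

(** A bound for the largest atom of the position at time [t]. In the first sum, truncated
    subtraction and [invsqrt 0 = 0] leave only the block that contains [t] in its interior; the
    second sum covers the pins, where the position is deterministic and the atom is 1. *)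
Let K (t : nat) : R :=
  \sum_(j < l.+1) 4 / b * invsqrt (minn (t - tau j) (tau j.+1 - t)) +
  \sum_(j < l.+2) (t == tau j)%:R.

Let K1_ge0 t : 0 <= \sum_(j < l.+1) 4 / b *
  (invsqrt (minn (t - tau j) (tau j.+1 - t)) : R).
Proof.
apply: sumr_ge0 => j _; rewrite mulr_ge0 ?invsqrt_ge0//.
by rewrite divr_ge0// ltW.
Qed.

Let K_ge0 t : 0 <= K t.
Proof. by rewrite addr_ge0 ?K1_ge0// sumr_ge0. Qed.

Let P_gt0 : 0 < #|P|%:R :> R.
Proof. by rewrite ltr0n (pinned_neq0 tau0 c0 tauq). Qed.

Let count_le_K t i : (t <= n)%N ->
  #|[set D in P | cnt D t == i]%SET|%:R / #|P|%:R <= K t.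
Proof.
move=> tn.
have : (exists2 j, (j < l.+2)%N & t = tau j) \/
       (exists2 j, (j < l.+1)%N & (tau j < t < tau j.+1)%N).
  have H k : (k <= l.+1)%N -> (t <= tau k)%N ->
      (exists2 j, (j < l.+2)%N & t = tau j) \/
      (exists2 j, (j < l.+1)%N & (tau j < t < tau j.+1)%N).
    elim: k => [_|k IH kl tk].
      by rewrite tau0 leqn0 => /eqP ->; left; exists 0%N.
    have [tk'|kt] := leqP t (tau k); first exact: IH (ltnW kl) tk'.
    move: tk; rewrite leq_eqVlt => /predU1P[->|tk]; first by left; exists k.+1.
    by right; exists k; rewrite ?kt.
  by apply: (H l.+1) => //; rewrite tauq.
case=> [[j jl tE]|[j jl tj]].
  apply: (@le_trans _ _ 1).
    rewrite ler_pdivrMr// mul1r ler_nat subset_leq_card//.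
    by apply/fintype.subsetP => D; rewrite inE => /andP[].
  rewrite /K (bigD1 (Ordinal jl) (F := fun j : 'I__ => (t == tau j)%:R)) //= tE eqxx.
  by rewrite addrCA lerDl addr_ge0// sumr_ge0.
have bL := pin1_ge jl; move: bL => /=.
have dE : (pin M N a j.+1).1%:R - (pin M N a j).1%:R +
    ((pin M N a j.+1).2%:R - (pin M N a j).2%:R) = (tau j.+1 - tau j)%:R :> R.
  have [p1 p2] := pin_gt0 (ltnW jl); have [q1 q2] := pin_gt0 jl.
  rewrite natrB ?(ltnW (tau_lt jl))// /tau !natrB ?natrD; [ring|lia|lia].
have cE : (c j.+1 - c j)%:R = (pin M N a j.+1).1%:R - (pin M N a j).1%:R :> R.
  have [p1 p2] := pin_gt0 (ltnW jl); have := pin1_lt jl.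
  by rewrite -natrB ?(ltnW (pin1_lt jl))// /c => h; congr (_%:R); lia.
rewrite dE => -[b1 b2].
have h1 : b * (tau j.+1 - tau j)%:R <= (c j.+1 - c j)%:R by rewrite cE.
have h2 : b * (tau j.+1 - tau j)%:R <= (tau j.+1 - tau j)%:R - (c j.+1 - c j)%:R.
  suff -> : (tau j.+1 - tau j)%:R - (c j.+1 - c j)%:R =
    (pin M N a j.+1).2%:R - (pin M N a j).2%:R :> R by [].
  by rewrite -dE cE addrAC subrr add0r.
have := card_pinned_le tauq tau_lt i jl tj b_gt0 h1 h2.
rewrite -/P => H; rewrite ler_pdivrMr//; apply: (le_trans H).
rewrite mulrAC ler_wpM2r//.
rewrite /K (bigD1 (Ordinal jl)) //= -addrA lerDl addr_ge0//; last first.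
  by rewrite sumr_ge0.
apply: sumr_ge0 => i' _; rewrite mulr_ge0 ?invsqrt_ge0//.
by rewrite divr_ge0// ltW.
Qed.

Let sum_K : \sum_(t < n.+1) K t <=
  (l.+2)%:R * (16 / b + 1) * Num.sqrt n.+1%:R.
Proof.
rewrite big_split /= mulrDr mulr1 mulrDl lerD//.
  rewrite exchange_big /=.
  apply: (@le_trans _ _ (\sum_(j < l.+1) (16 / b * Num.sqrt n.+1%:R))).
    apply: ler_sum => j _; rewrite -mulr_sumr.
    rewrite (_ : 16 / b * _ = 4 / b * (4 * Num.sqrt n.+1%:R)); last by ring.
    rewrite ler_wpM2l ?divr_ge0 ?(ltW b_gt0)//.
    by rewrite sum_invsqrt_min// tau_le.
  rewrite sumr_const card_ord -[leLHS]mulr_natl mulrA.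
  rewrite ler_wpM2r ?sqrtr_ge0// ler_wpM2r ?ler_nat//.
  by rewrite divr_ge0// ltW.
rewrite exchange_big /=.
apply: (@le_trans _ _ (\sum_(j < l.+2) 1)).
  apply: ler_sum => j _.
  have jl : (tau j < n.+1)%N by rewrite ltnS tau_le// -ltnS.
  rewrite (bigD1 (Ordinal jl)) //= eqxx big1 ?addr0// => t.
  by rewrite -val_eqE /= => /negbTE ->.
rewrite sumr_const card_ord -[leLHS]mulr_natl mulr1 ler_peMr//.
by rewrite -[leLHS]sqrtr1 ler_wsqrtr// ler1n.
Qed.

(** The sum bounds the expected number of common points, within [s], of two independent paths. One
    factor is replaced by the largest atom at the time of [z]; what remains is the mean of the sum
    of [K] along a path, and a path passes each time exactly once. *)
Lemma sum_visit_sq (s : seq (nat * nat)) : uniq s ->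
  (forall z, z \in s -> (0 < z.1)%N /\ (0 < z.2)%N) ->
  \sum_(z <- s) visit M N a z ^+ 2 <=
  (l.+2)%:R * (16 / b + 1) * Num.sqrt n.+1%:R.
Proof.
move=> us spos; apply: le_trans sum_K.
pose tz (z : nat * nat) := (z.1 + z.2 - 2)%N.
have v0 z : 0 <= visit M N a z by rewrite divr_ge0.
have vK z : z \in s -> visit M N a z <= K (tz z).
  move=> /spos[z1 z2]; rewrite visitE.
  have [tn|nt] := leqP (tz z) n; last first.
    rewrite big1 ?mul0r// => D _.
    by rewrite mem_path_pts// -/(tz z) leqNgt nt.
  apply: le_trans (count_le_K z.1.-1 tn); rewrite ler_wpM2r ?invr_ge0//.
  rewrite -sum1_card natr_sum big_mkcond [leRHS]big_mkcond /=.
  apply: ler_sum => D _; rewrite [X in _ <= if X then _ else _]finset.in_set.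
  case: (D \in P) => //=; rewrite mem_path_pts// -/(tz z) tn /=.
  by case: (_ == _).
apply: (@le_trans _ _ (\sum_(z <- s) K (tz z) * visit M N a z)).
  rewrite big_seq [leRHS]big_seq; apply: ler_sum => z zs.
  by rewrite expr2 ler_wpM2r// vK.
have -> : \sum_(z <- s) K (tz z) * visit M N a z =
    (\sum_(D in P) \sum_(z <- s) K (tz z) * (z \in path_pts D)%:R) / #|P|%:R.
  rewrite exchange_big /= mulr_suml; apply: eq_bigr => z _.
  by rewrite visitE -mulr_sumr mulrA.
rewrite ler_pdivrMr// mulr_natr -sumr_const; apply: ler_sum => D _.
rewrite (eq_bigr (fun z => if z \in path_pts D then K (tz z) else 0)); last first.
  by move=> z _; case: (z \in _); rewrite ?mulr1 ?mulr0.
rewrite -big_mkcond -big_filter.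
rewrite (perm_big [seq z <- path_pts D | z \in s]); last first.
  apply: uniq_perm; rewrite ?filter_uniq ?uniq_path_pts//.
  by move=> z; rewrite !mem_filter andbC.
rewrite big_filter big_mkcond.
apply: (@le_trans _ _ (\sum_(z <- path_pts D) K (tz z))).
  by apply: ler_sum => z _; case: ifP.
rewrite big_map -[iota 0 n.+1]/(index_iota 0 n.+1) big_mkord.
by apply: ler_sum => t _; rewrite /tz path_pos_time subn2.
Qed.

End overlap.

(** * Rounding of the prescribed points *)

Section pins_asymptotics.
Context {R : realType}.

Lemma scaled_itv (x : R) N : 0 <= x -> x * N%:R - 1 <= (scaled x N)%:R <= x * N%:R.
Proof.
move=> x0; have xN : 0 <= x * N%:R by rewrite mulr_ge0.
have /andP[h1 h2] := truncn_itv xN; rewrite /scaled h1 andbT lerBlDr natr1.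
exact: ltW.
Qed.

Lemma exists_lower_bound k (f : nat -> R) : (forall j, (j < k)%N -> 0 < f j) ->
  exists2 g, 0 < g & forall j, (j < k)%N -> g <= f j.
Proof.
elim: k => [|k IH] fk; first by exists 1.
have [|g g0 gf] := IH; first by move=> j jk; exact: fk (leqW jk).
exists (Num.min g (f k)); first by rewrite lt_min g0 fk.
move=> j; rewrite ltnS leq_eqVlt ge_min => /predU1P[->|/gf ->//].
by rewrite lexx orbT.
Qed.

Variables (l : nat).

(** The limits of the coordinates of [pin] divided by [N], indexed in the same way; for the second
    coordinates [xi] is replaced by 1. *)
Definition anchor (xi : R) (xi_ : 'I_l -> R) (j : nat) : R :=
  if j is j'.+1 then (if insub j' is Some i then xi_ i else xi) else 0.

Lemma anchor_lt (xi : R) (xi_ : 'I_l -> R) : 0 < xi ->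
  (forall i, 0 < xi_ i < xi) ->
  (forall i j : 'I_l, (i < j)%N -> xi_ i < xi_ j) ->
  forall j, (j < l.+1)%N -> anchor xi xi_ j < anchor xi xi_ j.+1.
Proof.
move=> xi0 xiI xilt [_|j jl] /=.
  by case: insubP => // i _ _; have /andP[] := xiI i.
have {}jl : (j < l)%N by [].
rewrite insubT; case: insubP => [i il iE|_]; last by have /andP[] := xiI (Ordinal jl).
by apply: xilt; rewrite iE.
Qed.

Lemma anchor_ge0 (xi : R) (xi_ : 'I_l -> R) : 0 < xi ->
  (forall i, 0 < xi_ i < xi) -> forall j, 0 <= anchor xi xi_ j <= xi.
Proof.
move=> xi0 xiI [|j] /=; first by rewrite lexx ltW.
case: insubP => [i _ _|_]; last by rewrite lexx ltW.
by have /andP[h1 h2] := xiI i; rewrite !ltW.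
Qed.

Lemma pin_asymptotics (xi : R) (xi_ zeta_ : 'I_l -> R) : 0 < xi ->
  (forall i, 0 < xi_ i < xi) ->
  (forall i j : 'I_l, (i < j)%N -> xi_ i < xi_ j) ->
  (forall i, 0 < zeta_ i < 1) ->
  (forall i j : 'I_l, (i < j)%N -> zeta_ i < zeta_ j) ->
  exists2 b : R, 0 < b & exists N0 : nat, forall N, (N0 <= N)%N ->
  let M := scaled xi N in
  let a := fun i : 'I_l => (scaled (xi_ i) N, scaled (zeta_ i) N) in
  forall j, (j < l.+1)%N ->
  [/\ ((pin M N a j).1 < (pin M N a j.+1).1)%N,
      ((pin M N a j).2 < (pin M N a j.+1).2)%N &
      let d1 := (pin M N a j.+1).1%:R - (pin M N a j).1%:R in
      let d2 := (pin M N a j.+1).2%:R - (pin M N a j).2%:R in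
      b * (d1 + d2) <= d1 /\ b * (d1 + d2) <= d2].
Proof.
move=> xi0 xiI xilt zI zlt.
pose X := anchor xi xi_; pose Y := anchor 1 zeta_.
have [gx gx0 Xg] : exists2 g, 0 < g & forall j, (j < l.+1)%N -> g <= X j.+1 - X j.
  by apply: exists_lower_bound => j jl; rewrite subr_gt0; exact: anchor_lt.
have [gy gy0 Yg] : exists2 g, 0 < g & forall j, (j < l.+1)%N -> g <= Y j.+1 - Y j.
  by apply: exists_lower_bound => j jl; rewrite subr_gt0; exact: anchor_lt.
pose g := Num.min gx gy.
have g0 : 0 < g by rewrite lt_min gx0.
(* Rounding changes a gap by at most 2, which is at most half of [g * N] once [N] exceeds [4 / g].
   On the other side [d1 + d2] is at most [(xi + 1) * N + 4], hence at most [(xi + 5) * N]. *)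
exists (g / 2 / (xi + 5)); first by rewrite !divr_gt0// ltr_wpDl// ltW.
exists (Num.truncn (4 / g)).+1 => N N0N M a j jl.
have gN : 4 / g <= N%:R.
  by apply: (@le_trans _ _ (Num.truncn (4 / g)).+1%:R);
    [rewrite ltW// truncnS_gt | rewrite ler_nat].
have {}gN : 4 <= g * N%:R by rewrite mulrC -ler_pdivrMr.
have N1 : 1 <= N%:R :> R.
  by rewrite ler1n (leq_trans _ N0N).
(* The slack is two-sided: a floor loses up to 1, whereas the starting corner has coordinate 1 and
   anchor 0. *)
have pX k : X k * N%:R - 1 <= (pin M N a k).1%:R <= X k * N%:R + 1.
  case: k => [|k].
    rewrite /X /= mul0r sub0r add0r lexx andbT; lra.
  rewrite /X /pin /=; case: insubP => [i _ _|_] /=.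
    have /andP[h0 _] := xiI i.
    have /andP[h1 h2] := scaled_itv N (ltW h0); rewrite h1 /=; lra.
  have /andP[h1 h2] := scaled_itv N (ltW xi0); rewrite h1 /=; lra.
have pY k : Y k * N%:R - 1 <= (pin M N a k).2%:R <= Y k * N%:R + 1.
  case: k => [|k].
    rewrite /Y /= mul0r sub0r add0r lexx andbT; lra.
  rewrite /Y /pin /=; case: insubP => [i _ _|_] /=.
    have /andP[h0 _] := zI i.
    have /andP[h1 h2] := scaled_itv N (ltW h0); rewrite h1 /=; lra.
  by rewrite mul1r; lra.
have gX : g <= X j.+1 - X j by rewrite (le_trans _ (Xg j jl))// ge_min lexx.
have gY : g <= Y j.+1 - Y j by rewrite (le_trans _ (Yg j jl))// ge_min lexx orbT.
have N00 : 0 <= N%:R :> R by [].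
have gXN := ler_wpM2r N00 gX; have gYN := ler_wpM2r N00 gY.
rewrite mulrBl in gXN; rewrite mulrBl in gYN.
have /andP[x1 x2] := pX j; have /andP[x3 x4] := pX j.+1.
have /andP[y1 y2] := pY j; have /andP[y3 y4] := pY j.+1.
pose d1 : R := (pin M N a j.+1).1%:R - (pin M N a j).1%:R.
pose d2 : R := (pin M N a j.+1).2%:R - (pin M N a j).2%:R.
have d1g : g * N%:R / 2 <= d1 by rewrite /d1; lra.
have d2g : g * N%:R / 2 <= d2 by rewrite /d2; lra.
have d1u : d1 <= xi * N%:R + 2.
  have /andP[h1 h2] := anchor_ge0 xi0 xiI j.
  have /andP[h3 h4] := anchor_ge0 xi0 xiI j.+1.
  have := ler_wpM2r N00 h4; have := mulr_ge0 h1 N00; rewrite /d1 -/(X j) -/(X j.+1).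
  lra.
have d2u : d2 <= N%:R + 2.
  have /andP[h1 h2] := anchor_ge0 ltr01 zI j.
  have /andP[h3 h4] := anchor_ge0 ltr01 zI j.+1.
  have := ler_wpM2r N00 h4; have := mulr_ge0 h1 N00; rewrite /d2 -/(Y j) -/(Y j.+1).
  lra.
have xi5 : 0 < xi + 5 by rewrite ltr_wpDl// ltW.
have d12 : g / 2 / (xi + 5) * (d1 + d2) <= g * N%:R / 2.
  rewrite (_ : g / 2 / (xi + 5) * _ = g * (d1 + d2) / 2 / (xi + 5)); last by ring.
  rewrite ler_pdivrMr//.
  rewrite (_ : g * N%:R / 2 * _ = g * (N%:R * (xi + 5)) / 2); last by ring.
  rewrite ler_wpM2r// ler_wpM2l ?(ltW g0)// mulrDr; lra.
split.
- rewrite -(ltr_nat R) -subr_gt0 (lt_le_trans _ d1g)//; lra.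
- rewrite -(ltr_nat R) -subr_gt0 (lt_le_trans _ d2g)//; lra.
- by split; [exact: le_trans d12 d1g | exact: le_trans d12 d2g].
Qed.

End pins_asymptotics.

(** * The normal distribution function and the heat equation *)

Section pointwise_derivatives.
Context {R : realType}.
Implicit Types (f g : R -> R) (x a b : R).

Lemma is_derive1M f g x a b : is_derive x 1 f a -> is_derive x 1 g b ->
  is_derive x 1 (fun y => f y * g y) (a * g x + f x * b).
Proof.
move=> fx gx; apply: (@is_derive_eq _ _ _ _ _ _ _ _ (is_deriveM fx gx)).
by rewrite /GRing.scale /= addrC mulrC.
Qed.

Lemma is_derive1D f g x a b : is_derive x 1 f a -> is_derive x 1 g b ->
  is_derive x 1 (fun y => f y + g y) (a + b).
Proof. by move=> fx gx; exact: is_deriveD. Qed.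

Lemma is_derive1B f g x a b : is_derive x 1 f a -> is_derive x 1 g b ->
  is_derive x 1 (fun y => f y - g y) (a - b).
Proof. by move=> fx gx; exact: is_deriveB. Qed.

Lemma is_derive1_cst x a : is_derive x 1 (fun _ : R => a) 0.
Proof. exact: is_derive_cst. Qed.

Lemma is_derive1_id x : is_derive x 1 (fun y : R => y) 1.
Proof. exact: is_derive_id. Qed.

Lemma is_derive1Zl f x a b : is_derive x 1 f b ->
  is_derive x 1 (fun y => a * f y) (a * b).
Proof.
move=> fx; apply: (@is_derive_eq _ _ _ _ _ _ _ _
  (is_derive1M (is_derive1_cst x a) fx)).
by rewrite mul0r add0r.
Qed.

Lemma is_derive1_comp_pw f g x a b :
  is_derive (g x) 1 f a -> is_derive x 1 g b ->
  is_derive x 1 (fun y => f (g y)) (a * b).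
Proof. by move=> fx gx; exact: is_derive1_comp. Qed.

Lemma MVT_within f f' a b : a <= b ->
  (forall x, a <= x <= b -> is_derive x 1 f (f' x)) ->
  exists2 c, a <= c <= b & f b - f a = f' c * (b - a).
Proof.
move=> ab df; have [||c cab fE] := @MVT_segment R f f' a b ab.
- by move=> x /[!in_itv]/= /andP[ax xb]; apply: df; rewrite !ltW.
- apply: continuous_in_subspaceT => x /[!inE]/= /[!in_itv]/= /df[d _].
  by apply/differentiable_continuous/derivable1_diffP.
- by exists c => //; rewrite in_itv in cab.
Qed.

(** Used repeatedly in place of Taylor's formula: every application integrates the bound once. The
    factor [(k + 1)^-1] is given away, which only affects constants. *)
Lemma MVT_norm_bound f f' (C : R) k : (forall x, is_derive x 1 f (f' x)) ->
  f 0 = 0 -> (forall x, `|f' x| <= C * `|x| ^+ k) ->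
  forall x, `|f x| <= C * `|x| ^+ k.+1.
Proof.
move=> df f0 f'C x.
suff [c cx ->] : exists2 c, `|c| <= `|x| & f x = f' c * x.
  rewrite normrM exprSr mulrA ler_wpM2r// (le_trans (f'C c))// ler_wpM2l//.
    have := f'C 1; rewrite normr1 expr1n mulr1; exact: le_trans.
  by rewrite lerXn2r// nnegrE.
have [x0|/ltW x0] := leP 0 x.
  have [c /andP[c0 cx]] := @MVT_within f f' 0 x x0 (fun x _ => df x).
  rewrite f0 !subr0 => ->; exists c => //; by rewrite !ger0_norm.
have [c /andP[c0 cx]] := @MVT_within f f' x 0 x0 (fun x _ => df x).
rewrite f0 !sub0r mulrN => /oppr_inj ->; exists c => //.
by rewrite !ler0_norm// lerN2.
Qed.

End pointwise_derivatives.

Section gauss.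
Context {R : realType}.
Implicit Types x y a b t h : R.

Definition gauss_density x : R := normal_peak 1 * expR (- (x ^+ 2 / 2)).

Definition gauss_cdf x : R := fine (normal_prob 0 1 `]-oo, x]%classic).

Lemma gauss_cdfE x : normal_prob 0 1 `]-oo, x]%classic = (gauss_cdf x)%:E.
Proof.
rewrite /gauss_cdf fineK// ge0_fin_numE ?measure_ge0//.
by rewrite (le_lt_trans (probability_le1 _ _)) ?ltry.
Qed.

Lemma gauss_cdf_ge0 x : 0 <= gauss_cdf x.
Proof. by rewrite -lee_fin -gauss_cdfE measure_ge0. Qed.

Lemma gauss_cdf_le1 x : gauss_cdf x <= 1.
Proof. by rewrite -lee_fin -gauss_cdfE probability_le1. Qed.

Lemma le_gauss_cdf x y : x <= y -> gauss_cdf x <= gauss_cdf y.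
Proof.
move=> xy; rewrite -lee_fin -!gauss_cdfE le_measure ?inE//.
exact: subset_itvl.
Qed.

(** As a random variable under the normal law, the identity has [gauss_cdf] as its [cdf], and this
    provides the limits at both infinities. *)
Let idTR : measurableTypeR R -> R := idfun.

#[local] HB.instance Definition _ :=
  @isMeasurableFun.Build _ _ _ _ idTR (@measurable_id _ _ setT).

Lemma gauss_cdf_cvgy : gauss_cdf x @[x --> +oo] --> (1 : R).
Proof.
have := cvg_cdfy1 (idTR : {RV (normal_prob (0 : R) 1) >-> R}).
rewrite (_ : cdf _ = EFin \o gauss_cdf); first by move/fine_cvgP => [].
by apply/funext => x /=; rewrite -gauss_cdfE.
Qed.

Lemma gauss_cdf_cvgNy : gauss_cdf x @[x --> -oo] --> (0 : R).
Proof.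
have := cvg_cdfNy0 (idTR : {RV (normal_prob (0 : R) 1) >-> R}).
rewrite (_ : cdf _ = EFin \o gauss_cdf); first by move/fine_cvgP => [].
by apply/funext => x /=; rewrite -gauss_cdfE.
Qed.

Lemma normal_peak1_ge0 : 0 <= normal_peak (1 : R).
Proof. exact: normal_peak_ge0. Qed.

Lemma normal_peak1_le1 : normal_peak (1 : R) <= 1.
Proof.
have h : 1 <= (1 ^+ 2 * pi *+ 2 : R).
  by rewrite expr1n mul1r -mulr_natr; have := @pi_ge2 R; lra.
rewrite /normal_peak invf_le1 ?sqrtr_gt0; last exact: lt_le_trans h.
by rewrite -[leLHS]sqrtr1 ler_sqrt// (le_trans ler01).
Qed.

Lemma gauss_densityE x : gauss_density x = normal_pdf 0 1 x.
Proof.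
rewrite normal_pdfE// /gauss_density /= /normal_fun subr0 expr1n.
by congr (_ * expR _); rewrite mulNr.
Qed.

Lemma gauss_density_ge0 x : 0 <= gauss_density x.
Proof. by rewrite mulr_ge0 ?normal_peak1_ge0 ?expR_ge0. Qed.

(* Since e^y >= 1 + y + y^2/2 for y = x^2/2 >= 0. *)
Lemma gauss_density_moments x :
  (1 + x ^+ 2 / 2 + x ^+ 4 / 8) * gauss_density x <= 2.
Proof.
have y0 : 0 <= x ^+ 2 / 2 by rewrite divr_ge0 ?sqr_ge0.
have := expR_ge1Dx (x ^+ 2 / 2); have := expR_ge1Dxn 1 y0.
rewrite (_ : 2`!%:R = 2 :> R)// => e2 e1.
have e3 : 1 + x ^+ 2 / 2 + x ^+ 4 / 8 <= 2 * expR (x ^+ 2 / 2).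
  have -> : x ^+ 4 / 8 = (x ^+ 2 / 2) ^+ 2 / 2 by field.
  lra.
rewrite /gauss_density expRN mulrCA; apply: (@le_trans _ _ (1 * 2)); last first.
  by rewrite mul1r.
apply: ler_pM => //; first exact: normal_peak1_ge0.
- rewrite mulr_ge0 ?invr_ge0 ?expR_ge0// !addr_ge0 ?divr_ge0 ?exprn_even_ge0//.
- exact: normal_peak1_le1.
- by rewrite ler_pdivrMr ?expR_gt0.
Qed.

Lemma is_derive_gauss_density x :
  is_derive x 1 gauss_density (- x * gauss_density x).
Proof.
have d := is_derive1Zl (normal_peak 1)
  (@is_derive1_comp_pw _ expR (fun y => - 2^-1 * (y * y)) _ _ _
    (is_derive_expR (- 2^-1 * (x * x)))
    (is_derive1Zl (- 2^-1) (is_derive1M (is_derive1_id x) (is_derive1_id x)))).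
have -> : gauss_density = fun y => normal_peak 1 * expR (- 2^-1 * (y * y)).
  by apply/funext => y; congr (_ * expR _); field.
by apply: (@is_derive_eq _ _ _ _ _ _ _ _ d); field.
Qed.

Lemma is_derive_gauss_cdf x : is_derive x 1 gauss_cdf (gauss_density x).
Proof.
have H : (@lebesgue_measure R).-integrable [set` Interval -oo%O (BRight (x + 1))]
    (EFin \o gauss_density).
  apply: (@integrableS _ _ _ _ setT) => //.
  rewrite (_ : EFin \o _ = fun x => (normal_pdf 0 1 x)%:E).
    exact: integrable_normal_pdf.
  by apply/funext => y /=; rewrite gauss_densityE.
have xx1 : x < x + 1 by rewrite ltrDl.
have cx : {for x, continuous gauss_density}.
  have [/derivable1_diffP d _] := is_derive_gauss_density x.
  exact/differentiable_continuous.
have [d dE] := continuous_FTC1 xx1 H (ltNyr _) cx.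
have E : gauss_cdf =
    fun y => (\int[lebesgue_measure]_(t in [set` `]-oo, y]]) gauss_density t)%R.
  apply/funext => y; rewrite /gauss_cdf /normal_prob /Rintegral.
  by congr fine; apply: eq_integral => z _; rewrite gauss_densityE.
rewrite E; apply: DeriveDef; first exact: d.
by rewrite -derive1E dE.
Qed.

Let is_derive_shift (x h : R) : is_derive h 1 (fun y => x + y) 1.
Proof.
apply: (@is_derive_eq _ _ _ _ _ _ _ _
  (is_derive1D (is_derive1_cst h x) (is_derive1_id h))).
by rewrite add0r.
Qed.

Lemma gauss_cdf_lip x y : `|gauss_cdf x - gauss_cdf y| <= `|x - y|.
Proof.
wlog xy : x y / x <= y.
  by move=> H; have [/H//|/ltW/H] := leP x y; rewrite distrC (distrC y).
have [c _ E] := MVT_within xy (fun z _ => is_derive_gauss_cdf z).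
rewrite distrC (distrC x) E normrM ler_piMl// ger0_norm ?gauss_density_ge0//.
rewrite /gauss_density -[leRHS]mulr1 ler_pM ?normal_peak1_ge0 ?expR_ge0//.
  exact: normal_peak1_le1.
by rewrite expR_le1 oppr_le0 divr_ge0 ?sqr_ge0.
Qed.

(** Up to sign these are the first three derivatives of the density. Each polynomial factor is at
    most a constant times [1 + x ^+ 2 / 2 + x ^+ 4 / 8], and [gauss_density_moments] turns that
    constant into twice itself. *)
Lemma gauss_density_bounds x :
  [/\ `|x * gauss_density x| <= 4,
     `|(x ^+ 2 - 1) * gauss_density x| <= 6 &
     `|(3 * x - x ^+ 3) * gauss_density x| <= 36].
Proof.
have := gauss_density_moments x; have := gauss_density_ge0 x.
set f := gauss_density x => f0 fx.
have x4 : x ^+ 4 = (x ^+ 2) ^+ 2 by rewrite -exprM.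
have x2 := sqr_ge0 x; have x40 : 0 <= x ^+ 4 by rewrite x4 sqr_ge0.
have bound c q : `|q| <= c * (1 + x ^+ 2 / 2 + x ^+ 4 / 8) -> `|q * f| <= c * 2.
  move=> qc; rewrite normrM (ger0_norm f0).
  have c0 : 0 <= c.
    have : 0 < 1 + x ^+ 2 / 2 + x ^+ 4 / 8 by lra.
    by move=> /pmulr_lge0 <-; exact: le_trans qc.
  by rewrite (le_trans (ler_wpM2r f0 qc))// -mulrA ler_wpM2l.
have x1 : (`|x|) ^+ 2 = x ^+ 2 by rewrite real_normK ?num_real.
have xn : `|x| <= 1 + x ^+ 2 / 2 + x ^+ 4 / 8.
  have := sqr_ge0 (`|x| - 1); rewrite sqrrB1 x1 => h; have := normr_ge0 x; lra.
split.
- have -> : 4 = 2 * 2 :> R by ring.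
  apply: bound; lra.
- have -> : 6 = 3 * 2 :> R by ring.
  apply: bound; rewrite ler_norml; apply/andP; split; lra.
- have -> : 36 = 18 * 2 :> R by ring.
  apply: bound; rewrite (le_trans (ler_normB _ _))// normrM ger0_norm//.
  rewrite normrX exprS x1.
  have := sqr_ge0 (`|x| - 1); have := sqr_ge0 (x ^+ 2 - 1).
  rewrite !sqrrB1 x1 -x4 => h1 h2.
  have : `|x| * x ^+ 2 <= (x ^+ 2 + x ^+ 4) / 2.
    have := mulr_ge0 x2 (sqr_ge0 (`|x| - 1)).
    rewrite sqrrB1 x1 x4; lra.
  lra.
Qed.

(** The remainder [g0] has derivative [g1], which has derivative [g2]; all three vanish at 0 and the
    derivative of [g2] is at most 6 in absolute value. Three mean value steps give the cubic
    bound. *)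
Lemma gauss_cdf_taylor x h :
  `|gauss_cdf (x + h) - gauss_cdf x - gauss_density x * h
    + x * gauss_density x / 2 * h ^+ 2| <= 6 * `|h| ^+ 3.
Proof.
pose f := gauss_density.
have df y : is_derive y 1 (fun z => f (x + z)) (- (x + y) * f (x + y)).
  apply: (@is_derive_eq _ _ _ _ _ _ _ _
    (@is_derive1_comp_pw _ f (fun z => x + z) _ _ _
      (is_derive_gauss_density (x + y)) (is_derive_shift x y))).
  by rewrite mulr1.
pose g2 z := (x * f x - (x + z) * f (x + z)).
have dg2 y : is_derive y 1 g2 (((x + y) ^+ 2 - 1) * f (x + y)).
  apply: (@is_derive_eq _ _ _ _ _ _ _ _ (is_derive1B (is_derive1_cst y (x * f x))
    (is_derive1M (is_derive_shift x y) (df y)))).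
  by ring.
pose g1 z := f (x + z) - f x + x * f x * z.
have dg1 y : is_derive y 1 g1 (g2 y).
  apply: (@is_derive_eq _ _ _ _ _ _ _ _ (is_derive1D
    (is_derive1B (df y) (is_derive1_cst y (f x)))
    (is_derive1Zl (x * f x) (is_derive1_id y)))).
  by rewrite /g2; ring.
pose g0 z := gauss_cdf (x + z) - gauss_cdf x - f x * z
  + x * f x / 2 * (z * z).
have dg0 y : is_derive y 1 g0 (g1 y).
  apply: (@is_derive_eq _ _ _ _ _ _ _ _ (is_derive1D
    (is_derive1B (is_derive1B (@is_derive1_comp_pw _ gauss_cdf
        (fun z => x + z) _ _ _ (is_derive_gauss_cdf (x + y)) (is_derive_shift x y))
      (is_derive1_cst y (gauss_cdf x)))
      (is_derive1Zl (f x) (is_derive1_id y)))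
    (is_derive1Zl (x * f x / 2) (is_derive1M (is_derive1_id y) (is_derive1_id y))))).
  by rewrite /g1 -/f; field.
have b2 : forall y, `|((x + y) ^+ 2 - 1) * f (x + y)| <= 6 * `|y| ^+ 0.
  by move=> y; rewrite expr0 mulr1; have [] := gauss_density_bounds (x + y).
have b1 : forall y, `|g2 y| <= 6 * `|y| ^+ 1.
  by apply: (MVT_norm_bound dg2) b2; rewrite /g2 addr0 subrr.
have b0 : forall y, `|g1 y| <= 6 * `|y| ^+ 2.
  by apply: (MVT_norm_bound dg1) b1; rewrite /g1 addr0 subrr mulr0 addr0.
have g00 : g0 0 = 0 by rewrite /g0 addr0 subrr !mulr0 subrr addr0.
have := MVT_norm_bound dg0 g00 b0 h.
by rewrite /g0 -expr2.
Qed.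

End gauss.

Section heat.
Context {R : realType}.
Implicit Types x y a b t h : R.

Lemma is_derive_invsqrt t : 0 < t ->
  is_derive t 1 (fun s => (Num.sqrt s)^-1) (- 2^-1 * (Num.sqrt t)^-1 ^+ 3).
Proof.
move=> t0; have s0 : Num.sqrt t != 0 by rewrite sqrtr_eq0 -ltNge.
have d : is_derive t 1 Num.sqrt (2 * Num.sqrt t)^-1 by exact: is_derive1_sqrt.
have dV : is_derive t 1 (fun s => (Num.sqrt s)^-1) 
   (- (Num.sqrt t) ^- 2 *: (2 * Num.sqrt t)^-1).
  case: d => d1 d2; apply: DeriveDef; first exact: derivableV.
  by rewrite (deriveV s0 d1) d2.
apply: (@is_derive_eq _ _ _ _ _ _ _ _ dV).
rewrite /GRing.scale /=; field; exact: s0.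
Qed.

(** First order expansion in the time. The second time derivative is [(3 * x - x ^+ 3) *
    gauss_density x / (4 * t ^+ 2)], with [x] taken at that time, and 9 is 36 / 4. *)
Lemma gauss_cdf_time a t (d : R) : 0 < t -> 0 <= d ->
  let x := a / Num.sqrt t in
  `|gauss_cdf (a / Num.sqrt (t + d)) - gauss_cdf x
    + x * gauss_density x / 2 * (d / t)| <= 9 * (d / t) ^+ 2.
Proof.
move=> t0 d0 /=; set x := a / Num.sqrt t; pose r s : R := (Num.sqrt s)^-1.
have sr (s : R) : 0 < s -> r s ^+ 2 = s^-1.
  by move=> s0; rewrite /r exprVn sqr_sqrtr// ltW.
have dr (s : R) : 0 < s -> is_derive s 1 (fun u => a * r u) (a * (- 2^-1 * r s ^+ 3)).
  by move=> s0; apply: is_derive1Zl; exact: is_derive_invsqrt.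
have dg (s : R) : 0 < s -> is_derive s 1 (fun u => gauss_cdf (a * r u))
    (gauss_density (a * r s) * (a * (- 2^-1 * r s ^+ 3))).
  by move=> s0; apply: (@is_derive1_comp_pw _ gauss_cdf (fun u => a * r u));
    [exact: is_derive_gauss_cdf | exact: dr].
have ddg (s : R) : 0 < s -> is_derive s 1
    (fun u => gauss_density (a * r u) * (a * (- 2^-1 * r u ^+ 3)))
    (4^-1 * r s ^+ 4 * ((3 * (a * r s) - (a * r s) ^+ 3) * gauss_density (a * r s))).
  move=> s0.
  have e : (fun u => gauss_density (a * r u) * (a * (- 2^-1 * r u ^+ 3))) =
    (fun u => gauss_density (a * r u) * (- (2^-1) * a * (r u * (r u * r u)))).
    by apply/funext => u; field.
  rewrite e; apply: (@is_derive_eq _ _ _ _ _ _ _ _ (is_derive1M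
    (@is_derive1_comp_pw _ gauss_density (fun u => a * r u) _ _ _
      (is_derive_gauss_density (a * r s)) (dr s s0))
    (is_derive1Zl (- 2^-1 * a) (is_derive1M (is_derive_invsqrt s0)
      (is_derive1M (is_derive_invsqrt s0) (is_derive_invsqrt s0)))))).
  by rewrite -/(r s); set q := r s; set ff := gauss_density _; clearbody q ff; field.
have td : t <= t + d by rewrite lerDl.
have pos (s : R) : t <= s <= t + d -> 0 < s by move=> /andP[ts _]; exact: lt_le_trans ts.
have /(MVT_within td)[c /andP[tc cd] E] : forall s : R, t <= s <= t + d ->
    is_derive s 1 (fun u => gauss_cdf (a * r u))
      (gauss_density (a * r s) * (a * (- 2^-1 * r s ^+ 3))).
  by move=> s /pos; exact: dg.
have pos' (s : R) : t <= s <= c -> 0 < s.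
  by move=> /andP[ts _]; exact: lt_le_trans ts.
have /(MVT_within tc)[c' /andP[tc' cc'] E'] : forall s : R, t <= s <= c ->
    is_derive s 1 (fun u => gauss_density (a * r u) * (a * (- 2^-1 * r u ^+ 3)))
    (4^-1 * r s ^+ 4 *
     ((3 * (a * r s) - (a * r s) ^+ 3) * gauss_density (a * r s))).
  by move=> s /pos'; exact: ddg.
rewrite -/(r t) -/(r (t + d)) -/x in E *.
have -> : gauss_cdf (a / Num.sqrt (t + d)) - gauss_cdf x +
    x * gauss_density x / 2 * (d / t) = (c - t) * d *
  (4^-1 * r c' ^+ 4 *
   ((3 * (a * r c') - (a * r c') ^+ 3) * gauss_density (a * r c'))).
  have -> : x * gauss_density x / 2 * (d / t) =
     - (gauss_density x * (a * (- 2^-1 * r t ^+ 3))) * d.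
    by rewrite /x -/(r t) -(sr t t0); field.
  transitivity ((gauss_density (a * r c) * (a * (- 2^-1 * r c ^+ 3)) -
    gauss_density x * (a * (- 2^-1 * r t ^+ 3))) * d).
    rewrite -/(r (t + d)) E; ring.
  rewrite E'; ring.
have [_ _ B] := gauss_density_bounds (a * r c').
have r4 : 0 <= r c' ^+ 4 <= t^-1 ^+ 2.
  have c'0 : 0 < c' by exact: lt_le_trans tc'.
  rewrite -[4%N]/(2 * 2)%N exprM sr// exprn_ge0 ?invr_ge0 ?(ltW c'0)//=.
  by rewrite lerXn2r ?nnegrE ?invr_ge0 ?(ltW c'0) ?(ltW t0)// lef_pV2.
have ct : 0 <= (c - t) * d <= d ^+ 2.
  rewrite mulr_ge0 ?subr_ge0//= expr2 ler_wpM2r// lerBlDl//.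
case/andP: r4 => r40 r4; case/andP: ct => ct0 ct.
have q0 : 0 <= 4^-1 * r c' ^+ 4 by rewrite mulr_ge0.
rewrite normrM (ger0_norm ct0) normrM (ger0_norm q0).
rewrite (_ : 9 * _ = d ^+ 2 * (4^-1 * t^-1 ^+ 2 * 36)).
  apply: ler_pM => //; first exact: mulr_ge0 q0 (normr_ge0 _).
  by apply: ler_pM => //; rewrite ler_wpM2l.
by field; rewrite gt_eqF.
Qed.

(* u_t(y) = gauss_cdf ((a - y) / sqrt t) solves the heat equation, so adding an
   independent centred step of variance 1/n amounts to t -> t + 1/n. *)
Lemma heat_step (J : finType) (pi v : J -> R) (B e : R) :
  (forall j, 0 <= pi j) -> \sum_j pi j = 1 -> (forall j, `|v j| <= B) ->
  0 < e <= 1 ->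
  let m1 := \sum_j pi j * v j in let m2 := \sum_j pi j * v j ^+ 2 in
  forall a t y (n : R), e ^+ 2 <= t -> 1 <= n ->
  `|\sum_j pi j * gauss_cdf ((a - (y + v j / Num.sqrt n)) / Num.sqrt t) -
    gauss_cdf ((a - y) / Num.sqrt (t + n^-1))| <=
  e ^- 4 * (`|m1| / Num.sqrt n + 2 * `|m2 - 1| / n +
    6 * B * m2 / (n * Num.sqrt n) + 9 / n ^+ 2).
Proof.
move=> pi0 pi1 vB /andP[e0 e1] m1 m2 a t y n et n1.
have n0 : 0 < n by exact: lt_le_trans n1.
have t0 : 0 < t by rewrite (lt_le_trans _ et)// exprn_gt0.
pose x := (a - y) / Num.sqrt t.
pose h j := - (v j / (Num.sqrt n * Num.sqrt t)).
have sn0 : 0 < Num.sqrt n by rewrite sqrtr_gt0.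
have st0 : 0 < Num.sqrt t by rewrite sqrtr_gt0.
have hx j : (a - (y + v j / Num.sqrt n)) / Num.sqrt t = x + h j.
  by rewrite /x /h; field; rewrite !gt_eqF.
pose f := gauss_density x.
have T j := gauss_cdf_taylor x (h j); rewrite -/f in T.
have [b1 _ _] := gauss_density_bounds x; rewrite -/f in b1.
pose r j := gauss_cdf (x + h j) - gauss_cdf x - f * h j + x * f / 2 * h j ^+ 2.
have S : \sum_j pi j * gauss_cdf ((a - (y + v j / Num.sqrt n)) / Num.sqrt t) =
   gauss_cdf x - f * m1 / (Num.sqrt n * Num.sqrt t)
   - x * f / 2 * (m2 / (n * t)) + \sum_j pi j * r j.
  have nt : n * t = Num.sqrt n ^+ 2 * Num.sqrt t ^+ 2 by rewrite !sqr_sqrtr// ltW.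
  rewrite (eq_bigr (fun j => pi j * gauss_cdf x
    - f / (Num.sqrt n * Num.sqrt t) * (pi j * v j)
    - x * f / 2 / (n * t) * (pi j * v j ^+ 2) + pi j * r j)); last first.
    by move=> j _; rewrite hx /r /h nt; field; rewrite !gt_eqF.
  rewrite big_split /= !sumrB -mulr_suml -!mulr_sumr pi1 -/m1 -/m2 nt.
  by field; rewrite !gt_eqF.
have rb : `|\sum_j pi j * r j| <= 6 * B * m2 / (n * Num.sqrt n) / Num.sqrt t ^+ 3.
  apply: (le_trans (ler_norm_sum _ _ _)).
  have -> : 6 * B * m2 / (n * Num.sqrt n) / Num.sqrt t ^+ 3 =
     \sum_j pi j * (6 * (B * (v j ^+ 2) / (n * Num.sqrt n) / Num.sqrt t ^+ 3)).
    rewrite /m2 mulr_sumr !mulr_suml; apply: eq_bigr => j _; ring.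
  apply: ler_sum => j _; rewrite normrM ger0_norm// ler_wpM2l//.
  apply: (le_trans (T j)); rewrite ler_wpM2l//.
  have -> : `|h j| ^+ 3 = `|v j| * v j ^+ 2 / (n * Num.sqrt n) / Num.sqrt t ^+ 3.
    rewrite /h normrN normrM (ger0_norm (x := _^-1)) ?invr_ge0 ?mulr_ge0 ?ltW//.
    rewrite -(real_normK (num_real (v j))).
    have aux (q s u n' : R) : s != 0 -> u != 0 -> n' = s ^+ 2 ->
        (q * (s * u)^-1) ^+ 3 = q * q ^+ 2 / (n' * s) / u ^+ 3.
      by move=> s0 u0 ->; field; rewrite s0 u0.
    by apply: aux; rewrite ?gt_eqF// sqr_sqrtr// ltW.
  rewrite !ler_wpM2r ?sqr_ge0 ?invr_ge0 ?mulr_ge0 ?exprn_ge0// ltW//.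
have B0 : 0 <= B.
  have [j _|] := pickP J; first exact: le_trans (vB j).
  move=> J0; move: pi1; rewrite big1; first by move/eqP; rewrite eq_sym oner_eq0.
  by move=> j; have := J0 j.
have m20 : 0 <= m2 by apply: sumr_ge0 => j _; rewrite mulr_ge0 ?sqr_ge0.
have D := @gauss_cdf_time (a - y) t n^-1 t0 _; rewrite -/x -/f in D.
have {}D := D (ltac:(by rewrite invr_ge0 ltW)).
set u := gauss_cdf (_ / Num.sqrt (t + n^-1)) in D *.
rewrite S.
(* The heat equation at work: the second order term in space, of coefficient [m2], meets the
   opposite first order term in time, of coefficient 1, and only [m2 - 1] is left of the two. *)
have -> : gauss_cdf x - f * m1 / (Num.sqrt n * Num.sqrt t) -
    x * f / 2 * (m2 / (n * t)) + \sum_j pi j * r j - u =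
   - (f / Num.sqrt t * (m1 / Num.sqrt n)) + (- (x * f / 2 / t * ((m2 - 1) / n)))
   + \sum_j pi j * r j + - (u - gauss_cdf x + x * f / 2 * (n^-1 / t)).
  by field; rewrite !gt_eqF.
have f1 : 0 <= f <= 1.
  rewrite gauss_density_ge0 /= /f /gauss_density -[leRHS]mulr1.
  rewrite ler_pM ?normal_peak1_ge0 ?normal_peak1_le1 ?expR_ge0//.
  by rewrite expR_le1 oppr_le0 divr_ge0 ?sqr_ge0.
have est : e <= Num.sqrt t.
  by have := ler_wsqrtr et; rewrite sqrtr_sqr (ger0_norm (ltW e0)).
(* As [e <= 1] and [e] is at most the square root of [t], all negative powers that occur are
   absorbed by [e ^- 4]. *)
have ek k : (k <= 4)%N -> e ^- k <= e ^- 4.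
  by move=> k4; rewrite lef_pV2 ?posrE ?exprn_gt0// ler_wiXn2l// ltW.
have es k : (k <= 4)%N -> Num.sqrt t ^- k <= e ^- 4.
  move=> k4; apply: le_trans (ek k k4).
  by rewrite lef_pV2 ?posrE ?exprn_gt0// lerXn2r// nnegrE ltW.
have tE : t = Num.sqrt t ^+ 2 by rewrite sqr_sqrtr// ltW.
have e40 : 0 <= e ^- 4 by rewrite invr_ge0 exprn_ge0// ltW.
apply: (le_trans (ler_normD _ _)); rewrite !mulrDr lerD//; last first.
  rewrite normrN; apply: (le_trans D).
  rewrite [leLHS](_ : _ = (t ^+ 2)^-1 * (9 / n ^+ 2)); last first.
    by field; rewrite !gt_eqF.
  rewrite ler_wpM2r ?mulr_ge0 ?invr_ge0 ?exprn_ge0 ?(ltW n0)//.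
  by rewrite [X in (X ^+ 2)^-1]tE -exprM; exact: (es 4%N).
apply: (le_trans (ler_normD _ _)); rewrite lerD//; last first.
  apply: (le_trans rb); rewrite mulrC ler_wpM2r ?es//.
  by rewrite !mulr_ge0 ?invr_ge0 ?mulr_ge0 ?(ltW n0) ?(ltW sn0).
apply: (le_trans (ler_normD _ _)); rewrite !normrN lerD//.
  have V0 : 0 <= (Num.sqrt n)^-1 by rewrite invr_ge0 ltW.
  have W0 : 0 <= (Num.sqrt t)^-1 by rewrite invr_ge0 ltW.
  have -> : `|f / Num.sqrt t * (m1 / Num.sqrt n)| =
      f / Num.sqrt t * (`|m1| / Num.sqrt n).
    case/andP: f1 => f0 _.
    by rewrite normrM (ger0_norm (mulr_ge0 f0 W0)) normrM (ger0_norm V0).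
  rewrite ler_wpM2r ?mulr_ge0//; apply: (@le_trans _ _ (1 * (Num.sqrt t)^-1)).
    by rewrite ler_wpM2r//; case/andP: f1.
  by rewrite mul1r; exact: (es 1%N).
have V0 : 0 <= n^-1 by rewrite invr_ge0 ltW.
have W0 : 0 <= t^-1 by rewrite invr_ge0 ltW.
have -> : `|x * f / 2 / t * ((m2 - 1) / n)| = `|x * f| / 2 / t * (`|m2 - 1| / n).
  rewrite normrM (normrM (m2 - 1)) (normrM _ t^-1) (normrM _ 2^-1).
  by rewrite (ger0_norm V0) (ger0_norm W0) (ger0_norm (x := 2^-1)).
rewrite (_ : e ^- 4 * _ = (2 * e ^- 4) * (`|m2 - 1| / n)); last by ring.
rewrite ler_wpM2r ?mulr_ge0// ler_pM ?mulr_ge0//; first lra.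
by rewrite [X in X^-1]tE es.
Qed.

End heat.

(** * Bounded differences and the Lindeberg argument *)

Section exponential_moment.
Context {R : realType}.

(** From [1 - u / 2 <= expR (- (u / 2))] the exponential is at most [(1 - u / 2) ^- 2], and the
    comparison with the quadratic is then a polynomial inequality valid up to [u = 1]. *)
Lemma expR_le_quadratic (u : R) : u <= 1 -> expR u <= 1 + u + 2 * u ^+ 2.
Proof.
move=> u1; have h := expR_ge1Dx (- (u / 2)).
have h0 : 0 < 1 - u / 2 by lra.
have E : expR u * expR (- (u / 2)) ^+ 2 = 1.
  by rewrite -expRM_natl -expRD (_ : u + _ = 0) ?expR0//; field.
have q : (1 - u / 2) ^+ 2 <= expR (- (u / 2)) ^+ 2.
  by rewrite lerXn2r ?nnegrE ?expR_ge0// ltW.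
have e1 : expR u * (1 - u / 2) ^+ 2 <= 1 by rewrite -[leRHS]E ler_wpM2l ?expR_ge0.
have p : 1 <= (1 + u + 2 * u ^+ 2) * (1 - u / 2) ^+ 2.
  have -> : (1 + u + 2 * u ^+ 2) * (1 - u / 2) ^+ 2 =
    1 + u ^+ 2 * ((1 - u) * (5 - 2 * u)) / 4 by field.
  have a1 : 0 <= 1 - u by rewrite subr_ge0.
  have a2 : 0 <= 5 - 2 * u by lra.
  by rewrite lerDl divr_ge0// mulr_ge0 ?sqr_ge0// mulr_ge0.
rewrite -(ler_pM2r (exprn_gt0 2 h0)); exact: le_trans e1 p.
Qed.

(** A form of Hoeffding's lemma: after centring, the linear term of [expR_le_quadratic] averages to
    zero. *)
Lemma sum_expR_le (J : finType) (pi G : J -> R) (c : R) :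
  (forall j, 0 <= pi j) -> \sum_j pi j = 1 ->
  (forall i j, `|G i - G j| <= c) -> c <= 1 ->
  \sum_j pi j * expR (G j) <= expR (\sum_j pi j * G j + 2 * c ^+ 2).
Proof.
move=> pi0 pi1 Gc c1; set m := \sum_j pi j * G j.
have Gm j : `|G j - m| <= c.
  have -> : G j - m = \sum_i pi i * (G j - G i).
    rewrite /m -[in LHS](mul1r (G j)) -pi1 mulr_suml -sumrB.
    by apply: eq_bigr => i _; rewrite mulrBr.
  rewrite (le_trans (ler_norm_sum _ _ _))//.
  rewrite -[leRHS]mul1r -pi1 mulr_suml; apply: ler_sum => i _.
  by rewrite normrM ger0_norm// ler_wpM2l.
have -> : \sum_j pi j * expR (G j) = expR m * \sum_j pi j * expR (G j - m).
  rewrite mulr_sumr; apply: eq_bigr => j _.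
  by rewrite mulrCA -expRD addrC subrK.
rewrite expRD ler_wpM2l ?expR_ge0//.
apply: (@le_trans _ _ (1 + 2 * c ^+ 2)); last exact: expR_ge1Dx.
have -> : 1 + 2 * c ^+ 2 = \sum_j pi j * (1 + (G j - m) + 2 * c ^+ 2).
  under eq_bigr => j _ do rewrite !mulrDr mulrN mulr1.
  rewrite !big_split /= sumrN -!mulr_suml pi1 -/m; ring.
apply: ler_sum => j _; rewrite ler_wpM2l//.
apply: le_trans (expR_le_quadratic _) _.
  by rewrite (le_trans (ler_norm _))// (le_trans (Gm j)).
rewrite lerD2l ler_wpM2l// -real_normK ?num_real// lerXn2r ?nnegrE//.
exact: le_trans (Gm j).
Qed.

End exponential_moment.

(** * Expectations as iterated finite sums *)

Section iterated_expectation.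
Context {R : realType} (I : eqType) (J : finType).
Variables (pi : I -> J -> R) (v : J -> R).
Hypothesis pi_ge0 : forall z j, 0 <= pi z j.
Hypothesis pi_sum1 : forall z, \sum_j pi z j = 1.
Implicit Types (x : I -> R) (z : I) (s : seq I) (Psi : (I -> R) -> R).

Definition upd x z (a : R) : I -> R := fun y => if y == z then a else x y.

Lemma updC x z z' a b : z != z' ->
  upd (upd x z a) z' b = upd (upd x z' b) z a.
Proof.
move=> zz'; apply/funext => y; rewrite /upd.
by case: (eqVneq y z') => // ->; rewrite eq_sym (negbTE zz').
Qed.

(** The expectation of [Psi] when the sites of [s] are independent, site [z] taking the value [v j]
    with probability [pi z j], and the other sites keep their values from [x]. *)
Fixpoint iterE s Psi x : R :=
  if s is z :: s' then \sum_j pi z j * iterE s' Psi (upd x z (v j)) else Psi x.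

Lemma le_iterE s Psi Psi' x : (forall y, Psi y <= Psi' y) ->
  iterE s Psi x <= iterE s Psi' x.
Proof.
move=> le; elim: s x => [|z s IH] x /=; first exact: le.
by apply: ler_sum => j _; rewrite ler_wpM2l.
Qed.

Lemma iterE_ge0 s Psi x : (forall y, 0 <= Psi y) -> 0 <= iterE s Psi x.
Proof.
move=> Psi0; elim: s x => [//|z s IH] x /=.
by apply: sumr_ge0 => j _; rewrite mulr_ge0.
Qed.

Lemma iterE_Zl s (c : R) Psi x :
  iterE s (fun y => c * Psi y) x = c * iterE s Psi x.
Proof.
elim: s x => [//|z s IH] x /=; rewrite mulr_sumr.
by apply: eq_bigr => j _; rewrite IH mulrCA.
Qed.

Lemma iterED s Psi Psi' x :
  iterE s (fun y => Psi y + Psi' y) x = iterE s Psi x + iterE s Psi' x.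
Proof.
elim: s x => [//|z s IH] x /=; rewrite -big_split/=.
by apply: eq_bigr => j _; rewrite IH mulrDr.
Qed.

Lemma iterE_sum s (A : finType) (D : pred A) (F : A -> (I -> R) -> R) x :
  iterE s (fun y => \sum_(a | D a) F a y) x = \sum_(a | D a) iterE s (F a) x.
Proof.
elim: s x => [//|z s IH] x /=; rewrite exchange_big/=.
by apply: eq_bigr => j _; rewrite IH mulr_sumr.
Qed.

Lemma iterE_bounded_diff s Psi z a b (c : R) x : z \notin s ->
  (forall y, `|Psi (upd y z a) - Psi (upd y z b)| <= c) ->
  `|iterE s Psi (upd x z a) - iterE s Psi (upd x z b)| <= c.
Proof.
move=> + H; elim: s x => [|z' s IH] x /=; first by move=> _; exact: H.
rewrite inE negb_or => /andP[zz' zs].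
rewrite -sumrB -[leRHS]mul1r -(pi_sum1 z') mulr_suml.
rewrite (le_trans (ler_norm_sum _ _ _))//; apply: ler_sum => j _.
by rewrite -mulrBr normrM ger0_norm// ler_wpM2l// !(updC _ _ _ zz') IH.
Qed.

(** The martingale argument: as a function of the first site, the expectation over the later sites
    still has differences at most [c z], so Hoeffding's lemma applies to one site after the
    other. *)
Lemma iterE_expR_le s Psi (c : I -> R) x : uniq s ->
  (forall z i j y, z \in s ->
     `|Psi (upd y z (v i)) - Psi (upd y z (v j))| <= c z) ->
  (forall z, z \in s -> c z <= 1) ->
  iterE s (fun y => expR (Psi y)) x <=
  expR (iterE s Psi x + 2 * \sum_(z <- s) c z ^+ 2).
Proof.
move=> + Psic c1; elim: s Psic c1 x => [|z s IH] Psic c1 x /=.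
  by rewrite big_nil mulr0 addr0.
move=> /andP[zs us]; rewrite big_cons.
have zz : z \in z :: s by rewrite inE eqxx.
have sub y : y \in s -> y \in z :: s by rewrite inE orbC => ->.
have {}IH y := IH (fun z' i j y zs' => Psic z' i j y (sub z' zs'))
  (fun z' zs' => c1 z' (sub z' zs')) y us.
apply: (@le_trans _ _ (\sum_j pi z j *
    expR (iterE s Psi (upd x z (v j))) * expR (2 * \sum_(z <- s) c z ^+ 2))).
  by apply: ler_sum => j _; rewrite -mulrA ler_wpM2l// -expRD.
rewrite -mulr_suml mulrDr addrA [leRHS]expRD ler_wpM2r ?expR_ge0//.
apply: sum_expR_le => //; last exact: c1.
by move=> i j; apply: iterE_bounded_diff => // y; exact: Psic.
Qed.

(** Chernoff's bound. The sign [e] in [F] handles the upper and the lower tail together, and [theta]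
    stays free subject to the condition under which [iterE_expR_le] applies. *)
Lemma iterE_tail s Psi (c : I -> R) (theta delta : R) x : uniq s ->
  (forall z i j y, z \in s ->
     `|Psi (upd y z (v i)) - Psi (upd y z (v j))| <= c z) ->
  0 <= theta -> (forall z, z \in s -> theta * c z <= 1) ->
  iterE s (fun y => (delta < `|Psi y - iterE s Psi x|)%R%:R) x <=
  2 * expR (2 * theta ^+ 2 * \sum_(z <- s) c z ^+ 2 - theta * delta).
Proof.
move=> us Psic th0 thc; set m := iterE s Psi x.
pose F (e : R) y := expR (e * theta * Psi y).
have FE (e : R) : `|e| = 1 -> iterE s (F e) x <=
    expR (e * theta * m + 2 * theta ^+ 2 * \sum_(z <- s) c z ^+ 2).
  move=> e1; have := @iterE_expR_le s (fun y => e * theta * Psi y)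
    (fun z => theta * c z) x us _ thc.
  rewrite iterE_Zl -/m (_ : \sum_(z <- s) (theta * c z) ^+ 2 =
    theta ^+ 2 * \sum_(z <- s) c z ^+ 2); last first.
    by rewrite mulr_sumr; apply: eq_bigr => z _; rewrite exprMn.
  rewrite mulrA; apply => z i j y zs.
  by rewrite -mulrBr !normrM e1 mul1r ger0_norm// ler_wpM2l// Psic.
have H y : (delta < `|Psi y - m|)%R%:R <=
    expR (- theta * delta - theta * m) * F 1 y +
    expR (- theta * delta + theta * m) * F (-1) y.
  rewrite /F -!expRD; case: ltP => [dm|_]; last by rewrite addr_ge0 ?expR_ge0.
  have [mp|pm] := leP m (Psi y).
    rewrite -[leLHS]addr0 lerD ?expR_ge0//= -[leLHS]/(1 : R) -[leLHS]expR0 ler_expR.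
    move: dm; rewrite ger0_norm ?subr_ge0// => /ltW/(ler_wpM2l th0).
    by rewrite -subr_ge0 => /le_trans; apply; rewrite le_eqVlt; apply/orP; left;
      apply/eqP; ring.
  rewrite -[leLHS]add0r lerD ?expR_ge0//= -[leLHS]/(1 : R) -[leLHS]expR0 ler_expR.
  move: dm; rewrite ltr0_norm ?subr_lt0// => /ltW/(ler_wpM2l th0).
  by rewrite -subr_ge0 => /le_trans; apply; rewrite le_eqVlt; apply/orP; left;
    apply/eqP; ring.
apply: (le_trans (le_iterE s x H)); rewrite iterED !iterE_Zl.
set S := 2 * theta ^+ 2 * _.
rewrite (_ : 2 * _ =
    expR (- theta * delta - theta * m) * expR (1 * theta * m + S) +
    expR (- theta * delta + theta * m) * expR (- 1 * theta * m + S)).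
  by rewrite lerD// ler_wpM2l ?expR_ge0// FE ?normrN ?normr1.
rewrite -!expRD mulr_natl mulr2n; congr (expR _ + expR _); ring.
Qed.

End iterated_expectation.

Section lindeberg.
Context {R : realType} (I : eqType) (J : finType).

Definition normalized_sum (n : R) (u : seq I) (y : I -> R) : R :=
  (Num.sqrt n)^-1 * \sum_(z <- u) y z.

Lemma normalized_sum_upd n (u : seq I) y z a : z \notin u ->
  normalized_sum n u (upd y z a) = normalized_sum n u y.
Proof.
move=> zu; congr (_ * _); apply: eq_big_seq => z' z'u.
by rewrite /upd; case: eqP => // zz'; rewrite -zz' z'u in zu.
Qed.

Variables (pi : I -> J -> R) (v : J -> R) (B : R).
Hypothesis pi_ge0 : forall z j, 0 <= pi z j.
Hypothesis pi_sum1 : forall z, \sum_j pi z j = 1.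
Hypothesis v_le : forall j, `|v j| <= B.

(** Each site of [sigma] that is integrated out disappears from the sum and advances the time by
    [n^-1]. This invariant makes the induction on [s] work. *)
Lemma iterE_lindeberg (s sigma : seq I) (a e t n err : R) (x : I -> R) :
  uniq s -> uniq sigma -> 0 < e <= 1 -> e ^+ 2 <= t -> 1 <= n ->
  (forall z, z \in s ->
    e ^- 4 * (`|\sum_j pi z j * v j| / Num.sqrt n +
      2 * `|\sum_j pi z j * v j ^+ 2 - 1| / n +
      6 * B * (\sum_j pi z j * v j ^+ 2) / (n * Num.sqrt n) + 9 / n ^+ 2) <= err) ->
  `|iterE pi v s (fun y => gauss_cdf ((a - normalized_sum n sigma y) / Num.sqrt t)) x -
    gauss_cdf ((a - normalized_sum n [seq z <- sigma | z \notin s] x) /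
      Num.sqrt (t + (count (mem s) sigma)%:R / n))| <=
  (count (mem s) sigma)%:R * err.
Proof.
move=> us usig e01 et n1 herr; elim: s us herr x => [|z s IH] /= us herr x.
  rewrite (@eq_filter _ (fun z => z \notin [::]) predT) ?filter_predT//.
  rewrite (@eq_count _ _ pred0) ?count_pred0 ?mul0r ?addr0 ?subrr ?normr0//.
move: us => /andP[zs us].
have {}IH := IH us (fun z' zs' => herr z' (mem_behead (s := z :: s) zs')).
set k := count (mem s) sigma in IH *.
have kE : count (mem (z :: s)) sigma = (k + (z \in sigma))%N.
  rewrite -[in RHS](count_uniq_mem z usig) /k -count_predUI.
  rewrite [X in (_ + X)%N](_ : _ = 0%N) ?addn0.
    by apply: eq_count => y /=; rewrite !inE orbC.
  by apply/eqP; rewrite -leqn0 leqNgt -has_count; apply/hasPn => y _ /=;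
    apply/negP => /andP[ys /eqP yz]; rewrite -yz ys in zs.
pose G j := iterE pi v s
  (fun y => gauss_cdf ((a - normalized_sum n sigma y) / Num.sqrt t))
  (upd x z (v j)).
pose H y := gauss_cdf ((a - normalized_sum n [seq z <- sigma | z \notin s] y) /
      Num.sqrt (t + k%:R / n)).
have GH j : `|G j - H (upd x z (v j))| <= k%:R * err by exact: IH.
have n0 : 0 < n by exact: lt_le_trans n1.
(* The head site costs one heat step if [sigma] visits it, and changes nothing otherwise. *)
have step : `|\sum_j pi z j * H (upd x z (v j)) -
    gauss_cdf ((a - normalized_sum n [seq y <- sigma | y \notin z :: s] x) /
      Num.sqrt (t + (k + (z \in sigma))%:R / n))| <= (z \in sigma)%:R * err.
  case: (boolP (z \in sigma)) => zsig; last first.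
    rewrite addn0 mul0r.
    rewrite (eq_bigr (fun j => pi z j * H x)); last first.
      by move=> j _; rewrite /H normalized_sum_upd// mem_filter negb_and zsig orbT.
    rewrite -mulr_suml pi_sum1 mul1r /H.
    rewrite (_ : [seq y <- sigma | y \notin s] = [seq y <- sigma | y \notin z :: s]).
      by rewrite subrr normr0.
    apply: eq_in_filter => y ysig; rewrite inE negb_or.
    by case: eqP => // yz; rewrite yz (negbTE zsig) in ysig.
  rewrite [leRHS](_ : _ = err); last exact: mul1r.
  rewrite (_ : t + (k + true)%:R / n = t + k%:R / n + n^-1); last first.
    by rewrite natrD mulrDl mul1r addrA.
  set y0 := normalized_sum n [seq y <- sigma | y \notin z :: s] x.
  have HE j : H (upd x z (v j)) =
     gauss_cdf ((a - (y0 + v j / Num.sqrt n)) / Num.sqrt (t + k%:R / n)).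
    rewrite /H; suff -> : normalized_sum n [seq z <- sigma | z \notin s]
      (upd x z (v j)) = y0 + v j / Num.sqrt n by [].
    rewrite [v j / _]mulrC -mulrDr; congr (_ * _).
    rewrite (bigD1_seq z) ?filter_uniq ?mem_filter ?zs//= addrC {2}/upd eqxx.
    congr (_ + _); rewrite !big_filter_cond.
    rewrite [LHS](eq_bigl (fun i => (i \notin z :: s) && true)).
      apply: eq_bigr => y.
      by rewrite andbT inE negb_or /upd => /andP[/negbTE ->].
    by move=> y; rewrite andbT inE negb_or andbC.
  under eq_bigr do rewrite HE.
  apply: le_trans (herr z (mem_head _ _)).
  apply: heat_step => //.
  by rewrite (le_trans et)// lerDl divr_ge0// ltW.
rewrite !kE [in leRHS]natrD [leRHS]mulrDl.
rewrite -(subrKA (\sum_j pi z j * H (upd x z (v j)))).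
apply: (le_trans (ler_normD _ _)); rewrite lerD//.
rewrite -sumrB (le_trans (ler_norm_sum _ _ _))//.
apply: (@le_trans _ _ (\sum_j pi z j * (k%:R * err))); last first.
  by rewrite -mulr_suml pi_sum1 mul1r.
by apply: ler_sum => j _; rewrite -mulrBr normrM ger0_norm// ler_wpM2l// GH.
Qed.

End lindeberg.

(** * Discretized weights *)

Section discretized_law.
Context {R : realType} (d : measure_display) (Omega : measurableType d)
  (P : probability Omega R) (I : choiceType) (w : I -> {RV P >-> R}).
Variables (D : set I) (hindep : independent_RVs D w).
Variables (J : finType) (cls : R -> J) (v : J -> R).
Hypothesis cls_meas : forall j, measurable (cls @^-1` [set j]).

Definition cell_prob (z : I) (j : J) : R :=
  fine (P (w z @^-1` (cls @^-1` [set j]))).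

Lemma cell_meas z j : measurable (w z @^-1` (cls @^-1` [set j])).
Proof. by rewrite -[X in measurable X]setTI; exact: measurable_funPT. Qed.

Lemma cell_probE z j : P (w z @^-1` (cls @^-1` [set j])) = (cell_prob z j)%:E.
Proof. by rewrite /cell_prob fineK// fin_num_measure//; exact: cell_meas. Qed.

Lemma cell_prob_ge0 z j : 0 <= cell_prob z j.
Proof. by rewrite fine_ge0. Qed.

Lemma measure_finType_cover (F : J -> set Omega) :
  (forall j, measurable (F j)) -> trivIset setT F ->
  P (\bigcup_j F j) = (\sum_j P (F j))%E.
Proof.
move=> mF tF; rewrite measure_fin_bigcup//; last exact: finite_finset.
rewrite (fsbigE (enum J)) ?enum_uniq//; last by move=> j; rewrite mem_enum.
rewrite (eq_bigl predT) ?big_enum//= => j; exact: in_setT.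
Qed.

Lemma trivIset_cells (E : set Omega) z :
  trivIset setT (fun j => E `&` (w z @^-1` (cls @^-1` [set j]))).
Proof.
apply/trivIsetP => i j _ _ ij; apply/seteqP; split => // t [[_ /= ti] [_ /= tj]].
by move: ij; rewrite -ti -tj eqxx.
Qed.

Lemma sum_cell_prob z : \sum_j cell_prob z j = 1.
Proof.
apply: EFin_inj; rewrite -sumEFin -(probability_setT P).
under eq_bigr do rewrite -cell_probE.
rewrite -(measure_finType_cover (cell_meas z)).
  by congr (P _); apply/seteqP; split => // t _; exists (cls (w z t)).
have := @trivIset_cells setT z; congr (trivIset _ _).
by apply/funext => j; rewrite setTI.
Qed.

(** Sites are overwritten in the order in which [iterE] consumes them, so both unfold together. *)
Fixpoint upds (x : I -> R) (s : seq I) (y : I -> R) : I -> R :=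
  if s is z :: s' then upds (upd x z (y z)) s' y else x.

Lemma upds_out x s y z : z \notin s -> upds x s y z = x z.
Proof.
elim: s x => [//|z' s IH] x; rewrite inE negb_or => /andP[zz' zs] /=.
by rewrite IH// /upd (negbTE zz').
Qed.

Lemma upds_in x s y z : z \in s -> upds x s y z = y z.
Proof.
elim: s x => [//|z' s IH] x; rewrite inE /=.
have [zs _|zs] := boolP (z \in s); first exact: IH.
by rewrite orbF => /eqP <-; rewrite upds_out// /upd eqxx.
Qed.

Definition discretize (t : Omega) (z : I) : R := v (cls (w z t)).

(* The induction moves the sites of s one by one to F, where independence
   applies. *)
Lemma cylinder_prob (s : seq I) (x : I -> R) (Q : (I -> R) -> bool)
    (F : {fset I}) (B : I -> set R) :
  uniq s -> [set` s] `<=` D -> [set` F] `<=` D ->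
  (forall z, z \in s -> z \notin F) ->
  (forall z, z \in F -> measurable (B z)) ->
  let E := \bigcap_(z in [set` F]) (w z @^-1` B z) `&`
    [set t | Q (upds x s (discretize t))] in
  measurable E /\ P E = ((\prod_(z <- F) P (w z @^-1` B z)) *
    (iterE cell_prob v s (fun y => (Q y)%:R) x)%:E)%E.
Proof.
elim: s x F B => [|z s IH] x F B /=.
  move=> _ _ FD _ Bm.
  have mF : measurable (\bigcap_(z in [set` F]) (w z @^-1` B z)).
    apply: fin_bigcap_measurable; first exact: finite_fset.
    by move=> z zF; rewrite -[X in measurable X]setTI; apply: measurable_funPT => //;
      exact: Bm.
  case: (Q x).
    rewrite (_ : [set _ : Omega | true] = setT); last by apply/seteqP; split.
    by rewrite setIT mule1; split=> //; exact: hindep.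
  rewrite (_ : [set _ : Omega | false] = set0); last by apply/seteqP; split.
  by rewrite setI0 measure0 mule0.
move=> /andP[zs us] sD FD sF Bm.
have zF : z \notin F by apply: sF; rewrite inE eqxx.
pose B' j := fun z' => if z' == z then cls @^-1` [set j] else B z'.
pose F' := (z |` F)%fset.
have zF' : forall z', z' \in F -> (z' == z) = false.
  by move=> z' z'F; apply: contraNF zF => /eqP <-.
pose E j := \bigcap_(z in [set` F']) (w z @^-1` B' j z) `&`
    [set t | Q (upds (upd x z (v j)) s (discretize t))].
have {}IH j : measurable (E j) /\ P (E j) =
    ((\prod_(z <- F') P (w z @^-1` B' j z)) *
    (iterE cell_prob v s (fun y => (Q y)%:R) (upd x z (v j)))%:E)%E.
  apply: IH => //.
  - by move=> z' /= z's; apply: sD; rewrite /= inE z's orbT.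
  - move=> z' /=; rewrite in_fset1U => /orP[/eqP ->|z'F]; last exact: FD.
    by apply: sD; rewrite /= inE eqxx.
  - move=> z' z's; rewrite in_fset1U negb_or sF ?inE ?z's ?orbT// andbT.
    by apply: contraNneq zs => <-.
  - move=> z'; rewrite in_fset1U /B'; case: eqP => [_ _|_ /= z'F]; first exact: cls_meas.
    exact: Bm.
have EE : \bigcap_(z in [set` F]) (w z @^-1` B z) `&`
    [set t | Q (upds (upd x z (discretize t z)) s (discretize t))] = \bigcup_j E j.
  apply/seteqP; split => t.
    move=> [tF tQ]; exists (cls (w z t)) => //; split => //= z'.
    rewrite /= in_fset1U /B'; case: eqP => [-> _ //|_ /= z'F].
    exact: tF.
  move=> [j _ [tF' tQ]].
  have tz : cls (w z t) = j.
    by have := tF' z; rewrite /= in_fset1U /B' eqxx; apply.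
  split; last by rewrite /= /discretize tz.
  move=> z' z'F; have := tF' z'; rewrite /= in_fset1U z'F orbT /B' zF'//; exact.
have tE : trivIset setT E.
  apply/trivIsetP => i j _ _ ij; apply/seteqP; split => // t [[ti _] [tj _]].
  have := ti z; have := tj z; rewrite /= in_fset1U /B' eqxx /= => /(_ isT) tzj.
  by move=> /(_ isT) tzi; move: ij; rewrite -tzi -tzj eqxx.
rewrite EE; split.
  by apply: fin_bigcup_measurable; [exact: finite_finset|move=> j _; have [] := IH j].
rewrite measure_finType_cover//; last by move=> j; have [] := IH j.
rewrite -sumEFin ge0_sume_distrr; last first.
  move=> j _; rewrite lee_fin mulr_ge0 ?cell_prob_ge0//.
  by apply: iterE_ge0 => //; exact: cell_prob_ge0.
apply: eq_bigr => j _; have [_ ->] := IH j.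
rewrite big_fsetU1//= EFinM /B' eqxx -cell_probE muleA; congr (_ * _)%E.
rewrite muleC; congr (_ * _)%E; rewrite big_seq [RHS]big_seq.
by apply: eq_bigr => z' z'F; rewrite zF'.
Qed.

Lemma discretized_prob (s : seq I) (x : I -> R) (Q : (I -> R) -> bool) :
  uniq s -> [set` s] `<=` D ->
  measurable [set t | Q (upds x s (discretize t))] /\
  P [set t | Q (upds x s (discretize t))] =
    (iterE cell_prob v s (fun y => (Q y)%:R) x)%:E.
Proof.
move=> us sD.
have := @cylinder_prob s x Q fset0 (fun=> setT) us sD.
rewrite (_ : [set` fset0] = set0) ?bigcap_set0 ?setTI; last first.
  by apply/seteqP; split => // z /=; rewrite inE.
by rewrite big_seq_fset0 mul1e; apply.
Qed.

End discretized_law.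

Section cell_moments.
Context {R : realType} (d : measure_display) (Omega : measurableType d)
  (P : probability Omega R) (I : choiceType) (w : I -> {RV P >-> R}).
Variables (J : finType) (cls : R -> J).
Hypothesis cls_meas : forall j, measurable (cls @^-1` [set j]).

Lemma integral_cells z (g : J -> R) :
  P.-integrable setT (fun t => (g (cls (w z t)))%:E) /\
  (\int[P]_t (g (cls (w z t)))%:E = (\sum_j cell_prob w cls z j * g j)%:E)%E.
Proof.
pose A j := w z @^-1` (cls @^-1` [set j]).
have mA j : measurable (A j) by exact: cell_meas.
have gE t : (g (cls (w z t)))%:E =
    (\sum_(j <- index_enum J) (g j)%:E * (\1_(A j) t)%:E)%E.
  rewrite (bigD1_seq (cls (w z t))) ?mem_index_enum ?index_enum_uniq//=.
  rewrite indicE mem_set// mule1 big1 ?adde0// => j jt.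
  rewrite indicE memNset ?mule0// /A /= => tj; by rewrite tj eqxx in jt.
have iA j : P.-integrable setT (fun t => ((g j)%:E * (\1_(A j) t)%:E)%E).
  by apply: integrableZl => //; exact: integrable_indic.
have E : (fun t => (g (cls (w z t)))%:E) =
    (fun t => \sum_(j <- index_enum J) (g j)%:E * (\1_(A j) t)%:E)%E.
  by apply/funext.
rewrite E; split; first by apply: integrable_sum => // j _; exact: iA.
rewrite integral_sum// -sumEFin; apply: eq_bigr => j _.
rewrite integralZl//; last first.
  exact: integrable_indic.
by rewrite integral_indic// setIT EFinM -(cell_probE w cls_meas) muleC.
Qed.

End cell_moments.

Section moment_comparison.
Context {R : realType} (d : measure_display) (Omega : measurableType d)
  (P : probability Omega R).

(** Carries a known moment of a weight over to its discretization. The constant [c0] will be the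
    rounding error, and [u], the p-th absolute power, pays for the values beyond the cutoff. *)
Lemma integral_close (h1 h2 u : Omega -> R) (c0 c1 K m : R) :
  P.-integrable setT (EFin \o h1) -> P.-integrable setT (EFin \o h2) ->
  P.-integrable setT (EFin \o u) -> (\int[P]_t (u t)%:E <= K%:E)%E ->
  0 <= c1 -> (forall t, `|h1 t - h2 t| <= c0 + c1 * u t) ->
  (\int[P]_t (h2 t)%:E = m%:E)%E ->
  exists2 m' : R, (\int[P]_t (h1 t)%:E = m'%:E)%E & `|m' - m| <= c0 + c1 * K.
Proof.
move=> i1 i2 iu uK c10 h12 h2m.
pose m' := fine (\int[P]_t (h1 t)%:E)%E.
have m'E : (\int[P]_t (h1 t)%:E = m'%:E)%E.
  by rewrite fineK//; exact: integrable_fin_num i1.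
exists m'; first exact: m'E.
have B := @integralB_EFin _ _ _ P setT h1 h2 measurableT i1 i2.
rewrite -lee_fin (_ : (`|m' - m|)%:E = `|(m' - m)%:E|%E)// EFinB -h2m -m'E -B.
apply: (le_trans (le_abse_integral _ _ _)) => //.
  have /integrableP[] := integrableB measurableT i1 i2; exact.
have ir : P.-integrable setT (fun t => (c0%:E + c1%:E * (u t)%:E)%E).
  apply: integrableD => //; last exact: integrableZl.
  exact: finite_measure_integrable_cst.
apply: (@le_trans _ _ (\int[P]_t (c0%:E + c1%:E * (u t)%:E))%E).
  have mh (h : Omega -> R) : P.-integrable setT (EFin \o h) -> measurable_fun setT h.
    by move=> /integrableP[/measurable_EFinP].
  apply: ge0_le_integral => //=.
  - apply/measurable_EFinP; apply: measurableT_comp => //.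
    exact: measurable_funB (mh _ i1) (mh _ i2).
  - have /integrableP[+ _] := ir; exact.
  - by move=> t _; rewrite -EFinM -EFinD lee_fin.
rewrite integralD//=; [|exact: finite_measure_integrable_cst|exact: integrableZl].
rewrite integral_cst//= probability_setT mule1 integralZl//.
by rewrite EFinD leeD2l// EFinM lee_wpmul2l// lee_fin.
Qed.

End moment_comparison.

(** * Truncation and rounding of a single weight *)

Section grid.
Context {R : realType} (B q : R).
Hypotheses (B_gt0 : 0 < B) (q_gt0 : 0 < q).

Definition grid_size : nat := Num.truncn (2 * B * q).

(** All values beyond the cutoff form the single class [None], to which [grid_value] assigns 0. The
    other classes are cells of length [q^-1], represented by their left ends. *)
Definition grid_class (t : R) : option 'I_grid_size.+1 :=
  if `|t| <= B then Some (inord (Num.truncn ((t + B) * q))) else None.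

Definition grid_value (j : option 'I_grid_size.+1) : R :=
  if j is Some k then k%:R / q - B else 0.

Let grid_index (t : R) : `|t| <= B ->
  0 <= (t + B) * q /\ (Num.truncn ((t + B) * q) < grid_size.+1)%N.
Proof.
rewrite ler_norml => /andP[Bt tB]; split.
  by rewrite mulr_ge0 ?(ltW q_gt0)//; lra.
rewrite ltnS; apply: le_truncn; rewrite ler_wpM2r ?(ltW q_gt0)//; lra.
Qed.

Lemma grid_value_le j : `|grid_value j| <= B.
Proof.
case: j => [[k kq]|] /=; last by rewrite normr0 ltW.
have kB : k%:R / q <= 2 * B.
  rewrite ler_pdivrMr//; apply: (@le_trans _ _ grid_size%:R).
    by rewrite ler_nat -ltnS.
  by rewrite truncn_le !mulr_ge0// ltW.
have : 0 <= k%:R / q by rewrite divr_ge0// ltW.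
rewrite ler_norml; lra.
Qed.

Lemma grid_value_near t : `|t| <= B -> `|grid_value (grid_class t) - t| <= q^-1.
Proof.
move=> tB; rewrite /grid_class tB /=; have [i0 i1] := grid_index tB.
rewrite inordK//; have /andP[h1 h2] := truncn_itv i0.
set k := Num.truncn _ in h1 h2 *.
have q0 : q != 0 by rewrite gt_eqF.
rewrite (_ : _ - t = (k%:R - (t + B) * q) / q); last by field.
have qV : 0 <= q^-1 by rewrite invr_ge0 ltW.
rewrite normrM (ger0_norm qV) -[leRHS]mul1r.
rewrite ler_wpM2r// ler_norml.
rewrite -natr1 in h2; lra.
Qed.

Lemma grid_class_meas j : measurable (grid_class @^-1` [set j]).
Proof.
have mB : measurable [set t : R | `|t| <= B].
  rewrite (_ : [set t | _] = `[(- B), B]%classic); first exact: measurable_itv.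
  by apply/seteqP; split => t /=; rewrite in_itv /= ler_norml.
case: j => [k|].
  rewrite (_ : grid_class @^-1` _ = [set t : R | `|t| <= B] `&`
    `[k%:R / q - B, k.+1%:R / q - B[%classic).
    by apply: measurableI => //; exact: measurable_itv.
  apply/seteqP; split => t /=; rewrite in_itv /= /grid_class.
    case: ifP => // tB [kE]; have [i0 i1] := grid_index tB.
    split=> //; rewrite -kE inordK// lerBlDr ltrBrDr ler_pdivrMr// ltr_pdivlMr//.
    exact: truncn_itv.
  move=> [tB]; have [i0 i1] := grid_index tB; rewrite tB => /andP[h1 h2].
  congr Some; apply: val_inj; rewrite /= inordK//.
  apply: truncn_def; rewrite -ler_pdivrMr// -ltr_pdivlMr// -lerBlDr -ltrBrDr.
  by rewrite h1.
rewrite (_ : grid_class @^-1` _ = ~` [set t : R | `|t| <= B]).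
  exact: measurableC.
by apply/seteqP; split => t /=; rewrite /grid_class; case: ifP.
Qed.

Lemma powR_truncation (p t : R) (r : nat) : r%:R <= p -> B < `|t| ->
  `|t| ^+ r <= `|t| `^ p / B `^ (p - r%:R).
Proof.
move=> rp Bt; have t0 : 0 < `|t| by exact: lt_trans Bt.
have -> : `|t| `^ p = `|t| ^+ r * `|t| `^ (p - r%:R).
  rewrite -powR_mulrn ?(ltW t0)// -powRD; first by rewrite addrC subrK.
  by apply/implyP => _; rewrite gt_eqF.
rewrite -mulrA ler_peMr ?exprn_ge0// ler_pdivlMr ?powR_gt0// mul1r.
by rewrite ge0_ler_powR ?subr_ge0 ?nnegrE ?(ltW B_gt0) ?(ltW t0)// ltW.
Qed.

Lemma grid_moment1 (p t : R) : 1 <= p ->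
  `|grid_value (grid_class t) - t| <=
    q^-1 + (B `^ (p - 1))^-1 * `|t| `^ p.
Proof.
move=> p1; have [tB|Bt] := leP `|t| B.
  rewrite (le_trans (grid_value_near tB))// lerDl mulr_ge0 ?powR_ge0//.
  by rewrite invr_ge0 powR_ge0.
rewrite /grid_class (lt_geF Bt) /= sub0r normrN.
have := powR_truncation (r := 1%N) p1 Bt; rewrite expr1 => h.
by rewrite (le_trans h)// mulrC lerDr invr_ge0 ltW.
Qed.

Lemma grid_moment2 (p t : R) : 2 <= p ->
  `|grid_value (grid_class t) ^+ 2 - t ^+ 2| <=
    2 * B / q + (B `^ (p - 2))^-1 * `|t| `^ p.
Proof.
move=> p2; have [tB|Bt] := leP `|t| B.
  apply: (@le_trans _ _ (2 * B / q)); last first.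
    by rewrite lerDl mulr_ge0 ?powR_ge0// invr_ge0 powR_ge0.
  rewrite subr_sqr normrM mulrC ler_pM//; last exact: grid_value_near.
  rewrite (le_trans (ler_normD _ _))//; have := grid_value_le (grid_class t); lra.
rewrite /grid_class (lt_geF Bt) /= expr0n sub0r normrN normrX.
have h := powR_truncation (r := 2%N) p2 Bt.
by rewrite (le_trans h)// mulrC lerDr divr_ge0 ?mulr_ge0// ltW.
Qed.

End grid.

Section site.
Context {R : realType} (d : measure_display) (Omega : measurableType d)
  (P : probability Omega R) (I : choiceType) (w : I -> {RV P >-> R}).
Variables (z : I) (p K B q : R).
Hypotheses (p_gt2 : 2 <= p).
Hypotheses (hmean : ('E_P[w z] = 0)%E)
  (hvar : ('E_P[fun t => (w z t ^+ 2)%R] = 1)%E)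
  (hmom : ('E_P[fun t => (`|w z t| `^ p)%R] <= K%:E)%E).
Hypotheses (B_gt0 : 0 < B) (q_gt0 : 0 < q).

Let u t := `|w z t| `^ p.

Let mu_u : measurable_fun setT u.
Proof.
apply: (measurableT_comp (measurable_powR p)).
exact: measurableT_comp.
Qed.

Let u_int : P.-integrable setT (EFin \o u).
Proof.
apply/integrableP; split; first exact/measurable_EFinP.
rewrite (eq_integral (fun t => (u t)%:E)); last first.
  by move=> t _ /=; rewrite ger0_norm ?powR_ge0.
move: hmom; rewrite unlock => h; apply: le_lt_trans h _; exact: ltry.
Qed.

Let uK : (\int[P]_t (u t)%:E <= K%:E)%E.
Proof. by move: hmom; rewrite unlock. Qed.

Let pow_le (r : nat) t : (r <= 2)%N -> `|w z t| ^+ r <= 1 + u t.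
Proof.
move=> r2; have [w1|w1] := leP `|w z t| 1.
  by rewrite (le_trans (exprn_ile1 _ (normr_ge0 _) w1))// lerDl powR_ge0.
rewrite -powR_mulrn// (le_trans (ler_powR _ _ (y := p)))// ?(ltW w1)//.
  by rewrite (le_trans _ p_gt2)// ler_nat.
by rewrite lerDr.
Qed.

Let w_int (r : nat) : (r <= 2)%N -> P.-integrable setT (EFin \o (fun t => w z t ^+ r)).
Proof.
move=> r2; apply: (@le_integrable _ _ _ _ _ _ _ (fun t => (1%:E + (u t)%:E)%E)) => //.
- apply/measurable_EFinP; exact: measurable_funX.
- move=> t _ /=; rewrite lee_fin normrX (le_trans (pow_le t r2))//.
  by rewrite ger0_norm// addr_ge0// powR_ge0.
- apply: integrableD => //; exact: finite_measure_integrable_cst.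
Qed.

Let pi := cell_prob w (@grid_class R B q) z.
Let val := @grid_value R B q.

Lemma site_mean : `|\sum_j pi j * val j| <= q^-1 + K / B `^ (p - 1).
Proof.
have [i1 E1] := integral_cells w (@grid_class_meas R B q q_gt0) z val.
have := @integral_close R _ _ P _ (fun t => w z t) u q^-1 (B `^ (p - 1))^-1 K 0
  i1 _ u_int uK.
case.
- have := w_int (isT : (1 <= 2)%N); exact.
- by rewrite invr_ge0 powR_ge0.
- by move=> t; apply: grid_moment1 => //; apply: le_trans p_gt2; rewrite ler1n.
- by move: hmean; rewrite unlock.
- move=> m'; rewrite E1 => -[<-]; rewrite subr0 => h.
  by rewrite (le_trans h)// lerD2l mulrC.
Qed.

Lemma site_var : `|\sum_j pi j * val j ^+ 2 - 1| <=
  2 * B / q + K / B `^ (p - 2).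
Proof.
have [i1 E1] := integral_cells w (@grid_class_meas R B q q_gt0) z
  (fun j => val j ^+ 2).
have := @integral_close R _ _ P _ (fun t => w z t ^+ 2) u (2 * B / q)
  (B `^ (p - 2))^-1 K 1 i1 (w_int (isT : (2 <= 2)%N)) u_int uK.
case.
- by rewrite invr_ge0 powR_ge0.
- by move=> t; apply: grid_moment2.
- by move: hvar; rewrite unlock.
- move=> m'; rewrite E1 => -[<-] h.
  by rewrite (le_trans h)// lerD2l mulrC.
Qed.

Lemma site_tail_meas : measurable [set t | B < `|w z t|].
Proof.
have mw : measurable_fun setT (fun t => `|w z t|) by exact: measurableT_comp.
rewrite (_ : [set t | _] = (fun t => `|w z t|) @^-1` `]B, +oo[%classic).
  by rewrite -[X in measurable X]setTI; apply: mw => //; exact: measurable_itv.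
by apply/seteqP; split => t /=; rewrite in_itv /= andbT.
Qed.

Lemma site_tail : (P [set t | (B < `|w z t|)%R] <= (K / B `^ p)%:E)%E.
Proof.
have mA := site_tail_meas.
have Bp : 0 < B `^ p by rewrite powR_gt0.
rewrite mulrC -[X in (_ X <= _)%E]setIT -integral_indic//.
apply: (@le_trans _ _ (\int[P]_t ((B `^ p)^-1%:E * (u t)%:E))%E); last first.
  by rewrite integralZl// EFinM lee_wpmul2l// lee_fin invr_ge0 ltW.
apply: ge0_le_integral => //=.
- by apply/measurable_EFinP; exact: measurable_indic.
- by apply/measurable_EFinP; exact: measurable_funM.
- move=> t _; rewrite -EFinM lee_fin indicE.
  case: (boolP (t \in _)) => [|_]; last first.
    by rewrite mulr_ge0 ?powR_ge0// invr_ge0 ltW.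
  rewrite inE /= => Bt; rewrite ler_pdivlMl// mulr1.
  apply: ge0_ler_powR; rewrite ?nnegrE ?(ltW B_gt0) ?(ltW Bt)//.
  exact: le_trans p_gt2.
Qed.

End site.

(** * Quenched deviations *)

Section box_paths.
Variables M N : nat.

Definition box : seq (nat * nat) := [seq (i, j) | i <- iota 1 M, j <- iota 1 N].

Lemma uniq_box : uniq box.
Proof. by rewrite allpairs_uniq ?iota_uniq// => -[? ?] [? ?] _ _ [-> ->]. Qed.

Lemma mem_box z : (z \in box) = [&& 0 < z.1, z.1 <= M, 0 < z.2 & z.2 <= N]%N.
Proof.
case: z => i j; apply/allpairsP/idP => [[[i' j'] /= [+ + [-> ->]]]|].
  by rewrite !mem_iota !add1n !ltnS => /andP[-> ->] /andP[-> ->].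
move=> /and4P[/= i0 iM j0 jN]; exists (i, j) => /=.
by rewrite !mem_iota !add1n !ltnS i0 iM j0 jN.
Qed.

Lemma size_box : size box = (M * N)%N.
Proof. by rewrite size_allpairs !size_iota. Qed.

Lemma points_box (s : box_path M N) z : z \in points s -> z \in box.
Proof. by move=> /mapP[[i j] _ ->]; rewrite mem_box /= !ltn_ord. Qed.

Lemma size_points (s : box_path M N) : size (points s) = (M + N - 1)%N.
Proof. by rewrite size_map size_tuple. Qed.

Lemma uniq_points l (a : 'I_l -> nat * nat) (s : box_path M N) :
  (0 < M)%N -> (0 < N)%N -> s \in paths_through M N a -> uniq (points s).
Proof.
case: M N s a => [//|M'] [//|N'] s a _ _; rewrite inE => /andP[+ _].
by move=> /up_right_pathE[D _ ->]; exact: uniq_path_pts.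
Qed.

End box_paths.

Section smoothed_average.
Context {R : realType}.
Variables (M N l : nat) (a : 'I_l -> nat * nat) (x0 e : R).
Hypotheses (M0 : (0 < M)%N) (N0 : (0 < N)%N) (e_gt0 : 0 < e) (e_le1 : e <= 1).
Let A := paths_through M N a.
Hypothesis A0 : (0 < #|A|)%N.
Let n : R := (M + N - 1)%:R.

(** The average over the path of the smoothed indicator of path sums up to [x0]; [e] is the standard
    deviation of the smoothing. *)
Definition smooth_avg (y : nat * nat -> R) : R :=
  #|paths_through M N a|%:R^-1 * \sum_(s in paths_through M N a)
    gauss_cdf ((x0 - @path_sum R M N y s) / e).

Let cA : 0 < #|A|%:R :> R. Proof. by rewrite ltr0n. Qed.

Let n1 : 1 <= n.
Proof. by rewrite ler1n subn_gt0 -(addn1 1) leq_add. Qed.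

Let n_gt0 : 0 < n. Proof. exact: lt_le_trans n1. Qed.

Let sn0 : 0 < Num.sqrt n. Proof. by rewrite sqrtr_gt0. Qed.

Let cdf_lip u v : `|gauss_cdf ((x0 - u) / e) - gauss_cdf ((x0 - v) / e)| <=
  `|u - v| / e.
Proof.
apply: (le_trans (gauss_cdf_lip _ _)); rewrite -mulrBl normrM.
rewrite (ger0_norm (x := e^-1)) ?invr_ge0 ?(ltW e_gt0)//.
by rewrite (_ : x0 - u - (x0 - v) = - (u - v)) ?normrN//; ring.
Qed.

Let path_sum_upd s y z v1 v2 : s \in A ->
  `|@path_sum R M N (upd y z v1) s - path_sum (upd y z v2) s| <=
  (z \in points s)%:R * (`|v1 - v2| / Num.sqrt n).
Proof.
move=> sA; rewrite /path_sum -mulrBr -sumrB.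
have [zs|zs] := boolP (z \in points s); last first.
  rewrite big_seq big1 ?mulr0 ?normr0 ?mul0r// => z' z's.
  rewrite /upd; case: eqP => [zz'|_]; last by rewrite subrr.
  by move: zs; rewrite -zz' z's.
rewrite (bigD1_seq z) ?(uniq_points M0 N0 sA)//= big1 ?addr0; last first.
  by move=> z' /negbTE z'z; rewrite /upd z'z subrr.
have sV : 0 <= (Num.sqrt n)^-1 by rewrite invr_ge0 ltW.
by rewrite /upd eqxx mul1r normrM (ger0_norm sV) mulrC.
Qed.

(** Only the paths through [z] feel the change, and each of them at most by the Lipschitz constant
    [e^-1] times the change of its normalized sum. *)
Lemma smooth_avg_upd y z v1 v2 :
  `|smooth_avg (upd y z v1) - smooth_avg (upd y z v2)| <=
  visit M N a z * (`|v1 - v2| / (e * Num.sqrt n)).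
Proof.
rewrite /smooth_avg -mulrBr -sumrB normrM ger0_norm ?invr_ge0//.
rewrite /visit mulrAC mulrC ler_wpM2r ?invr_ge0//.
have -> : #|[pred s in paths_through M N a | z \in points s]|%:R =
    \sum_(s in A) (z \in points s)%:R :> R.
  rewrite -sum1_card natr_sum big_mkcondr /=.
  by apply: eq_bigr => s _; case: (z \in points s).
rewrite mulr_suml (le_trans (ler_norm_sum _ _ _))//; apply: ler_sum => s sA.
apply: (le_trans (cdf_lip _ _)).
rewrite ler_pdivrMr//; apply: (le_trans (path_sum_upd _ _ _ _ sA)).
rewrite -mulrA ler_wpM2l// le_eqVlt; apply/orP; left; apply/eqP; field.
by rewrite !gt_eqF.
Qed.

Lemma visit_ge0 z : 0 <= visit M N a z :> R.
Proof. by rewrite divr_ge0. Qed.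

Lemma visit_le1 z : visit M N a z <= 1 :> R.
Proof.
rewrite ler_pdivrMr// mul1r ler_nat subset_leq_card//.
by apply/fintype.subsetP => s; rewrite inE => /andP[].
Qed.

Lemma smooth_avg_close y y' (eta : R) :
  (forall z, z \in box M N -> `|y z - y' z| <= eta) ->
  `|smooth_avg y - smooth_avg y'| <= Num.sqrt n * eta / e.
Proof.
move=> yy'; rewrite /smooth_avg -mulrBr -sumrB normrM ger0_norm ?invr_ge0//.
rewrite mulrC ler_pdivrMr// mulr_natr -sumr_const.
rewrite (le_trans (ler_norm_sum _ _ _))//; apply: ler_sum => s sA.
apply: (le_trans (cdf_lip _ _)); rewrite ler_wpM2r ?invr_ge0 ?(ltW e_gt0)//.
rewrite /path_sum -mulrBr -sumrB normrM ger0_norm; last first.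
  by rewrite invr_ge0 sqrtr_ge0.
rewrite ler_pdivrMl// mulrA -expr2 sqr_sqrtr ?(ltW n_gt0)//.
rewrite (le_trans (ler_norm_sum _ _ _))//.
apply: (@le_trans _ _ (\sum_(z <- points s) eta)).
  rewrite big_seq [leRHS]big_seq; apply: ler_sum => z zs.
  by apply: yy'; exact: points_box zs.
by rewrite big_const_seq count_predT size_points iter_addr_0 mulr_natl.
Qed.

(** All points of a path lie in the box, so after integrating over the box no weight is left and the
    time has moved from [e ^+ 2] to [e ^+ 2 + 1], whatever the path. *)
Lemma smooth_avg_mean (J : finType) (pi : nat * nat -> J -> R) (v : J -> R)
    (B err : R) (y : nat * nat -> R) :
  (forall z j, 0 <= pi z j) -> (forall z, \sum_j pi z j = 1) ->
  (forall j, `|v j| <= B) ->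
  (forall z, z \in box M N ->
    e ^- 4 * (`|\sum_j pi z j * v j| / Num.sqrt n +
      2 * `|\sum_j pi z j * v j ^+ 2 - 1| / n +
      6 * B * (\sum_j pi z j * v j ^+ 2) / (n * Num.sqrt n) + 9 / n ^+ 2) <= err) ->
  `|iterE pi v (box M N) smooth_avg y - gauss_cdf (x0 / Num.sqrt (e ^+ 2 + 1))| <=
  n * err.
Proof.
move=> pi0 pi1 vB herr.
rewrite /smooth_avg iterE_Zl iterE_sum.
have -> : gauss_cdf (x0 / Num.sqrt (e ^+ 2 + 1)) =
    #|A|%:R^-1 * \sum_(s in A) gauss_cdf (x0 / Num.sqrt (e ^+ 2 + 1)).
  rewrite sumr_const mulrnAr -mulrnAl -(mulr_natl (#|A|%:R^-1)) mulfV ?mul1r//.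
  by rewrite gt_eqF.
rewrite -mulrBr -sumrB normrM ger0_norm ?invr_ge0//.
rewrite ler_pdivrMl// mulr_natl -sumr_const.
rewrite (le_trans (ler_norm_sum _ _ _))//; apply: ler_sum => s sA.
have e01 : 0 < e <= 1 by rewrite e_gt0.
have cnt : count (mem (box M N)) (points s) = (M + N - 1)%N.
  rewrite -[RHS](size_points s); apply/eqP; rewrite -all_count; apply/allP => z.
  exact: points_box.
have := @iterE_lindeberg R _ J pi v B pi0 pi1 vB (box M N) (points s) x0 e
  (e ^+ 2) n err y (uniq_box M N) (uniq_points M0 N0 sA) e01 (lexx _) n1 herr.
rewrite cnt sqrtr_sqr (ger0_norm (ltW e_gt0)) -/n divff ?gt_eqF//.
rewrite (@eq_in_filter _ _ pred0) ?filter_pred0; last first.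
  by move=> z zs; rewrite /= (points_box zs).
by rewrite /normalized_sum big_nil mulr0 subr0.
Qed.

End smoothed_average.

Lemma measure_bigsetU_seq_le (R : realType) (d : measure_display)
    (T : measurableType d) (P : probability T R) (I : eqType) (s : seq I)
    (F : I -> set T) (c : R) :
  (forall i, measurable (F i)) -> {in s, forall i, (P (F i) <= c%:E)%E} ->
  (P (\big[setU/set0]_(i <- s) F i) <= ((size s)%:R * c)%:E)%E.
Proof.
move=> mF; elim: s => [_|i s IH PF]; first by rewrite big_nil measure0 mul0r.
rewrite big_cons; apply: (le_trans (measureU2 _ _ _)) => //.
  exact: bigsetU_measurable.
rewrite /= -natr1 mulrDl mul1r addrC EFinD leeD ?PF ?mem_head// IH// => j js.
by rewrite PF// inE js orbT.
Qed.

Section deviation.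
Context {R : realType} (d : measure_display) (Omega : measurableType d)
  (P : probability Omega R) (w : nat * nat -> {RV P >-> R}) (p K : R).
Hypothesis p_ge2 : 2 <= p.
Hypothesis hindep : independent_RVs quadrant w.
Hypothesis hmean : forall z, quadrant z -> ('E_P[w z] = 0)%E.
Hypothesis hvar : forall z, quadrant z -> ('E_P[fun t => (w z t ^+ 2)%R] = 1)%E.
Hypothesis hmom : forall z, quadrant z ->
  ('E_P[fun t => (`|w z t| `^ p)%R] <= K%:E)%E.

Variables (M N l : nat) (a : 'I_l -> nat * nat) (x0 e : R).
Hypotheses (M0 : (0 < M)%N) (N0 : (0 < N)%N) (e_gt0 : 0 < e) (e_le1 : e <= 1).
Hypothesis A0 : (0 < #|paths_through M N a|)%N.
Let n : R := (M + N - 1)%:R.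
Variables (V B q theta delta err : R).
Hypotheses (B_gt0 : 0 < B) (q_gt0 : 0 < q) (theta_ge0 : 0 <= theta).
Hypothesis hV : \sum_(z <- box M N) visit M N a z ^+ 2 <= V.
Let c := 2 * B / (e * Num.sqrt n).
Hypothesis theta_c : theta * c <= 1.
Hypothesis herr :
  e ^- 4 * ((q^-1 + K / B `^ (p - 1)) / Num.sqrt n +
      2 * (2 * B / q + K / B `^ (p - 2)) / n +
      6 * B * (1 + (2 * B / q + K / B `^ (p - 2))) / (n * Num.sqrt n) +
      9 / n ^+ 2) <= err.

Let n1 : 1 <= n.
Proof. by rewrite ler1n subn_gt0 -(addn1 1) leq_add. Qed.

Let n_gt0 : 0 < n. Proof. exact: lt_le_trans n1. Qed.

Let sn0 : 0 < Num.sqrt n. Proof. by rewrite sqrtr_gt0. Qed.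

(** On the complement of [Bad] no weight of the box exceeds [B] and the discretized average is
    within [delta] of its mean. The three errors are this fluctuation, the rounding of the weights,
    and the Lindeberg error of the mean. *)
Lemma quenched_deviation : exists Bad : set Omega, [/\ measurable Bad,
  (P Bad <= ((M * N)%:R * (K / B `^ p) +
     2 * expR (2 * theta ^+ 2 * (c ^+ 2 * V) - theta * delta))%:E)%E &
  forall omega, ~ Bad omega ->
    `|smooth_avg M N a x0 e (fun z => w z omega) -
      gauss_cdf (x0 / Num.sqrt (e ^+ 2 + 1))| <=
    delta + Num.sqrt n / q / e + n * err].
Proof.
pose cls := @grid_class R B q; pose v := @grid_value R B q.
pose pi := cell_prob w cls; pose s := box M N.
pose F := smooth_avg M N a x0 e : (nat * nat -> R) -> R.
pose y0 : nat * nat -> R := fun=> 0.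
have clsm j : measurable (cls @^-1` [set j]) by exact: grid_class_meas.
have sq z : z \in s -> quadrant z.
  by rewrite mem_box => /and4P[z1 _ z2 _]; split.
have pi0 z j : 0 <= pi z j by exact: cell_prob_ge0.
have pi1 z : \sum_j pi z j = 1 by exact: sum_cell_prob.
have vB j : `|v j| <= B by exact: grid_value_le.
pose m := iterE pi v s F y0.
have meanF : `|m - gauss_cdf (x0 / Num.sqrt (e ^+ 2 + 1))| <= n * err.
  apply: (smooth_avg_mean x0 M0 N0 e_gt0 e_le1 A0 y0 pi0 pi1 vB) => z zs.
  have qz := sq z zs.
  have h1 := site_mean p_ge2 (hmean qz) (hmom qz) B_gt0 q_gt0.
  have h2 := site_var p_ge2 (hvar qz) (hmom qz) B_gt0 q_gt0.
  apply: le_trans herr; rewrite ler_wpM2l ?invr_ge0 ?exprn_ge0 ?(ltW e_gt0)//.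
  have nV : 0 <= n^-1 by rewrite invr_ge0 ltW.
  have snV : 0 <= (Num.sqrt n)^-1 by rewrite invr_ge0 ltW.
  have h3 : \sum_j pi z j * v j ^+ 2 <= 1 + (2 * B / q + K / B `^ (p - 2)).
    by rewrite -lerBlDl (le_trans (ler_norm _)).
  rewrite lerD2r !lerD//.
  - by rewrite ler_wpM2r.
  - by rewrite ler_wpM2r// ler_wpM2l.
  - by rewrite ler_wpM2r ?invr_ge0 ?mulr_ge0 ?(ltW n_gt0) ?(ltW sn0)//
      ler_wpM2l// mulr_ge0// ltW.
have c0 : 0 <= c by rewrite divr_ge0 ?mulr_ge0 ?(ltW B_gt0) ?(ltW e_gt0) ?(ltW sn0).
pose c' z := visit M N a z * c.
have tail : iterE pi v s (fun y => (delta < `|F y - m|)%R%:R) y0 <=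
    2 * expR (2 * theta ^+ 2 * (c ^+ 2 * V) - theta * delta).
  have Fc z i j y : z \in s -> `|F (upd y z (v i)) - F (upd y z (v j))| <= c' z.
    move=> _; apply: le_trans; first exact: smooth_avg_upd.
    rewrite ler_wpM2l ?visit_ge0// ler_wpM2r//.
      by rewrite invr_ge0 mulr_ge0 ?(ltW e_gt0) ?(ltW sn0).
    rewrite (le_trans (ler_normB _ _))// mulr_natl mulr2n lerD//.
  have thc z : z \in s -> theta * c' z <= 1.
    have v1 : visit M N a z <= 1 :> R by exact: visit_le1.
    move=> _; rewrite mulrCA (le_trans _ theta_c)//.
    exact: ler_piMl (mulr_ge0 theta_ge0 c0) v1.
  apply: (le_trans (iterE_tail pi0 pi1 delta y0 (uniq_box M N) Fc theta_ge0 thc)).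
  rewrite ler_wpM2l// ler_expR lerD2r ler_wpM2l ?mulr_ge0 ?sqr_ge0//.
  under eq_bigr do rewrite /c' exprMn.
  by rewrite -mulr_suml mulrC ler_wpM2l ?sqr_ge0.
have [mE PE] := @discretized_prob R d Omega P _ w quadrant hindep _ cls v clsm s y0
  (fun y => (delta < `|F y - m|)%R) (uniq_box M N) sq.
have PE' : (P [set t | (delta < `|F (upds y0 s (discretize w cls v t)) - m|)%R] <=
    (2 * expR (2 * theta ^+ 2 * (c ^+ 2 * V) - theta * delta))%:E)%E.
  by rewrite PE lee_fin.
pose G z := [set t | (B < `|w z t|)%R].
have mG z : measurable (G z) by exact: site_tail_meas.
exists (\big[setU/set0]_(z <- s) G z `|`
  [set t | delta < `|F (upds y0 s (discretize w cls v t)) - m|]).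
split.
- apply: measurableU => //; exact: bigsetU_measurable.
- apply: (le_trans (measureU2 _ _ _)) => //; first exact: bigsetU_measurable.
  rewrite EFinD leeD//.
  rewrite -size_box measure_bigsetU_seq_le// => z zs.
  by apply: site_tail p_ge2 _ B_gt0; exact/hmom/sq.
- move=> omega /not_orP[nG nE].
  have wB z : z \in s -> `|w z omega| <= B.
    move=> zs; rewrite leNgt; apply/negP => Bw; apply: nG.
    by rewrite -bigcup_seq; exists z.
  have Fw : `|F (fun z => w z omega) - F (upds y0 s (discretize w cls v omega))| <=
      Num.sqrt n / q / e.
    apply: (smooth_avg_close x0 M0 N0 e_gt0 A0) => z zs.
    rewrite upds_in// distrC; apply: grid_value_near => //; exact: wB.
  have Fm : `|F (upds y0 s (discretize w cls v omega)) - m| <= delta.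
    by rewrite leNgt; apply/negP.
  rewrite -(subrKA (F (upds y0 s (discretize w cls v omega)))).
  apply: (le_trans (ler_normD _ _)).
  rewrite -addrA addrCA lerD// -(subrKA m) (le_trans (ler_normD _ _))//.
  exact: lerD.
Qed.

End deviation.

(** * Almost sure convergence *)

Section power_series_bounds.
Context {R : realType}.

(** Since [N] is [u * (1 - u^-1)], it is at most [u * expR (- u^-1)]; raising to the power [eta] and
    using [1 + eta / u <= expR (eta / u)] gives the claim after clearing denominators. *)
Lemma powR_telescope (eta : R) (N : nat) : 0 < eta -> (0 < N)%N ->
  eta * (N.+1%:R `^ (1 + eta))^-1 <= (N%:R `^ eta)^-1 - (N.+1%:R `^ eta)^-1.
Proof.
move=> eta0 N0; set u : R := N.+1%:R.
have u0 : 0 < u by rewrite ltr0n.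
have NR : 0 < N%:R :> R by rewrite ltr0n.
have Nu : N%:R <= u * expR (- u^-1).
  have -> : N%:R = u * (1 - u^-1) by rewrite mulrBr mulr1 divff ?gt_eqF// /u -natr1 addrK.
  by rewrite ler_wpM2l ?(ltW u0)// expR_ge1Dx.
have ue0 : 0 < u `^ eta by rewrite powR_gt0.
have H : N%:R `^ eta * (1 + eta / u) <= u `^ eta.
  have h1 : N%:R `^ eta <= (u * expR (- u^-1)) `^ eta.
    by apply: ge0_ler_powR => //; rewrite ?nnegrE ?mulr_ge0 ?expR_ge0 ?ltW.
  rewrite powRM ?expR_ge0 ?(ltW u0)// -expRM in h1.
  have h2 : 1 + eta / u <= expR (eta / u) := expR_ge1Dx _.
  have h3 : 0 <= 1 + eta / u by rewrite addr_ge0// divr_ge0 ?ltW.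
  apply: (le_trans (ler_pM (powR_ge0 _ _) h3 h1 h2)).
  by rewrite -mulrA -expRD (_ : - u^-1 * eta + eta / u = 0) ?expR0 ?mulr1//; ring.
have Ne0 : 0 < N%:R `^ eta by rewrite powR_gt0.
rewrite powRD; last by rewrite (gt_eqF u0) implybT.
rewrite powRr1 ?(ltW u0)// lerBrDr.
rewrite -(ler_pM2l Ne0) mulfV ?gt_eqF//.
rewrite -(ler_pM2r ue0) mul1r; apply: le_trans H.
by rewrite le_eqVlt; apply/orP; left; apply/eqP; field; rewrite !gt_eqF.
Qed.

Lemma sum_powR_le (eta : R) (k : nat) : 0 < eta ->
  \sum_(2 <= N < k) (N%:R `^ (1 + eta))^-1 <= eta^-1.
Proof.
move=> eta0.
have H k' : \sum_(2 <= N < k'.+2) (N%:R `^ (1 + eta))^-1 <=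
    eta^-1 * (1 - (k'.+1%:R `^ eta)^-1).
  elim: k' => [|k' IH].
    by rewrite big_geq// powR1 invr1 subrr mulr0.
  rewrite big_nat_recr//= (le_trans (lerD IH (lexx _)))//.
  have := powR_telescope eta0 (ltn0Sn k'); rewrite -ler_pdivlMl// => h.
  by rewrite (le_trans (lerD (lexx _) h))// -mulrDr addrA subrK.
case: k => [|[|k]].
- by rewrite big_geq// invr_ge0 ltW.
- by rewrite big_geq// invr_ge0 ltW.
by rewrite (le_trans (H k))// ler_piMr ?invr_ge0 ?(ltW eta0)//.
Qed.

Lemma expRN_le_pow (y : R) (k : nat) : 0 < y -> expR (- y) <= (k.+1)`!%:R / y ^+ k.+1.
Proof.
move=> y0; have := expR_ge1Dxn k (ltW y0) => h.
rewrite expRN -[leLHS]mul1r ler_pdivrMr ?expR_gt0// mulrAC.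
have f0 : 0 < k.+1`!%:R :> R by rewrite ltr0n fact_gt0.
rewrite ler_pdivlMr ?exprn_gt0// mul1r -ler_pdivrMl//.
by rewrite mulrC (le_trans _ h)// lerDr.
Qed.

End power_series_bounds.

Lemma borel_cantelli_powR (R : realType) (d : measure_display)
    (T : measurableType d) (P : probability T R) (F : nat -> set T) (C eta : R)
    (N1 : nat) : 0 < eta -> 0 <= C ->
  (forall N, (N1 <= N)%N -> measurable (F N)) ->
  (forall N, (N1 <= N)%N -> (P (F N) <= (C * (N%:R `^ (1 + eta))^-1)%:E)%E) ->
  {ae P, forall t, exists N2, forall N, (N2 <= N)%N -> ~ F N t}.
Proof.
move=> eta0 C0 mF PF.
(* Replacing the first events by the empty set leaves the conclusion unchanged; the threshold 2 is
   where the sum in [sum_powR_le] starts. *)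
pose N1' := maxn N1 2; pose G N := if (N1' <= N)%N then F N else set0.
have mG N : measurable (G N).
  by rewrite /G; case: ifPn => // h; apply: mF; rewrite (leq_trans _ h)// leq_maxl.
have PG N : (P (G N) <= ((2 <= N)%N%:R * (C * (N%:R `^ (1 + eta))^-1))%:E)%E.
  rewrite /G; case: ifPn => h; last first.
    by rewrite measure0 lee_fin !mulr_ge0// invr_ge0 powR_ge0.
  by rewrite (leq_trans _ h) ?leq_maxr// mul1r PF// (leq_trans _ h)// leq_maxl.
have S : (\sum_(N <oo) P (G N) < +oo)%E.
  apply: (@le_lt_trans _ _ (C * eta^-1)%:E); last exact: ltry.
  apply: lime_le; first exact: is_cvg_nneseries.
  apply: nearW => k.
  apply: (@le_trans _ _ (\sum_(0 <= N < k)
      ((2 <= N)%N%:R * (C * (N%:R `^ (1 + eta))^-1))%:E)%E).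
    exact: lee_sum.
  rewrite sumEFin lee_fin.
  have [k2|k2] := leqP k 2.
    rewrite big_nat_cond big1 ?mulr_ge0 ?invr_ge0 ?(ltW eta0)// => N /andP[/andP[_ Nk] _].
    by rewrite leqNgt (leq_trans Nk k2) mul0r.
  rewrite (big_cat_nat (n := 2)) ?(ltnW k2)//= big_nat_cond big1 ?add0r; last first.
    by move=> N /andP[/andP[_ Nk] _]; rewrite leqNgt Nk mul0r.
  rewrite (eq_big_nat _ _ (F2 := fun N => C * (N%:R `^ (1 + eta))^-1)); last first.
    by move=> N /andP[-> _]; rewrite mul1r.
  by rewrite -mulr_sumr ler_wpM2l// sum_powR_le.
have L0 := lim_sup_set_cvg0 mG S.
exists (lim_sup_set G); split => //.
  apply: bigcap_measurable => // k _; exact: bigcup_measurable.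
move=> t /= nt k _; apply: contrapT => nk; apply: nt.
exists (maxn k N1') => N; rewrite geq_max => /andP[kN N1N] FN; apply: nk.
by exists N => //; rewrite /G N1N.
Qed.

(** To be read with [Y] the fourth root of [N], [s] the square root of the number of path points,
    and [Y ^+ 4] the inverse mesh. The rounding error and n times the Lindeberg error together are
    then O(1 / [Y]). *)
Lemma error_bound (R : realType) (Y s c B b1 b2 K e : R) :
  1 <= Y -> Y ^+ 2 <= s -> s <= c * Y ^+ 2 -> 0 <= B -> B <= Y ->
  Y ^+ 4 <= b1 -> Y ^+ 4 <= b2 -> 0 <= K -> 0 < e -> e <= 1 ->
  s / Y ^+ 4 / e + s ^+ 2 * (e ^- 4 * (((Y ^+ 4)^-1 + K / b1) / s +
      2 * (2 * B / Y ^+ 4 + K / b2) / s ^+ 2 +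
      6 * B * (1 + (2 * B / Y ^+ 4 + K / b2)) / (s ^+ 2 * s) +
      9 / (s ^+ 2) ^+ 2)) <=
  e ^- 4 * (c + c * (1 + K) + 2 * (2 + K) + 6 * (3 + K) + 9) / Y.
Proof.
move=> Y1 Ys sc B0 BY Yb1 Yb2 K0 e0 e1.
have Y0 : 0 < Y by exact: lt_le_trans Y1.
have Y20 : 0 < Y ^+ 2 by rewrite exprn_gt0.
have Y40 : 0 < Y ^+ 4 by rewrite exprn_gt0.
have s0 : 0 < s by exact: lt_le_trans Ys.
have c0 : 0 < c by rewrite -(pmulr_lgt0 _ Y20); exact: lt_le_trans sc.
have E0 : 0 <= e ^- 4 by rewrite invr_ge0 exprn_ge0// ltW.
have E1 : e^-1 <= e ^- 4.
  by rewrite lef_pV2 ?posrE ?exprn_gt0// -[leRHS]expr1 ler_wiXn2l// ltW.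
have V k : (1 <= k)%N -> Y ^- k <= Y^-1.
  move=> k1; rewrite lef_pV2 ?posrE ?exprn_gt0// -[leLHS]expr1 ler_weXn2l//.
have D (b : R) : Y ^+ 4 <= b -> K / b <= K / Y ^+ 4.
  by move=> h; rewrite ler_wpM2l// lef_pV2// posrE (lt_le_trans Y40).
have x1 : s / Y ^+ 4 <= c * Y ^- 2.
  by rewrite ler_pdivrMr// (le_trans sc)// -mulrA ler_wpM2l ?(ltW c0)//
    (_ : Y ^- 2 * Y ^+ 4 = Y ^+ 2)//; field; rewrite gt_eqF.
have c0' := ltW c0; have VY0 : 0 <= Y^-1 by rewrite invr_ge0 ltW.
have t1 : s / Y ^+ 4 / e <= e ^- 4 * c * Y^-1.
  rewrite mulrC -mulrA ler_pM ?invr_ge0 ?divr_ge0 ?(ltW s0) ?(ltW e0) ?(ltW Y40)//.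
  by rewrite (le_trans x1)// ler_wpM2l// V.
have t2 : s * ((Y ^+ 4)^-1 + K / b1) <= c * (1 + K) * Y^-1.
  apply: (@le_trans _ _ (s / Y ^+ 4 * (1 + K))).
    rewrite (_ : s / Y ^+ 4 * (1 + K) = s * ((Y ^+ 4)^-1 + K / Y ^+ 4)); last by ring.
    by rewrite ler_wpM2l ?(ltW s0)// lerD2l D.
  rewrite [leRHS]mulrAC ler_wpM2r ?addr_ge0// (le_trans x1)// ler_wpM2l// V//.
have g4 : 2 * B / Y ^+ 4 + K / b2 <= (2 + K) * Y^-1.
  rewrite [leRHS]mulrDl lerD//; last by rewrite (le_trans (D _ Yb2))// ler_wpM2l// V.
  rewrite -mulrA ler_wpM2l// ler_pdivrMr// (le_trans BY)//.
  rewrite (_ : Y^-1 * Y ^+ 4 = Y * Y ^+ 2); last by field; rewrite gt_eqF.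
  by rewrite ler_peMr ?(ltW Y0)// exprn_ege1.
have Y1' : Y^-1 <= 1 by rewrite invf_le1.
have K2 : 0 <= 2 + K by rewrite addr_ge0.
have g5 : 2 * B / Y ^+ 4 + K / b2 <= 2 + K.
  by rewrite (le_trans g4)// ler_piMr.
have t4 : 6 * B * (1 + (2 * B / Y ^+ 4 + K / b2)) / s <= 6 * (3 + K) * Y^-1.
  rewrite ler_pdivrMr//; apply: (@le_trans _ _ (6 * Y * (3 + K))).
    have b20 : 0 <= b2 by exact: le_trans (ltW Y40) Yb2.
    have a1 : 0 <= 6 * B by rewrite mulr_ge0.
    have a2 : 0 <= 1 + (2 * B / Y ^+ 4 + K / b2).
      by rewrite !addr_ge0// divr_ge0// ?mulr_ge0// ltW.
    have a3 : 6 * B <= 6 * Y by rewrite ler_wpM2l.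
    by apply: ler_pM a1 a2 a3 _; lra.
  rewrite (_ : 6 * Y * (3 + K) = 6 * (3 + K) * (Y^-1 * Y ^+ 2)); last first.
    by field; rewrite gt_eqF.
  have K3 : 0 <= 6 * (3 + K) by rewrite mulr_ge0// addr_ge0.
  by rewrite -[leRHS]mulrA; apply: ler_wpM2l => //; apply: ler_wpM2l.
have t5 : 9 / s ^+ 2 <= 9 * Y^-1.
  rewrite ler_wpM2l// lef_pV2 ?posrE ?exprn_gt0//.
  apply: (@le_trans _ _ (s * 1)).
    by rewrite mulr1 (le_trans _ Ys)// -[leLHS]expr1 ler_weXn2l.
  by rewrite expr2 ler_wpM2l ?(ltW s0)// (le_trans _ Ys)// exprn_ege1.
have sn : s != 0 by rewrite gt_eqF.
rewrite (_ : s ^+ 2 * _ = e ^- 4 * (s * ((Y ^+ 4)^-1 + K / b1) +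
   2 * (2 * B / Y ^+ 4 + K / b2) +
   6 * B * (1 + (2 * B / Y ^+ 4 + K / b2)) / s + 9 / s ^+ 2)); last first.
  rewrite mulrCA; congr (_ * _).
  set u := (Y ^+ 4)^-1 + K / b1; set u' := 2 * B / Y ^+ 4 + K / b2.
  by clearbody u u'; field.
apply: (@le_trans _ _ (e ^- 4 * c * Y^-1 + e ^- 4 * (c * (1 + K) * Y^-1 +
    2 * ((2 + K) * Y^-1) + 6 * (3 + K) * Y^-1 + 9 * Y^-1))).
  by rewrite lerD// ler_wpM2l// !lerD// ler_wpM2l.
by rewrite le_eqVlt; apply/orP; left; apply/eqP; ring.
Qed.

Section asymptotics.
Context {R : realType} (l : nat).
Variables (xi : R) (xi_ zeta_ : 'I_l -> R).
Hypothesis hxi : 0 < xi.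
Hypothesis hxi_ : forall i, 0 < xi_ i < xi.
Hypothesis hxi_lt : forall i j : 'I_l, (i < j)%N -> xi_ i < xi_ j.
Hypothesis hzeta_ : forall i, 0 < zeta_ i < 1.
Hypothesis hzeta_lt : forall i j : 'I_l, (i < j)%N -> zeta_ i < zeta_ j.

Definition targets (N : nat) (i : 'I_l) : nat * nat :=
  (scaled (xi_ i) N, scaled (zeta_ i) N).

Lemma paths_through_asymptotics : exists2 CV : R, 0 < CV &
  exists N0 : nat, forall N, (N0 <= N)%N -> let M := scaled xi N in
  [/\ (0 < M)%N, (0 < N)%N, (0 < #|paths_through M N (targets N)|)%N &
    \sum_(z <- box M N) visit M N (targets N) z ^+ 2 <=
      CV * Num.sqrt (M + N - 1)%:R].
Proof.
have [b b0 [N0 H]] := pin_asymptotics hxi hxi_ hxi_lt hzeta_ hzeta_lt.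
exists ((l.+2)%:R * (16 / b + 1)).
  by rewrite mulr_gt0// addr_gt0// divr_gt0.
(* The second threshold makes [xi * N] at least 1, so that the box is not empty. *)
exists (maxn N0 (Num.truncn xi^-1).+1) => N; rewrite geq_max => /andP[N0N xN] M.
have N_gt0 : (0 < N)%N by exact: leq_ltn_trans xN.
have M_gt0 : (0 < M)%N.
  rewrite /M /scaled truncn_gt0 -ler_pdivrMl// mulr1.
  apply: (@le_trans _ _ (Num.truncn xi^-1).+1%:R); last by rewrite ler_nat.
  by rewrite ltW// truncnS_gt.
have {}H := H N N0N; rewrite -/M -/(targets N) in H.
clearbody M; case: M M_gt0 H => [//|M'] _ H.
case: N N_gt0 H {N0N xN} => [//|N'] _ H.
have p1 j : (j < l.+1)%N -> _ := fun jl => let: And3 h _ _ := H j jl in h.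
have p2 j : (j < l.+1)%N -> _ := fun jl => let: And3 _ h _ := H j jl in h.
have p3 j : (j < l.+1)%N -> _ := fun jl => let: And3 _ _ h := H j jl in h.
split => //; first exact: paths_through_neq0 p1 p2.
have -> : (M'.+1 + N'.+1 - 1)%N = (M' + N').+1 by rewrite addSn addnS subSS subn0.
apply: sum_visit_sq => //; first exact: uniq_box.
by move=> z; rewrite mem_box => /and4P[].
Qed.

End asymptotics.

(** The midpoint of 3/p and 1/4. The last two inequalities make [B ^ (p - 1)] and [B ^ (p - 2)] at
    least [N] for [B = N ^ nu], which bounds the bias from truncation by a constant multiple of the
    mesh. *)
Lemma exponent_choice (R : realType) (p : R) : 12 < p ->
  exists nu : R, [/\ 0 < nu, nu < 4^-1, 3 < nu * p, 1 <= nu * (p - 1) &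
    1 <= nu * (p - 2)].
Proof.
move=> hp; have p0 : 0 < p by lra.
have p3 : 3 / p < 4^-1 by rewrite ltr_pdivrMr//; lra.
have p30 : 0 < 3 / p by rewrite divr_gt0.
pose nu : R := (3 / p + 4^-1) / 2.
have nup : 3 < nu * p by rewrite -ltr_pdivrMr// /nu; lra.
exists nu; split=> //; try (rewrite /nu; lra).
- rewrite mulrBr mulr1; have : nu < 4^-1 by rewrite /nu; lra.
  lra.
- rewrite mulrBr; have : nu < 4^-1 by rewrite /nu; lra.
  lra.
Qed.

Section almost_sure.
Context {R : realType} (d : measure_display) (Omega : measurableType d)
  (P : probability Omega R) (w : nat * nat -> {RV P >-> R}) (xi p K : R).
Variables (l : nat) (xi_ zeta_ : 'I_l -> R).
Hypotheses (hxi : 0 < xi) (hp : 12 < p) (hK : 0 < K).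
Hypothesis hindep : independent_RVs quadrant w.
Hypothesis hmean : forall z, quadrant z -> ('E_P[w z] = 0)%E.
Hypothesis hvar : forall z, quadrant z -> ('E_P[fun t => (w z t ^+ 2)%R] = 1)%E.
Hypothesis hmom : forall z, quadrant z ->
  ('E_P[fun t => (`|w z t| `^ p)%R] <= K%:E)%E.
Hypothesis hxi_ : forall i, 0 < xi_ i < xi.
Hypothesis hxi_lt : forall i j : 'I_l, (i < j)%N -> xi_ i < xi_ j.
Hypothesis hzeta_ : forall i, 0 < zeta_ i < 1.
Hypothesis hzeta_lt : forall i j : 'I_l, (i < j)%N -> zeta_ i < zeta_ j.

Let avg (N : nat) (x0 e : R) (omega : Omega) : R :=
  smooth_avg (scaled xi N) N (targets xi_ zeta_ N) x0 e (fun z => w z omega).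

(* With B = N^nu and theta = N^(1/4 - nu): 3/p < nu makes the truncation
   probabilities N^2 / B^p summable, nu < 1/4 makes the fluctuations small. *)
Lemma smooth_avg_ae (x0 e delta : R) : 0 < e -> e <= 1 -> 0 < delta ->
  {ae P, forall omega, exists N2, forall N, (N2 <= N)%N ->
    `|avg N x0 e omega - gauss_cdf (x0 / Num.sqrt (e ^+ 2 + 1))| <= 2 * delta}.
Proof.
move=> e0 e1 delta0.
have p0 : 0 < p by apply: lt_trans hp.
have [nu [nu0 nu4 nup nu1 nu2]] := exponent_choice hp.
pose g : R := 4^-1 - nu.
have g0 : 0 < g by rewrite subr_gt0.
(* The truncation leaves N^(2 - nu p) <= N^(-1 - eta); the cap at 1 lets the decay N^(-2) of the
   other term suffice as well. *)
pose eta : R := Num.min (nu * p - 3) 1.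
have eta0 : 0 < eta by rewrite lt_min subr_gt0 nup ltr01.
have eta1 : eta <= 1 by rewrite ge_min lexx orbT.
have eta3 : eta <= nu * p - 3 by rewrite ge_min lexx.
(* With this many powers, [expRN_le_pow] bounds [expR (- (theta * delta))] by a multiple of N^(-2),
   because [theta ^+ k.+1] is at least [N ^+ 2]. *)
pose k := Num.truncn (2 / g).
have kg : 2 <= g * k.+1%:R.
  by rewrite -ler_pdivrMl// mulrC ltW// truncnS_gt.
have [CV CV0 [N0 HN0]] :=
  paths_through_asymptotics hxi hxi_ hxi_lt hzeta_ hzeta_lt.
pose C : R := xi * K + 2 * (expR (8 * CV / e ^+ 2) * (k.+1`!%:R / delta ^+ k.+1)).
have C0 : 0 <= C.
  rewrite addr_ge0//; first by rewrite mulr_ge0 ?ltW.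
  by rewrite !mulr_ge0 ?expR_ge0// invr_ge0 exprn_ge0// ltW.
pose c1 : R := xi + 1.
pose E : R := e ^- 4 * (c1 + c1 * (1 + K) + 2 * (2 + K) + 6 * (3 + K) + 9).
have c10 : 0 <= c1 by rewrite addr_ge0 ?(ltW hxi).
have E0 : 0 <= E.
  rewrite mulr_ge0 ?invr_ge0 ?exprn_ge0 ?(ltW e0)//.
  by rewrite !addr_ge0// ?mulr_ge0// ?addr_ge0// ltW.
(* Beyond [T ^+ 4] the fourth root [Y] of [N] is at least [T]. The summand [2 / e] ensures
   [theta * c <= 1] in [quenched_deviation], and [E / delta] makes the deterministic errors at most
   [delta]. *)
pose T : R := 1 + 2 / e + E / delta.
have T1 : 1 <= T.
  by rewrite /T -addrA lerDl addr_ge0// divr_ge0// ltW.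
pose N1 := maxn N0 (Num.truncn (T ^+ 4)).+1.
(* The existential precedes the condition on [N], so that [choice] selects the exceptional events
   for all [N] simultaneously. *)
have step N : exists Bad : set Omega, (N1 <= N)%N -> [/\ measurable Bad,
    (P Bad <= (C * (N%:R `^ (1 + eta))^-1)%:E)%E &
    forall omega, ~ Bad omega ->
      `|avg N x0 e omega - gauss_cdf (x0 / Num.sqrt (e ^+ 2 + 1))| <= 2 * delta].
  have [N1N|] := leqP N1 N; last by exists set0.
  have /andP[N0N TN] : (N0 <= N)%N && ((Num.truncn (T ^+ 4)).+1 <= N)%N.
    by rewrite -geq_max.
  have [M_gt0 N_gt0 A0 HV] := HN0 N N0N.
  set M := scaled xi N in M_gt0 A0 HV.
  pose X : R := N%:R.
  have TX : T ^+ 4 <= X.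
    by apply: (@le_trans _ _ (Num.truncn (T ^+ 4)).+1%:R);
      rewrite ?ler_nat// ltW// truncnS_gt.
  have X1 : 1 <= X by rewrite (le_trans _ TX)// exprn_ege1.
  have X0 : 0 < X by exact: lt_le_trans X1.
  have X0' : X != 0 by rewrite gt_eqF.
  pose Y : R := X `^ (4^-1).
  have YX : Y ^+ 4 = X.
    rewrite -powR_mulrn ?powR_ge0// -powRrM mulVf ?powRr1 ?(ltW X0)//.
  have Y0 : 0 <= Y by exact: powR_ge0.
  have TY : T <= Y.
    rewrite leNgt; apply/negP => YT; have := TX; rewrite -YX leNgt => /negP; apply.
    by rewrite ltrXn2r// nnegrE.
  have Y1 : 1 <= Y by exact: le_trans TY.
  have Ypos : 0 < Y by exact: lt_le_trans Y1.
  pose n : R := (M + N - 1)%:R.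
  have nX : X <= n.
    by rewrite ler_nat leq_subRL ?addn_gt0 ?M_gt0// leq_add2r.
  have MX : M%:R <= xi * X by rewrite truncn_le mulr_ge0// ltW.
  have nc : n <= c1 * X.
    rewrite (@le_trans _ _ (M + N)%:R) ?ler_nat ?leq_subr//.
    by rewrite natrD mulrDl mul1r lerD2r.
  have n0 : 0 < n by exact: lt_le_trans nX.
  pose s := Num.sqrt n.
  have s2 : s ^+ 2 = n by rewrite sqr_sqrtr// ltW.
  have s0 : 0 < s by rewrite sqrtr_gt0.
  have Ys : Y ^+ 2 <= s.
    rewrite -(ler_pXn2r (n := 2)) ?nnegrE ?exprn_ge0 ?(ltW s0)//.
    by rewrite -exprM YX s2.
  have sc : s <= c1 * Y ^+ 2.
    rewrite -(ler_pXn2r (n := 2)) ?nnegrE ?mulr_ge0 ?exprn_ge0 ?(ltW s0)//.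
    rewrite exprMn -exprM YX s2 (le_trans nc)// ler_wpM2r ?(ltW X0)//.
    by rewrite expr2 ler_peMl// /c1 lerDr ltW.
  pose B : R := X `^ nu; pose theta : R := X `^ g.
  have B0 : 0 < B by rewrite powR_gt0.
  have theta0 : 0 <= theta by exact: powR_ge0.
  have thB : theta * B = Y.
    by rewrite /theta /B -powRD ?X0' ?implybT// /g subrK.
  have BY : B <= Y by rewrite ler_powR// ltW.
  have b1 : Y ^+ 4 <= B `^ (p - 1).
    by rewrite YX -powRrM -[leLHS](powRr1 (ltW X0)) ler_powR.
  have b2 : Y ^+ 4 <= B `^ (p - 2).
    by rewrite YX -powRrM -[leLHS](powRr1 (ltW X0)) ler_powR.
  have thc : theta * (2 * B / (e * s)) = 2 * Y / (e * s).
    by rewrite -thB; ring.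
  have thc2 : 2 * Y / (e * s) <= 2 / e / Y.
    rewrite ler_pdivrMr ?mulr_gt0//.
    rewrite (_ : 2 / e / Y * (e * s) = 2 * (s / Y)); last by field; rewrite !gt_eqF.
    rewrite ler_wpM2l// ler_pdivlMr// -expr2//.
  have p2 : 2 <= p by rewrite (le_trans _ (ltW hp))// ler_nat.
  pose err := e ^- 4 * ((X^-1 + K / B `^ (p - 1)) / s +
      2 * (2 * B / X + K / B `^ (p - 2)) / n +
      6 * B * (1 + (2 * B / X + K / B `^ (p - 2))) / (n * s) +
      9 / n ^+ 2).
  have YTe : 2 / e / Y <= 1.
    rewrite ler_pdivrMr// mul1r (le_trans _ TY)// /T.
    have : 0 <= E / delta by rewrite divr_ge0// ltW.
    lra.
  have [|Bad [mBad PBad HBad]] := @quenched_deviation R d Omega P w p K p2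
    hindep hmean hvar hmom M N l (targets xi_ zeta_ N) x0 e M_gt0 N_gt0 e0 e1 A0
    (CV * s) B X theta delta err B0 X0 theta0 HV _ (lexx err).
    by rewrite -/n -/s thc (le_trans thc2).
  exists Bad => _; split => //.
    apply: (le_trans PBad); rewrite lee_fin -/n -/s.
    set r := (N%:R `^ (1 + eta))^-1.
    have r0 : 0 <= r by rewrite invr_ge0 powR_ge0.
    have X1e : 0 < X `^ (1 + eta) by rewrite powR_gt0.
    rewrite /C [leRHS]mulrDl lerD//.
      have -> : (M * N)%:R = M%:R * X :> R by rewrite natrM.
      apply: (@le_trans _ _ (xi * X * X * (K / B `^ p))).
        by rewrite ler_wpM2r ?divr_ge0 ?powR_ge0 ?(ltW hK)// ler_wpM2r// ltW.
      rewrite (_ : xi * X * X * (K / B `^ p) = xi * K * (X * X / B `^ p)); last by ring.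
      rewrite ler_wpM2l ?mulr_ge0 ?(ltW hxi) ?(ltW hK)//.
      rewrite ler_pdivrMr ?powR_gt0// -ler_pdivrMl ?invr_gt0// invrK -powRrM.
      rewrite -expr2 -(powR_mulrn 2 (ltW X0)) -powRD ?X0' ?implybT//.
      by rewrite ler_powR//; lra.
    rewrite -[leRHS]mulrA ler_wpM2l// expRD -[leRHS]mulrA.
    apply: ler_pM; rewrite ?expR_ge0//.
      rewrite ler_expR.
      (* As [theta * B] equals [Y], the variance term is [8 * CV / e ^+ 2] times [Y ^+ 2 / s], and
         the last factor is at most 1. *)
      rewrite (_ : 2 * theta ^+ 2 * _ =
        2 * ((theta * (2 * B / (e * s))) ^+ 2 * (CV * s))); last by ring.
      rewrite thc (_ : 2 * _ = 8 * CV / e ^+ 2 * (Y ^+ 2 / s)); last first.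
        by field; rewrite !gt_eqF.
      rewrite ler_piMr ?ler_pdivrMr ?mul1r//.
      by rewrite divr_ge0 ?mulr_ge0 ?exprn_ge0 ?(ltW CV0) ?(ltW e0).
    have th0 : 0 < theta by rewrite powR_gt0.
    apply: (le_trans (expRN_le_pow k (mulr_gt0 th0 delta0))).
    rewrite exprMn invfM mulrA [leLHS]mulrAC.
    rewrite ler_wpM2l ?divr_ge0 ?exprn_ge0 ?(ltW delta0)//.
    have -> : theta ^+ k.+1 = X `^ (g * k.+1%:R).
      by rewrite -(powR_mulrn k.+1 theta0) /theta -powRrM.
    have X2e : 0 < X `^ (g * k.+1%:R) by rewrite powR_gt0.
    rewrite (lef_pV2 X2e X1e).
    by rewrite ler_powR// (le_trans _ kg)//; lra.
  move=> omega nBad; apply: (le_trans (HBad omega nBad)).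
  rewrite -/n -/s (_ : 2 * delta = delta + delta); last by ring.
  rewrite -addrA lerD2l.
  have := error_bound Y1 Ys sc (ltW B0) BY b1 b2 (ltW hK) e0 e1.
  rewrite YX s2 -/err -/E => /le_trans; apply.
  rewrite ler_pdivrMr// mulrC -ler_pdivrMr// (le_trans _ TY)// /T lerDr.
  by rewrite addr_ge0// divr_ge0// ltW.
have [F HF] := choice step.
have := @borel_cantelli_powR R d Omega P F C eta N1 eta0 C0
  (fun N h => let: And3 m _ _ := HF N h in m)
  (fun N h => let: And3 _ m _ := HF N h in m).
apply: filterS => omega [N2 HN2]; exists (maxn N1 N2) => N.
rewrite geq_max => /andP[N1N N2N].
by have [_ _] := HF N N1N; apply; exact: HN2.
Qed.

End almost_sure.

(** * From smoothed indicators to distribution functions *)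

Section sandwich.
Context {R : realType} {M N l : nat}.
Variables (a : 'I_l -> nat * nat) (y : nat * nat -> R).
Let A := paths_through M N a.
Hypothesis A0 : (0 < #|A|)%N.

Definition path_sum_cdf (x : R) : R :=
  #|A|%:R^-1 * \sum_(s in A) (path_sum y s <= x)%R%:R.

Lemma path_sum_lawE x :
  path_sum_law M N a y `]-oo, x]%classic = (path_sum_cdf x)%:E.
Proof.
rewrite /path_sum_law /unif_prob /path_sum_cdf mulrC; congr (_ * _)%:E.
rewrite -sum1_card natr_sum big_mkcondr /=; apply: eq_bigr => s _.
rewrite (_ : (s \in _) = (path_sum y s <= x)); first by case: (_ <= _).
by apply/idP/idP; rewrite inE /= in_itv.
Qed.

Let mean_le (F G : box_path M N -> R) (c : R) :
  (forall s, F s <= G s + c) ->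
  #|A|%:R^-1 * \sum_(s in A) F s <= #|A|%:R^-1 * \sum_(s in A) G s + c.
Proof.
move=> FG; have cA : 0 < #|A|%:R :> R by rewrite ltr0n.
have -> : c = #|A|%:R^-1 * \sum_(s in A) c.
  rewrite sumr_const mulrnAr -mulrnAl -(mulr_natl (#|A|%:R^-1)) mulfV ?mul1r//.
  by rewrite gt_eqF.
by rewrite -mulrDr ler_wpM2l ?invr_ge0// -big_split /=; apply: ler_sum.
Qed.

(** On the event that the path sum is at most [x], monotonicity bounds the smoothed indicator below
    by its value at [x]. The correction is small when [x0] exceeds [x] by many multiples of [e]; the
    companion bound is meant for [x0] below [x]. *)
Lemma path_sum_cdf_le x x0 e : 0 < e -> path_sum_cdf x <=
  smooth_avg M N a x0 e y + (1 - gauss_cdf ((x0 - x) / e)).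
Proof.
move=> e0; apply: mean_le => s /=; case: (leP (path_sum y s) x) => [sx|_].
  rewrite addrCA lerDl subr_ge0 le_gauss_cdf// ler_wpM2r ?invr_ge0 ?(ltW e0)//.
  by rewrite lerD2l lerN2.
by rewrite addr_ge0 ?gauss_cdf_ge0// subr_ge0 gauss_cdf_le1.
Qed.

Lemma path_sum_cdf_ge x x0 e : 0 < e ->
  smooth_avg M N a x0 e y <= path_sum_cdf x + gauss_cdf ((x0 - x) / e).
Proof.
move=> e0; apply: mean_le => s /=; case: (leP (path_sum y s) x) => [sx|xs].
  by rewrite (le_trans (gauss_cdf_le1 _))// lerDl gauss_cdf_ge0.
rewrite add0r le_gauss_cdf// ler_wpM2r ?invr_ge0 ?(ltW e0)//.
by rewrite lerD2l lerN2 ltW.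
Qed.

End sandwich.

Lemma ae_forall_countable {R : realType} (d : measure_display)
    (T : measurableType d) (P : probability T R) (I : countType)
    (Q : I -> T -> Prop) :
  (forall i, {ae P, forall t, Q i t}) -> {ae P, forall t, forall i, Q i t}.
Proof.
move=> H.
have : {ae P, forall t, forall (k : nat) (i : I), @choice.unpickle I k = Some i -> Q i t}.
  apply/ae_foralln => k; case: (@choice.unpickle I k) => [i|].
    by apply: filterS (H i) => t Qt i' [<-].
  by apply: (@filterS _ _ _ setT) => //; exact: filterT.
by apply: filterS => t Qt i; apply: (Qt (choice.pickle i)); rewrite choice.pickleK.
Qed.

Section gauss_scaling.
Context {R : realType}.

(** Removes the excess variance [e ^+ 2] caused by the smoothing. *)
Lemma gauss_cdf_scale (x e : R) :
  `|gauss_cdf (x / Num.sqrt (e ^+ 2 + 1)) - gauss_cdf x| <= `|x| * e ^+ 2.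
Proof.
apply: (le_trans (gauss_cdf_lip _ _)); set r := Num.sqrt _.
have r1 : 1 <= r by rewrite -[leLHS]sqrtr1 ler_wsqrtr// lerDr sqr_ge0.
have r0 : 0 < r by exact: lt_le_trans r1.
have r2 : r ^+ 2 = e ^+ 2 + 1 by rewrite sqr_sqrtr// addr_ge0// sqr_ge0.
have rV : 0 <= 1 - r^-1 by rewrite subr_ge0 invf_le1.
rewrite (_ : x / r - x = - (x * (1 - r^-1))); last by ring.
rewrite normrN normrM ler_wpM2l// ger0_norm//.
have -> : e ^+ 2 = (r - 1) * (r + 1) by rewrite -subr_sqr_1 r2 addrK.
have -> : 1 - r^-1 = (r - 1) * r^-1 by field; rewrite gt_eqF.
rewrite ler_wpM2l ?subr_ge0//.
by apply: (@le_trans _ _ 1); [rewrite invf_le1 | rewrite lerDr ltW].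
Qed.

End gauss_scaling.

Theorem corollary1p2 (R : realType) (d : measure_display)
    (Omega : measurableType d) (P : probability Omega R)
    (w : nat * nat -> {RV P >-> R}) (xi p K : R)
    (l : nat) (xi_ zeta_ : 'I_l -> R)
    (hxi : 0 < xi) (hp : 12 < p) (hK : 0 < K)
    (hindep : independent_RVs quadrant w)
    (hmean : forall z, quadrant z -> ('E_P[w z] = 0)%E)
    (hvar : forall z, quadrant z -> ('E_P[fun t => (w z t ^+ 2)%R] = 1)%E)
    (hmom : forall z, quadrant z ->
      ('E_P[fun t => (`|w z t| `^ p)%R] <= K%:E)%E)
    (hxi_ : forall i, 0 < xi_ i < xi)
    (hxi_lt : forall i j : 'I_l, (i < j)%N -> xi_ i < xi_ j)
    (hzeta_ : forall i, 0 < zeta_ i < 1)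
    (hzeta_lt : forall i j : 'I_l, (i < j)%N -> zeta_ i < zeta_ j) :
  {ae P, forall omega,
    cvg_in_distribution
      (fun N => path_sum_law (scaled xi N) N
                  (fun i => (scaled (xi_ i) N, scaled (zeta_ i) N))
                  (fun z => w z omega))
      (normal_prob 0 1)}.
Proof.
pose avg N x0 e omega := smooth_avg (scaled xi N) N (targets xi_ zeta_ N) x0 e
  (fun z => w z omega) : R.
have inv_gt0 k : 0 < k.+1%:R^-1 :> R by rewrite invr_gt0 ltr0n.
have inv_le1 k : k.+1%:R^-1 <= 1 :> R by rewrite invf_le1 ?ler1n ?ltr0n.
(* The triple holds the rational level and the indices of the smoothing width and of the tolerance.
   Countability makes the exceptional set common to all of them. *)
have : {ae P, forall omega, forall i : rat * nat * nat,
    exists N2, forall N, (N2 <= N)%N ->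
    `|avg N (ratr i.1.1) i.1.2.+1%:R^-1 omega -
      gauss_cdf (ratr i.1.1 / Num.sqrt (i.1.2.+1%:R^-1 ^+ 2 + 1))| <=
    2 * i.2.+1%:R^-1}.
  apply: ae_forall_countable => -[[x0 k] j] /=.
  exact: (smooth_avg_ae hxi hp hK hindep hmean hvar hmom hxi_ hxi_lt hzeta_
    hzeta_lt (ratr x0) (inv_gt0 k) (inv_le1 k) (inv_gt0 j)).
have [CV _ [N0 HN0]] := paths_through_asymptotics hxi hxi_ hxi_lt hzeta_ hzeta_lt.
apply: filterS => omega Homega x _.
pose law N := path_sum_cdf (M := scaled xi N) (N := N) (targets xi_ zeta_ N)
  (fun z => w z omega) x.
rewrite [X in _ --> X]gauss_cdfE.
rewrite (_ : (fun N => _) = EFin \o law); last first.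
  by apply/funext => N; exact: path_sum_lawE.
apply: cvg_EFin; first by apply: nearW => N.
apply/cvgrPdist_le => eps eps0; rewrite /law.
(* Four errors are kept below this size: the excess variance, the move from [x] to a rational level,
   the tolerance in the almost sure statement, and the normal tail in the sandwich. *)
have e8 : 0 < eps / 8 by rewrite divr_gt0.
have small (y : R) : 0 <= y ->
    exists k0, forall k, (k0 <= k)%N -> y * k.+1%:R^-1 <= eps / 8.
  move=> y0; exists (Num.truncn (y / (eps / 8))).+1 => k kk.
  rewrite ler_pdivrMr ?ltr0n// -ler_pdivrMl// mulrC.
  apply: (@le_trans _ _ (Num.truncn (y / (eps / 8))).+1%:R).
    by rewrite ltW// truncnS_gt.
  by rewrite ler_nat leqW.
have [j Hj] := small 2 (ler0n _ _).
(* The width [k.+1%:R^-1] is chosen after the level: it must be so small compared with the gap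
   between [x0] and [x] that the quotient lies in the normal tail beyond [A], and it must also make
   the excess variance negligible. *)
have scale (x0 A gap : R) : 0 < gap -> exists k : nat,
    A <= gap / k.+1%:R^-1 /\
    `|gauss_cdf (x0 / Num.sqrt (k.+1%:R^-1 ^+ 2 + 1)) - gauss_cdf x0| <= eps / 8.
  move=> gap0; have [k0 Hk0] := small `|x0| (normr_ge0 _).
  pose k := maxn k0 (Num.truncn (A / gap)); exists k; split.
    rewrite invrK mulrC -ler_pdivrMr//.
    apply: (@le_trans _ _ (Num.truncn (A / gap)).+1%:R).
      by rewrite ltW// truncnS_gt.
    by rewrite ler_nat ltnS leq_maxr.
  apply: (le_trans (gauss_cdf_scale _ _)).
  apply: le_trans (Hk0 k (leq_maxl _ _)); rewrite ler_wpM2l// expr2.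
  by rewrite ler_piMl// ltW.
have lin (u s f g t q j' y : R) : s - f <= eps / 8 -> f - g <= y - x ->
    j' <= eps / 8 -> u - s <= j' -> t <= eps / 8 -> y < x + eps / 8 ->
    u + t <= g + eps by lra.
have lin' (u s f g t q j' y : R) : - (eps / 8) <= s - f -> g - f <= x - y ->
    j' <= eps / 8 -> - j' <= u - s -> t <= eps / 8 -> u <= q + t ->
    x - eps / 8 < y -> g - eps <= q by lra.
have upper : exists N2, forall N, (N2 <= N)%N -> law N <= gauss_cdf x + eps.
  have [A HA] : exists A : R, forall u, A <= u -> 1 - gauss_cdf u <= eps / 8.
    have /cvgrPdist_le/(_ _ e8)[A [_ HA]] := @gauss_cdf_cvgy R.
    exists (A + 1) => u Au; apply: le_trans (ler_norm _) _; apply: HA.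
    by rewrite (lt_le_trans _ Au)// ltrDl.
  (* The level lies strictly above [x] to leave room for the smoothing, and within [eps / 8] so that
     the 1-Lipschitz [gauss_cdf] hardly changes. *)
  have [x0] := @rat_in_itvoo R x (x + eps / 8) (ltr_pwDr e8 (lexx _)).
  rewrite in_itv /= => /andP[xx0 x0e].
  have [k [kA kx0]] := scale (ratr x0) A (ratr x0 - x) (ltac:(by rewrite subr_gt0)).
  have [N2 HN2] := Homega (x0, k, j); exists (maxn N0 N2) => N.
  rewrite geq_max => /andP[N0N N2N].
  have [_ _ A0 _] := HN0 N N0N.
  apply: (le_trans (@path_sum_cdf_le _ _ _ _ _ (fun z => w z omega) A0 x (ratr x0) _
    (inv_gt0 k))).
  have := HA _ kA; have := HN2 N N2N; rewrite /= -/(avg N _ _ omega).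
  have := Hj j (leqnn j); have := gauss_cdf_lip (ratr x0) x.
  rewrite (ger0_norm (x := ratr x0 - x)) ?subr_ge0 ?(ltW xx0)//.
  move: kx0; rewrite !ler_norml => /andP[_ h1] /andP[_ h2] h3 /andP[_ h4] h5.
  move: x0e => h6; rewrite /avg in h4 *.
  exact: (lin _ _ _ _ _ 0 _ _ h1 h2 h3 h4 h5 h6).
have lower : exists N2, forall N, (N2 <= N)%N -> gauss_cdf x - eps <= law N.
  have [A HA] : exists A : R, forall u, A <= u -> gauss_cdf (- u) <= eps / 8.
    have /cvgrPdist_le/(_ _ e8)[A [_ HA]] := @gauss_cdf_cvgNy R.
    exists (- A + 1) => u Au; have := HA (- u).
    rewrite sub0r normrN => h; apply: le_trans (ler_norm _) _; apply: h.
    by rewrite ltrNl (lt_le_trans _ Au)// ltrDl.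
  have [x0] := @rat_in_itvoo R (x - eps / 8) x (ltac:(by rewrite ltrBlDr ltrDl)).
  rewrite in_itv /= => /andP[x0e xx0].
  have [k [kA kx0]] := scale (ratr x0) A (x - ratr x0) (ltac:(by rewrite subr_gt0)).
  have [N2 HN2] := Homega (x0, k, j); exists (maxn N0 N2) => N.
  rewrite geq_max => /andP[N0N N2N].
  have [_ _ A0 _] := HN0 N N0N.
  have := @path_sum_cdf_ge _ _ _ _ _ (fun z => w z omega) A0 x (ratr x0) _
    (inv_gt0 k).
  have := HA _ kA; rewrite -mulNr opprB; have := HN2 N N2N.
  rewrite /= -/(avg N _ _ omega).
  have := Hj j (leqnn j); have := gauss_cdf_lip x (ratr x0).
  rewrite (ger0_norm (x := x - ratr x0)) ?subr_ge0 ?(ltW xx0)//.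
  move: kx0; rewrite !ler_norml => /andP[h1 _] /andP[_ h2] h3 /andP[h4 _] h5 h8.
  rewrite /avg in h4; exact: (lin' _ _ _ _ _ _ _ _ h1 h2 h3 h4 h5 h8 x0e).
have [N2 HU] := upper; have [N3 HL] := lower.
near=> N.
have N2N : (N2 <= N)%N by near: N; exact: nbhs_infty_ge.
have N3N : (N3 <= N)%N by near: N; exact: nbhs_infty_ge.
have := HU N N2N; have := HL N N3N => h1 h2.
by rewrite -[X in _ - X]/(law N) ler_norml; apply/andP; split;
  move: h1 h2; lra.
Unshelve. all: by end_near. Qed.
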